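(* Let $\{\varphi_n : n\in\mathbb{N}^d\}$ be an orthonormal basis in $\mathcal{P}$ (with respect to $[\cdot,\cdot]_k$) such that $\varphi_n\in\mathcal{P}_{|n|}$ and the coefficients of the $\varphi_n$'s are real. For $j=1,\ldots,d$ let $\widehat{\mathbb{N}}^d_j$ denote the set of those $n\in\mathbb{N}^d$ for which $T_j^k\varphi_n$ does not vanish identically. Assume, in addition, that for every $j=1,\ldots,d$: (i) the system $\{T_j^k\varphi_n : n\in\widehat{\mathbb{N}}^d_j\}$ is orthogonal in $(\mathcal{P},[\cdot,\cdot]_k)$; (ii) there is a constant $C$ such that $\|T_j^k\varphi_n\|_{[\,,\,]_k}\le C(|n|+1)^{1/2}$ for all $n\in\widehat{\mathbb{N}}^d_j$. Then, for every $j=1,\ldots,d$, the operator $R_j^k$ defined by $$R^{k}_jf=\sum_{n\in\mathbb{N}^d} (2|n|+2\gamma+d)^{-1/2}\langle f,h_n^{k} \rangle_{k}\; \delta_jh_n^{k}$$ for $f=\sum_{n\in\mathbb{N}^d}\langle f,h_n^k\rangle_k h_n^k\in L^2(\mathbb{R}^d,w_k)$ is bounded on $L^2(\mathbb{R}^d,w_k)$.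
   Context: Notation: $\mathbb{N}=\{0,1,2,\ldots\}$; for $n\in\mathbb{N}^d$, $|n|=n_1+\ldots+n_d$ and $n!=n_1!\cdots n_d!$. Let $G\subset O(\mathbb{R}^d)$ be a finite reflection group, $R\subset\mathbb{R}^d$ a root system associated with the reflections of $G$, $k\colon R\to[0,\infty)$ a $G$-invariant nonnegative multiplicity function, and $R_+$ a fixed positive subsystem of $R$. For $\beta\in R$, $\sigma_\beta$ is the reflection in the hyperplane orthogonal to $\beta$. The Dunkl operators are $$T_j^{k}f(x)=\partial_j f(x) +\sum_{\beta\in R_+}k(\beta)\beta_j\frac{f(x)-f(\sigma_\beta x)}{\langle\beta,x\rangle},\quad f\in C^1(\mathbb{R}^d),\ j=1,\ldots,d;$$ they commute with each other. Put $\Delta_k=\sum_{j=1}^d(T_j^k)^2$, $\gamma=\sum_{\beta\in R_+}k(\beta)$, and $$w_k(x)=\prod_{\beta\in R_+}|\langle\beta,x\rangle|^{2k(\beta)}.$$ $L^2(\mathbb{R}^d,w_k)$ is the $L^2$ space for the measure $w_k(x)\,dx$, with inner product $\langle f,g\rangle_k=\int_{\mathbb{R}^d}f\overline{g}\,w_k\,dx$. $\mathcal{P}$ is the space of all polynomials on $\mathbb{R}^d$, and $\mathcal{P}_m$ is the subspace of homogeneous polynomials of total degree $m$; one has $T_j^k\mathcal{P}_m\subset\mathcal{P}_{m-1}$ (with $\mathcal P_{-1}=\{0\}$). $\mathcal{P}$ is equipped with the generalized Fischer inner product $[p,q]_k=(p(T^k)q)(0)$, where $p(T^k)$ is obtained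 from $p(x)$ by replacing each $x_j$ by $T_j^k$; $\|\cdot\|_{[\,,\,]_k}$ is the induced norm. Given the orthonormal basis $\{\varphi_n\}$, the generalized Hermite polynomials are $H_n^{k}=2^{|n|}\sqrt{n!}\,\exp(-\Delta_{k}/4) \varphi_n$ (the exponential series terminates on polynomials), and the generalized Hermite functions are $$h_n^{k}(x)=\Big(\frac{1}{2^{|n|}n!\,c_{k}}\Big)^{1/2}e^{-\|x\|^2/2}H_n^{k}(x),\qquad c_k=\int_{\mathbb{R}^d}e^{-\|x\|^2}w_k(x)\,dx.$$ The system $\{h_n^k: n\in\mathbb{N}^d\}$ is an orthonormal basis of $L^2(\mathbb{R}^d,w_k)$ (consisting of eigenfunctions of $-\Delta_k+\|x\|^2$ with eigenvalues $2|n|+2\gamma+d$). Finally, $\delta_j=T_j^k+x_j$. *)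

(* Defs.v *)
From HB Require Import structures.
From mathcomp Require Import all_boot all_order all_algebra finmap complex.
(* The notations of mpoly clash with those of analysis, hence the filter. *)
From mathcomp Require Import -(notations) mpoly.
From mathcomp Require Import all_classical all_reals all_analysis.
From mathcomp.analysis Require Import showcase.summability.
Set Implicit Arguments.
Unset Strict Implicit.
Unset Printing Implicit Defensive.
Import Order.TTheory GRing.Theory Num.Theory.
Import numFieldNormedType.Exports.
Local Open Scope classical_set_scope.
Local Open Scope complex_scope.
Local Open Scope ring_scope.

(* Points of R^d are row vectors; linear maps act on the right, x |-> x *m g. *)

Section ReflectionGroups.
Context {R : realType} {d : nat}.
Implicit Types (x y u b : 'rV[R]_d) (g h : 'M[R]_d).

Definition dotp x y : R := \sum_(i < d) x 0 i * y 0 i.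

Definition reflect_in b x : 'rV[R]_d := x - (2 * dotp b x / dotp b b) *: b.

Definition is_reflection_along b g : Prop :=
  b != 0 /\ forall x, x *m g = reflect_in b x.

Definition is_reflection g : Prop := exists b, is_reflection_along b g.

Definition finite_reflection_group (G : {fset 'M[R]_d}) : Prop :=
  [/\ forall g, g \in G -> g *m g^T = 1%:M,
      1%:M \in G,
      forall g h, g \in G -> h \in G -> g *m h \in G,
      forall g, g \in G -> invmx g \in G
    & forall g, g \in G -> exists s : seq 'M[R]_d,
        (forall h, h \in s -> h \in G /\ is_reflection h) /\
        g = \big[mulmx/1%:M]_(h <- s) h].

Definition root_system (Phi : {fset 'rV[R]_d}) : Prop :=
  [/\ 0 \notin Phi,
      forall b c, b \in Phi -> (c *: b \in Phi) = (c == 1) || (c == -1)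
    & forall a b, a \in Phi -> b \in Phi -> reflect_in a b \in Phi].

(* The reflections belonging to G are exactly those along the roots. *)
Definition root_system_of (G : {fset 'M[R]_d}) (Phi : {fset 'rV[R]_d}) : Prop :=
  root_system Phi /\
  forall g, (g \in G /\ is_reflection g) <->
            (exists2 b, b \in Phi & is_reflection_along b g).

Definition positive_subsystem (Phi Phip : {fset 'rV[R]_d}) : Prop :=
  exists u, (forall b, b \in Phi -> dotp b u != 0) /\
            (forall b, (b \in Phip) = (b \in Phi) && (0 < dotp b u)).

Definition multiplicity (G : {fset 'M[R]_d}) (Phi : {fset 'rV[R]_d})
    (k : 'rV[R]_d -> R) : Prop :=
  (forall b, b \in Phi -> 0 <= k b) /\
  (forall g b, g \in G -> b \in Phi -> k (b *m g) = k b).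

End ReflectionGroups.

Section Lebesgue.
Context {R : realType}.

Definition rV_of_tuple d (t : d.-tuple R) : 'rV[R]_d := \row_i tnth t i.

Fixpoint lebesgue_tuple (d : nat) : set (d.-tuple R) -> \bar R :=
  match d with
  | 0 => \d_ [tuple]
  | d'.+1 => pushforward (lebesgue_measure \x lebesgue_tuple (d := d'))%E
               (fun p : R * d'.-tuple R => [tuple of p.1 :: p.2])
  end.

(* Integral over R^d with respect to the (Borel) Lebesgue measure. *)
Definition integral_rV d (F : 'rV[R]_d -> \bar R) : \bar R :=
  (\int[@lebesgue_tuple d]_t F (rV_of_tuple t))%E.

Definition measurable_rV d (F : 'rV[R]_d -> R) : Prop :=
  measurable_fun [set: d.-tuple R] (fun t => F (rV_of_tuple t)).

End Lebesgue.

Section Dunkl.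
Context {R : realType} {d : nat}.
Variables (Rp : {fset 'rV[R]_d}) (k : 'rV[R]_d -> R).
Implicit Types (x b : 'rV[R]_d) (p q : mpoly d R) (n m : multinom d).
Implicit Types (j : 'I_d).

Definition gamma : R := \sum_(b <- Rp) k b.

Definition weight x : R := \prod_(b <- Rp) (`|dotp b x| `^ (2 * k b)).

(* (f x - f (sigma_b x)) / <b, x>; on the hyperplane <b, x> = 0 the value is the
   limit 2 |b|^-2 D_b f x, so that the quotient is continuous when f is C^1. *)
Definition divided_difference b (f : 'rV[R]_d -> R) x : R :=
  if dotp b x == 0 then 2 / dotp b b * 'D_b f x
  else (f x - f (reflect_in b x)) / dotp b x.

Definition dunkl j (f : 'rV[R]_d -> R) x : R :=
  'D_(delta_mx 0 j) f x +
  \sum_(b <- Rp) k b * b 0 j * divided_difference b f x.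

Definition mpoly_fun p x : R := meval (fun i => x 0 i) p.

(* T_j on polynomials: the polynomial whose function is T_j of the function of
   p. It is unique, and it exists since f - f \o sigma_b is divisible by <b, .>
   when f is polynomial. *)
Definition dunklP j p : mpoly d R :=
  xget 0 [set q | forall x, mpoly_fun q x = dunkl j (mpoly_fun p) x].

(* T^m = T_0^(m 0) ... T_(d-1)^(m (d-1)); the T_j commute. *)
Definition dunkl_monomial m q : mpoly d R :=
  foldr (fun i r => iter (m i) (dunklP i) r) q (enum 'I_d).

Definition dunkl_subst p q : mpoly d R :=
  \sum_(m <- msupp p) mcoeff m p *: dunkl_monomial m q.

Definition fischer p q : R := mpoly_fun (dunkl_subst p q) 0.

Definition fischer_norm p : R := Num.sqrt (fischer p p).

Definition orthonormal_basis (phi : multinom d -> mpoly d R) : Prop :=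
  (forall n m, fischer (phi n) (phi m) = (n == m)%:R) /\
  (forall p, exists (s : seq (multinom d)) (c : multinom d -> R),
     p = \sum_(n <- s) c n *: phi n).

Definition Nhat (phi : multinom d -> mpoly d R) j : set (multinom d) :=
  [set n | dunklP j (phi n) != 0].

Definition dunkl_laplace p : mpoly d R := \sum_(j < d) dunklP j (dunklP j p).

(* The Laplacian lowers degrees by 2, so the terms with i >= msize p are 0. *)
Definition exp_laplace p : mpoly d R :=
  \sum_(i < msize p) ((- 4^-1) ^+ i / (i`!)%:R) *: iter i dunkl_laplace p.

Definition mfactorial n : nat := (\prod_(i < d) (n i)`!)%N.

Definition hermite_poly (phi : multinom d -> mpoly d R) n : mpoly d R :=
  (2 ^+ mdeg n * Num.sqrt (mfactorial n)%:R) *: exp_laplace (phi n).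

Definition gauss_const : R :=
  fine (integral_rV (fun x => (expR (- dotp x x) * weight x)%:E)).

Definition hermite_fun (phi : multinom d -> mpoly d R) n x : R :=
  Num.sqrt ((2 ^+ mdeg n * (mfactorial n)%:R * gauss_const)^-1) *
  expR (- (dotp x x / 2)) * mpoly_fun (hermite_poly phi n) x.

Definition delta j (f : 'rV[R]_d -> R) x : R := dunkl j f x + x 0 j * f x.

Definition norm2 (f : 'rV[R]_d -> R[i]) : \bar R :=
  poweR (integral_rV (fun x => (Normc.normc (f x) ^+ 2 * weight x)%:E)) 2^-1.

Definition in_L2 (f : 'rV[R]_d -> R[i]) : Prop :=
  [/\ measurable_rV (fun x => complex.Re (f x)),
      measurable_rV (fun x => complex.Im (f x))
    & (norm2 f < +oo)%E].

Definition inner (f g : 'rV[R]_d -> R[i]) : R[i] :=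
  let F x := f x * (g x)^* in
  fine (integral_rV (fun x => (complex.Re (F x) * weight x)%:E)) +i*
  fine (integral_rV (fun x => (complex.Im (F x) * weight x)%:E)).

Definition riesz_term (phi : multinom d -> mpoly d R) j
    (f : 'rV[R]_d -> R[i]) n x : R[i] :=
  ((Num.sqrt (2 * (mdeg n)%:R + 2 * gamma + d%:R))^-1)%:C *
  inner f (fun y => (hermite_fun phi n y)%:C) *
  (delta j (hermite_fun phi n) x)%:C.

(* g = R_j f : the partial sums over finite subsets of N^d converge to g in L^2,
   along the directed set of these subsets. *)
Definition is_riesz (phi : multinom d -> mpoly d R) j
    (f g : 'rV[R]_d -> R[i]) : Prop :=
  in_L2 g /\
  (fun A : {fset multinom d} =>
     norm2 (fun x => g x - \sum_(n <- A) riesz_term phi j f n x))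
    @ totally --> 0%E.

(* An operator on L^2 is given by its graph T, up to equality a.e. of values. *)
Definition bounded_on_L2
    (T : ('rV[R]_d -> R[i]) -> ('rV[R]_d -> R[i]) -> Prop) : Prop :=
  (forall f, in_L2 f -> exists g, T f g) /\
  exists C : R, forall f g, in_L2 f -> T f g -> (norm2 g <= C%:E * norm2 f)%E.

End Dunkl.

(* Main.v *)
From HB Require Import structures.
Require Import Defs.
From mathcomp Require Import all_boot all_order all_algebra finmap complex.
From mathcomp Require Import -(notations) mpoly.
From mathcomp Require Import all_classical all_reals all_analysis.
From mathcomp.analysis Require Import showcase.summability.
From mathcomp Require Import measurable_realfun ring lra.
Set Implicit Arguments.
Unset Strict Implicit.
Unset Printing Implicit Defensive.
Import Order.TTheory GRing.Theory Num.Theory.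
Import numFieldNormedType.Exports.
Local Open Scope classical_set_scope.
Local Open Scope ring_scope.

(** Let h n be the generalized Hermite functions and v n the functions
    (2|n| + 2 gamma + d)^(-1/2) delta_j h n. The operator sends h n to v n, so
    it is bounded as soon as the h n are orthonormal and the v n are orthogonal
    with bounded norms: Bessel's inequality bounds the coefficients and the
    Riesz-Fischer theorem sums the images (orthogonal_transform).

    The norms and inner products of the v n are those of polynomials for the
    Fischer product. Writing E for the Gaussian e^{-|x|^2/2}, one has
    delta_j (E p) = E T_j p, since the first-order term of T_j applied to E
    cancels multiplication by x_j while the difference terms do not see the
    radial factor E. As T_j commutes with exp(-Delta_k/4), delta_j h n is thus
    a multiple of E exp(-Delta_k/4) T_j phi_n (delta_gauss_mpoly, exp_lap_op).
    Macdonald's identity (macdonald_identity) says that, up to the factor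
    2^(-m) c_k, the pairing of E exp(-Delta_k/4) p with E exp(-Delta_k/4) q in
    L^2(w_k) is [p, q]_k when p is homogeneous of degree m. Hence the h n are
    orthonormal, the v n are orthogonal by hypothesis (i), and the square of the
    norm of v n is 2 (2|n| + 2 gamma + d)^(-1) [T_j phi_n, T_j phi_n]_k, which
    hypothesis (ii) bounds.

    Macdonald's identity follows from algebra and one analytic fact. The fact is
    the integration by parts L (T_v p) = 2 L (<v, x> p) for the functional
    L p = int p e^{-|x|^2} w_k (gauss_functional_dunkl). The weight is not
    differentiable on the root hyperplanes, so the formula is proved for the
    smooth weights prod_b (<b, x>^2 + eps)^k(b) and eps tends to 0. The algebra
    is the action of T_v on polynomials, defined from the exact quotients
    (p - sigma_b p) / <b, x>: all properties are proved by induction along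
    p |-> <w, x> p, starting from the commutation rule dunkl_op_linform. In
    particular the T_v commute (dunkl_op_comm), the commutator of Delta_k with
    multiplication by <w, x> is 2 T_w (dunkl_lap_linform), and exp(-Delta_k/4)
    turns <w, x> into <w, x> - T_w / 2 (exp_lap_linform). *)

(** * Lebesgue measure on tuples *)
Section PackSigmaFinite.
Context {d} {T : measurableType d} {R : realType}.

(** A copy of mu that carries the sigma-finite structure given by the proof, for
    use where the structure is only known to exist. *)
Definition sigma_finite_pack (mu : {measure set T -> \bar R})
  of sigma_finite setT mu : set T -> \bar R := mu.

Variables (mu : {measure set T -> \bar R}) (mu_fin : sigma_finite setT mu).
HB.instance Definition _ := Measure.copy (sigma_finite_pack mu_fin) mu.
HB.instance Definition _ :=
  Measure_isSigmaFinite.Build _ _ _ (sigma_finite_pack mu_fin) mu_fin.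
End PackSigmaFinite.

Section LebesgueTuple.
Context {R : realType}.

Let uncons_tuple d (t : d.+1.-tuple R) : R * d.-tuple R :=
  (thead t, [tuple of behead t]).

Lemma measurable_uncons d : measurable_fun setT (@uncons_tuple d).
Proof.
apply/measurable_fun_pairP; split.
- exact: (measurable_tnth (T := R) (ord0 : 'I_d.+1)).
- exact: measurable_behead.
Qed.

Lemma measurable_cons_tuple d :
  measurable_fun setT (fun p : R * d.-tuple R => [tuple of p.1 :: p.2]).
Proof. exact: measurable_cons. Qed.

(** The products of the sets of two exhausting sequences exhaust the product
    space. The induction needs a structure of sigma-finite measure to form the
    product at the next step, hence the existential. *)
Lemma lebesgue_tuple_sigma_finite d :
  exists mu : {sigma_finite_measure set d.-tuple R -> \bar R},
    @lebesgue_tuple R d = mu.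
Proof.
elim: d => [|d [mu muE]].
  by exists (\d_[tuple]).
have E : @lebesgue_tuple R d.+1 =
    pushforward (@lebesgue_measure R \x mu)%E
      (fun p : R * d.-tuple R => [tuple of p.1 :: p.2]).
  by rewrite -muE.
have [m mE] : exists m : {measure set d.+1.-tuple R -> \bar R},
    @lebesgue_tuple R d.+1 = m.
  rewrite E.
  by exists (measure_function_pushforward__canonical__measure_function_Measure
    (@lebesgue_measure R \x mu)%E (@measurable_cons_tuple d)).
have m_fin : sigma_finite setT m.
  have /sigma_finiteP[A [TA ndA Aoo]] := sigma_finiteT (@lebesgue_measure R).
  have /sigma_finiteP[B [TB ndB Boo]] := sigma_finiteT mu.
  exists (fun i => @uncons_tuple d @^-1` (A i `*` B i)).
    apply/seteqP; split=> // t _.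
    have [i _ Ai] : (\bigcup_i A i) (thead t) by rewrite -TA.
    have [j _ Bj] : (\bigcup_i B i) [tuple of behead t] by rewrite -TB.
    exists (maxn i j) => //; split=> /=.
      by apply: (subsetPset _ _ (ndA _ _ (leq_maxl i j))).
    by apply: (subsetPset _ _ (ndB _ _ (leq_maxr i j))).
  move=> i; have [mA Alt] := Aoo i; have [mB Blt] := Boo i; split.
    rewrite -[X in measurable X]setTI; apply: measurable_uncons => //.
    exact: measurableX.
  rewrite -mE E /pushforward.
  rewrite [X in (_ X < _)%E](_ : _ = A i `*` B i); last first.
    apply/seteqP; split=> -[x t] /=;
    by rewrite /uncons_tuple theadE (_ : [tuple of _] = t)//; apply/val_inj.
  by rewrite product_measure1E// lte_mul_pinfty// ge0_fin_numE.
by exists (sigma_finite_pack m_fin).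
Qed.
End LebesgueTuple.
Section LebesgueTupleInstances.
Context {R : realType}.
Variable d : nat.
Let mu : set (d.-tuple R) -> \bar R := @lebesgue_tuple R d.

Let mu0 : mu set0 = 0%E.
Proof. by rewrite /mu; have [m ->] := @lebesgue_tuple_sigma_finite R d. Qed.

Let mu_ge0 A : (0 <= mu A)%E.
Proof. by rewrite /mu; have [m ->] := @lebesgue_tuple_sigma_finite R d. Qed.

Let mu_sigma_additive : semi_sigma_additive mu.
Proof.
rewrite /mu; have [m ->] := @lebesgue_tuple_sigma_finite R d.
exact: measure_semi_sigma_additive.
Qed.

HB.instance Definition _ := isMeasure.Build _ _ _ (@lebesgue_tuple R d)
  mu0 mu_ge0 mu_sigma_additive.

Let mu_sigma_finite : sigma_finite setT mu.
Proof.
rewrite /mu; have [m ->] := @lebesgue_tuple_sigma_finite R d.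
exact: sigma_finiteT.
Qed.

HB.instance Definition _ :=
  Measure_isSigmaFinite.Build _ _ _ (@lebesgue_tuple R d) mu_sigma_finite.

End LebesgueTupleInstances.

Section TupleIntegral.
Context {R : realType}.
Local Notation leb := (@lebesgue_measure R).
Local Notation lebt := (@lebesgue_tuple R).
Local Open Scope ereal_scope.

Lemma integral_tuple0 (F : 0.-tuple R -> \bar R) :
  \int[@lebt 0]_t F t = F [tuple].
Proof.
have FE : F = cst (F [tuple]) by apply/funext => t; rewrite tuple0.
rewrite integral_dirac//; first by rewrite diracE mem_setT mul1e.
by rewrite FE; exact: measurable_cst.
Qed.

Lemma ge0_integral_tuple_cons d (F : d.+1.-tuple R -> \bar R) :
  measurable_fun setT F -> (forall t, 0 <= F t) ->
  \int[@lebt d.+1]_t F t = \int[leb]_s \int[@lebt d]_t F [tuple of s :: t].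
Proof.
move=> mF F0.
rewrite /= ge0_integral_pushforward//=; last exact: measurable_cons_tuple.
rewrite preimage_setT fubini_tonelli1//.
by apply: (measurableT_comp mF); exact: measurable_cons_tuple.
Qed.

Definition tuple_insert d (i : 'I_d.+1) (s : R) (t : d.-tuple R) :
    d.+1.-tuple R :=
  [tuple if unlift i l is Some k then tnth t k else s | l < d.+1].

Lemma tnth_insert d (i : 'I_d.+1) s t : tnth (@tuple_insert d i s t) i = s.
Proof. by rewrite tnth_mktuple unlift_none. Qed.

Lemma tnth_insert_lift d (i : 'I_d.+1) s t k :
  tnth (@tuple_insert d i s t) (lift i k) = tnth t k.
Proof. by rewrite tnth_mktuple liftK. Qed.

Lemma tuple_insert0 d s (t : d.-tuple R) :
  tuple_insert ord0 s t = [tuple of s :: t].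
Proof.
apply: eq_from_tnth => l; case: (unliftP ord0 l) => [k|] ->.
  by rewrite tnth_insert_lift tnthS.
by rewrite tnth_insert tnth0.
Qed.

Lemma tuple_insertS d (i : 'I_d.+1) s x (t : d.-tuple R) :
  tuple_insert (lift ord0 i) s [tuple of x :: t] =
  [tuple of x :: tuple_insert i s t].
Proof.
apply: eq_from_tnth => l; case: (unliftP (lift ord0 i) l) => [k|] ->; last first.
  by rewrite tnth_insert tnthS tnth_insert.
rewrite tnth_insert_lift; case: (unliftP ord0 k) => [k'|] ->.
  rewrite tnthS (_ : lift _ _ = lift ord0 (lift i k')); last first.
    by apply/val_inj; rewrite /= /bump /= !add1n ltnS addnS.
  by rewrite tnthS tnth_insert_lift.
by rewrite (_ : lift _ _ = ord0) ?tnth0//; apply/val_inj.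
Qed.

Lemma measurable_tuple_insert d (i : 'I_d.+1) :
  measurable_fun setT (fun p : R * d.-tuple R => tuple_insert i p.1 p.2).
Proof.
apply/measurable_fun_tnthP => l; case: (unliftP i l) => [k|] ->.
- rewrite [X in measurable_fun _ X](_ : _ = fun p => tnth p.2 k).
    by apply: (measurableT_comp (measurable_tnth k)).
  by apply/funext => p /=; rewrite tnth_insert_lift.
- rewrite [X in measurable_fun _ X](_ : _ = fst)//.
  by apply/funext => p /=; rewrite tnth_insert.
Qed.

(** The measure is defined by splitting off the first coordinate; by Tonelli any
    coordinate may be integrated first. *)
Lemma ge0_integral_tuple_insert d (i : 'I_d.+1) (F : d.+1.-tuple R -> \bar R) :
  measurable_fun setT F -> (forall t, 0 <= F t) ->
  \int[@lebt d.+1]_t F t = \int[@lebt d]_t \int[leb]_s F (tuple_insert i s t).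
Proof.
elim: d => [|d IH] in i F * => mF F0.
  rewrite integral_tuple0 (ge0_integral_tuple_cons mF F0); apply: eq_integral => s _.
  by rewrite integral_tuple0 (ord1 i) tuple_insert0.
case: (unliftP ord0 i) => [j|] ->; last first.
  rewrite (ge0_integral_tuple_cons mF F0).
  have mF' : measurable_fun setT
      (fun p : measurableTypeR R * d.+1.-tuple R => F [tuple of p.1 :: p.2]).
    by apply: (measurableT_comp mF); exact: measurable_cons_tuple.
  apply: (etrans (fubini_tonelli _ mF' (fun=> F0 _))).
  by apply: eq_integral => t _; apply: eq_integral => s _; rewrite tuple_insert0.
rewrite (ge0_integral_tuple_cons mF F0).
rewrite [RHS]ge0_integral_tuple_cons; last 2 first.
- apply: (@measurable_fun_fubini_tonelli_G _ _ _ _ R leb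
    (fun p : measurableTypeR R * d.+1.-tuple R =>
      F (tuple_insert (lift ord0 j) p.1 p.2))) => //.
  by apply: (measurableT_comp mF); exact: measurable_tuple_insert.
- by move=> t; exact: integral_ge0.
apply: eq_integral => x _.
have mFx : measurable_fun setT (fun t : d.+1.-tuple R => F [tuple of x :: t]).
  apply: (measurableT_comp mF).
  exact: (measurableT_comp (measurable_cons_tuple (d := d.+1)) (measurable_pair1 x)).
rewrite [LHS](IH j _ mFx (fun=> F0 _)).
by apply: eq_integral => t _; apply: eq_integral => s _; rewrite tuple_insertS.
Qed.

End TupleIntegral.

(** * Invariance of the integral on R^d *)

Section Invariance.
Context {R : realType}.
Local Notation leb := (@lebesgue_measure R).
Local Notation lebt := (@lebesgue_tuple R).
Local Open Scope ereal_scope.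

Lemma ge0_integral_translation (f : R -> \bar R) (a : R) :
  measurable_fun setT f -> (forall x, 0 <= f x) ->
  \int[leb]_x f (x + a)%R = \int[leb]_x f x.
Proof.
move=> mf f0.
pose g : measurableTypeR R -> measurableTypeR R := fun x => (x + a)%R.
have mg : measurable_fun setT g by apply: measurable_funD.
pose nu := measure_function_pushforward__canonical__measure_function_Measure
  leb mg.
have E A : measurable A -> leb A = nu A.
  apply: lebesgue_measure_unique => _ [[x y]] _ <-.
  rewrite /nu /= /pushforward.
  rewrite (_ : g @^-1` _ = `]x - a, y - a]%classic%R); last first.
    by apply/seteqP; split=> z /=; rewrite !in_itv /= ltrBlDr lerBrDr.
  rewrite lebesgue_measure_itv [RHS]lebesgue_measure_itv /= !lte_fin ltrD2r.
  by case: ifP => // _; rewrite -!EFinB; congr EFin; ring.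
transitivity (\int[pushforward leb g]_x f x).
  by rewrite ge0_integral_pushforward// preimage_setT.
by apply: eq_measure_integral => A mA _; rewrite -E.
Qed.

Lemma ge0_integral_reflection (f : R -> \bar R) :
  measurable_fun setT f -> (forall x, 0 <= f x) ->
  \int[leb]_x f (- x)%R = \int[leb]_x f x.
Proof.
move=> mf f0.
have mN : measurable_fun setT (-%R : measurableTypeR R -> measurableTypeR R).
  exact: oppr_measurable.
transitivity (\int[pushforward leb (-%R : measurableTypeR R -> measurableTypeR R)]_x f x).
  by rewrite ge0_integral_pushforward// preimage_setT.
by apply: eq_measure_integral => A mA _; exact: lebesgue_measureN.
Qed.

Lemma ge0_integral_tuple_translation d (F : d.-tuple R -> \bar R)
    (v : 'I_d -> R) :
  measurable_fun setT F -> (forall t, 0 <= F t) ->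
  \int[@lebt d]_t F [tuple (tnth t i + v i)%R | i < d] = \int[@lebt d]_t F t.
Proof.
elim: d => [|d IH] in F v * => mF F0.
  by rewrite !integral_tuple0; congr F; apply/eq_from_tnth; case.
pose tr := fun t : d.+1.-tuple R => [tuple (tnth t i + v i)%R | i < d.+1].
have mtr : measurable_fun setT tr.
  apply/measurable_fun_tnthP => i.
  rewrite [X in measurable_fun _ X](_ : _ = fun t => (tnth t i + v i)%R).
    by apply: measurable_funD => //; exact: measurable_tnth.
  by apply/funext => t; rewrite /= tnth_mktuple.
rewrite ge0_integral_tuple_cons//; last exact: (measurableT_comp mF mtr).
have mFc s : measurable_fun setT (fun t : d.-tuple R => F [tuple of s :: t]).
  apply: (measurableT_comp mF).
  exact: (measurableT_comp (measurable_cons_tuple (d := d)) (measurable_pair1 s)).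
have step (s : R) : \int[@lebt d]_t F (tr [tuple of s :: t]) =
    \int[@lebt d]_t F [tuple of (s + v ord0)%R :: t].
  rewrite -(IH (fun t => F [tuple of (s + v ord0)%R :: t])
      (fun i => v (lift ord0 i)))//.
  apply: eq_integral => t _; congr F; apply: eq_from_tnth => l.
  case: (unliftP ord0 l) => [k|] ->.
    by rewrite tnthS !tnth_mktuple tnthS.
  by rewrite tnth0 tnth_mktuple tnth0.
transitivity (\int[leb]_s \int[@lebt d]_t F [tuple of (s + v ord0)%R :: t]).
  by apply: eq_integral => s _; exact: step.
rewrite [RHS](ge0_integral_tuple_cons mF F0).
apply: (ge0_integral_translation (f := fun s => \int[lebt (d:=d)]_t F [tuple of s :: t])).
- apply: (@measurable_fun_fubini_tonelli_F _ _ _ _ R (@lebt d)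
    (fun p : measurableTypeR R * d.-tuple R => F [tuple of p.1 :: p.2])) => //.
  by apply: (measurableT_comp mF); exact: measurable_cons_tuple.
- by move=> s; exact: integral_ge0.
Qed.

End Invariance.

Section RowVectorIntegral.
Context {R : realType}.
Local Notation leb := (@lebesgue_measure R).
Local Notation lebt := (@lebesgue_tuple R).

Definition rV_measurable d {d'} {T : measurableType d'} (F : 'rV[R]_d -> T) :=
  measurable_fun [set: d.-tuple R] (F \o @rV_of_tuple R d).

Lemma rV_measurable_coord d (i : 'I_d) :
  rV_measurable (fun x : 'rV[R]_d => x 0 i).
Proof.
rewrite /rV_measurable [X in measurable_fun _ X](_ : _ = fun t => tnth t i).
  exact: measurable_tnth.
by apply/funext => t /=; rewrite mxE.
Qed.

Lemma measurable_comp_rV d {dT} {T : measurableType dT} {dX}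
    {X : measurableType dX} (F : 'rV[R]_d -> T) (g : X -> 'rV[R]_d) :
  rV_measurable F -> (forall i, measurable_fun setT (fun x => g x 0 i)) ->
  measurable_fun setT (F \o g).
Proof.
move=> mF mg.
have -> : F \o g = (F \o @rV_of_tuple R d) \o
    (fun x => [tuple g x 0 i | i < d]).
  apply/funext => x /=; congr F; apply/rowP => i.
  by rewrite mxE tnth_mktuple.
apply: (measurableT_comp mF); apply/measurable_fun_tnthP => i.
rewrite [X in measurable_fun _ X](_ : _ = fun x => g x 0 i)//.
by apply/funext => x /=; rewrite tnth_mktuple.
Qed.

Local Open Scope ereal_scope.

Definition hyperplane_point d (i : 'I_d.+1) (t : d.-tuple R) : 'rV[R]_d.+1 :=
  rV_of_tuple (tuple_insert i 0%R t).

Lemma measurable_line_point d (i : 'I_d.+1) (b : 'rV[R]_d.+1) {dT}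
    {T : measurableType dT} (F : 'rV[R]_d.+1 -> T) :
  rV_measurable F ->
  measurable_fun setT (fun p : measurableTypeR R * d.-tuple R =>
    F (p.1 *: b + hyperplane_point i p.2)%R).
Proof.
move=> mF; apply: (measurable_comp_rV mF) => l.
rewrite [X in measurable_fun _ X](_ : _ = fun p : measurableTypeR R * d.-tuple R =>
   (p.1 * b 0%R l + tnth (tuple_insert i 0 p.2) l)%R); last first.
  by apply/funext => p; rewrite !mxE.
apply: measurable_funD; first by apply: measurable_funM.
apply: (measurableT_comp (measurable_tnth l)).
pose h (p : measurableTypeR R * d.-tuple R) : R * d.-tuple R := (0%R, p.2).
have mh : measurable_fun setT h.
  apply/measurable_fun_pairP; split.
    exact: (@measurable_cst _ _ _ _ _ (0%R : R)).
  exact: (@measurable_snd _ _ (measurableTypeR R) (d.-tuple R)).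
exact: (measurableT_comp (@measurable_tuple_insert R d i) mh).
Qed.

(** Tonelli along the lines of direction b: the shear moving coordinate l by
    s * b l acts on each hyperplane x_i = s as a translation. *)
Lemma ge0_integral_lines d (i : 'I_d.+1) (b : 'rV[R]_d.+1)
    (F : 'rV[R]_d.+1 -> \bar R) :
  b 0%R i = 1%R -> rV_measurable F -> (forall x, 0 <= F x) ->
  integral_rV F =
    \int[@lebt d]_t \int[leb]_s F (s *: b + hyperplane_point i t)%R.
Proof.
move=> bi mF F0; rewrite /integral_rV (ge0_integral_tuple_insert i mF (fun t => F0 _)).
have mG : measurable_fun setT (fun p : measurableTypeR R * d.-tuple R =>
    F (rV_of_tuple (tuple_insert i p.1 p.2))).
  by apply: (measurableT_comp mF); exact: measurable_tuple_insert.
rewrite -(fubini_tonelli (m1 := leb) (m2 := @lebt d) _ mG (fun=> F0 _)) /=.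
have mH := measurable_line_point i b mF.
rewrite -(fubini_tonelli (m1 := leb) (m2 := @lebt d) _ mH (fun=> F0 _)) /=.
apply: eq_integral => s _.
rewrite -(@ge0_integral_tuple_translation R d
   (fun t => F (rV_of_tuple (tuple_insert i s t)))
   (fun k => (s * b 0%R (lift i k))%R))//; last first.
  exact: (measurableT_comp mG (measurable_pair1 s)).
apply: eq_integral => t _; congr F; apply/rowP => l; rewrite !mxE.
case: (unliftP i l) => [k|] ->.
  by rewrite !tnth_insert_lift tnth_mktuple addrC.
by rewrite !tnth_insert bi mulr1 addr0.
Qed.

Lemma dotpDr d (x y z : 'rV[R]_d) : (dotp x (y + z) = dotp x y + dotp x z)%R.
Proof.
rewrite /dotp -big_split/=; apply: eq_bigr => i _; by rewrite mxE mulrDr.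
Qed.

Lemma dotpZr d (x y : 'rV[R]_d) a : (dotp x (a *: y) = a * dotp x y)%R.
Proof.
by rewrite /dotp mulr_sumr; apply: eq_bigr => i _; rewrite mxE mulrCA.
Qed.

Lemma dotpC d (x y : 'rV[R]_d) : dotp x y = dotp y x.
Proof. by apply: eq_bigr => i _; rewrite mulrC. Qed.

Lemma dotpZl d (x y : 'rV[R]_d) a : (dotp (a *: x) y = a * dotp x y)%R.
Proof. by rewrite dotpC dotpZr dotpC. Qed.

Lemma dotpDl d (x y z : 'rV[R]_d) : (dotp (x + y) z = dotp x z + dotp y z)%R.
Proof. by rewrite dotpC dotpDr !(dotpC z). Qed.

Lemma dotpp_ge0 d (x : 'rV[R]_d) : (0 <= dotp x x)%R.
Proof. by apply: sumr_ge0 => i _; rewrite -expr2 sqr_ge0. Qed.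

Lemma dotpp_eq0 d (x : 'rV[R]_d) : (dotp x x == 0%R) = (x == 0%R).
Proof.
rewrite psumr_eq0; last by move=> i _; rewrite -expr2 sqr_ge0.
apply/allP/eqP => [h|-> i _]; last by rewrite mxE mulr0 eqxx.
apply/rowP => i; have := h i (mem_index_enum _).
by rewrite mxE mulf_eq0 orbb => /eqP.
Qed.

Lemma reflect_inZ d (b : 'rV[R]_d) c x :
  c != 0%R -> reflect_in (c *: b) x = reflect_in b x.
Proof.
move=> c0; rewrite /reflect_in; congr (_ - _)%R.
rewrite !dotpZr !dotpZl scalerA; congr (_ *: _)%R.
have [->|b0] := eqVneq (dotp b b) 0%R; first by rewrite !mulr0 !invr0 !mulr0 mul0r.
by field; rewrite c0 b0.
Qed.

(** After scaling b so that one of its coordinates is 1, the reflection acts on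
    each line of direction b as s |-> a - s, which preserves the
    one-dimensional Lebesgue measure. *)
Lemma ge0_integral_reflect_in d (b : 'rV[R]_d) (F : 'rV[R]_d -> \bar R) :
  b != 0%R -> rV_measurable F -> (forall x, 0 <= F x) ->
  integral_rV (fun x => F (reflect_in b x)) = integral_rV F.
Proof.
case: d => [|d] in b F *; first by move=> /eqP []; exact: thinmx0.
move=> b0 mF F0.
have [i bi] : exists i, b 0%R i != 0%R.
  apply/existsP; apply: contra_neqT b0 => /existsPn h; apply/rowP => i.
  by have := h i; rewrite negbK mxE => /eqP.
pose b1 := ((b 0%R i)^-1 *: b)%R.
have b1i : b1 0%R i = 1%R by rewrite mxE mulVf.
have b1b1 : dotp b1 b1 != 0%R.
  by rewrite dotpp_eq0 scaler_eq0 invr_eq0 (negbTE bi).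
have E x : reflect_in b x = reflect_in b1 x by rewrite reflect_inZ// invr_eq0.
have mFr : rV_measurable (fun x => F (reflect_in b x)).
  apply: (measurable_comp_rV mF) => l.
  rewrite /reflect_in; under eq_fun do rewrite !mxE.
  apply: measurable_funB; first exact: measurable_tnth.
  apply: measurable_funM => //; apply: measurable_funM => //.
  apply: measurable_funM => //; apply: measurable_sum => k.
  apply: measurable_funM => //.
  exact: (rV_measurable_coord k).
rewrite [LHS](ge0_integral_lines b1i mFr (fun=> F0 _)).
rewrite [RHS](ge0_integral_lines b1i mF F0).
apply: eq_integral => t _.
set y := hyperplane_point i t; pose a := (2 * dotp b1 y / dotp b1 b1)%R.
have mf : measurable_fun setT (fun s : R => F (s *: b1 + y)%R).
  exact: (measurableT_comp (measurable_line_point i b1 mF) (measurable_pair2 t)).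
have ma : measurable_fun setT (fun s : R => (s - a)%R).
  by apply: measurable_funB.
pose f (s : R) := F ((s - a) *: b1 + y)%R.
have mfa : measurable_fun setT f by exact: (measurableT_comp mf ma).
transitivity (\int[leb]_s f (- s)%R); last first.
  rewrite ge0_integral_reflection//; last by move=> s; exact: F0.
  exact: (ge0_integral_translation (f := fun s => F (s *: b1 + y)%R) (- a)).
apply: eq_integral => s _; congr F; rewrite E /reflect_in dotpDr dotpZr.
rewrite addrAC -scalerBl; congr (_ *: _ + _)%R.
by rewrite /a; field.
Qed.

End RowVectorIntegral.

(** * Reflections and divided differences of polynomials *)

Section Polynomials.
Context {R : realType} {d : nat}.
Implicit Types (p q : mpoly d R) (x y u v w b : 'rV[R]_d).
Local Notation mX i := (mpolyX R (mnm1 i) : mpoly d R).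
Local Notation mC c := (mpolyC d c : mpoly d R).

Definition linform v : mpoly d R := \sum_i v 0 i *: mX i.

Lemma linformD v w : linform (v + w) = linform v + linform w.
Proof.
by rewrite -big_split/=; apply: eq_bigr => i _; rewrite mxE scalerDl.
Qed.

Lemma linformZ c v : linform (c *: v) = c *: linform v.
Proof. by rewrite scaler_sumr; apply: eq_bigr => i _; rewrite mxE scalerA. Qed.

Lemma linform_delta i : linform (delta_mx 0 i) = mX i.
Proof.
rewrite /linform (bigD1 i)//= big1 ?addr0.
  by rewrite mxE !eqxx scale1r.
by move=> l li; rewrite mxE (negbTE li) andbF scale0r.
Qed.

Lemma linform_eq0 v : (linform v == 0) = (v == 0).
Proof.
apply/eqP/eqP => [v0|->]; last first.
  by rewrite -[0](scale0r 0) linformZ scale0r.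
apply/rowP => i; rewrite mxE.
have : mcoeff (mnm1 i) (linform v) = v 0 i.
  rewrite /linform raddf_sum /= (bigD1 i)//= big1 ?addr0.
    by rewrite mcoeffZ mcoeffX eqxx mulr1.
  move=> l li; rewrite mcoeffZ mcoeffX (_ : (_ == _) = false) ?mulr0//.
  apply/negbTE; apply: contra li => /eqP/mnmP/(_ l).
  by rewrite !mnm1E eqxx; case: eqP => // ->.
by rewrite v0 mcoeff0.
Qed.

(** Linear forms are used instead of variables because reflections permute
    them: this is the induction behind all identities between the operators. *)
Lemma mpoly_ind_linform (P : mpoly d R -> Prop) :
  (forall c, P (mC c)) -> (forall p q, P p -> P q -> P (p + q)) ->
  (forall w p, P p -> P (linform w * p)) -> forall p, P p.
Proof.
move=> PC PD PX; elim/mpolyind => [|c m p _ _ Pp]; first by rewrite -(mpolyC0 d R).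
apply: PD => //; rewrite -mul_mpolyC mulrC mpolyXE_id.
elim/big_ind : _ (mC c) (PC c) => [q|P1 P2 h1 h2 q Pq|i _ q Pq].
- by rewrite mul1r.
- by rewrite -mulrA; apply: h1; apply: h2.
- elim: (m i) => [|n IH]; first by rewrite expr0 mul1r.
  by rewrite exprS -mulrA -linform_delta; apply: PX; rewrite linform_delta.
Qed.

Lemma mpoly_fun_linform v x : mpoly_fun (linform v) x = dotp v x.
Proof.
rewrite /mpoly_fun /linform raddf_sum; apply: eq_bigr => i _ /=.
by rewrite mevalZ mevalXU.
Qed.

Lemma mpoly_funM p q x : mpoly_fun (p * q) x = mpoly_fun p x * mpoly_fun q x.
Proof. exact: mevalM. Qed.

Lemma mpoly_funD p q x : mpoly_fun (p + q) x = mpoly_fun p x + mpoly_fun q x.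
Proof. exact: mevalD. Qed.

Lemma mpoly_funB p q x : mpoly_fun (p - q) x = mpoly_fun p x - mpoly_fun q x.
Proof. exact: mevalB. Qed.

Lemma mpoly_funZ c p x : mpoly_fun (c *: p) x = c * mpoly_fun p x.
Proof. exact: mevalZ. Qed.

Lemma mpoly_funC c x : mpoly_fun (mC c) x = c.
Proof. exact: mevalC. Qed.

Lemma mpoly_fun_sum I (r : seq I) (F : I -> mpoly d R) x :
  mpoly_fun (\sum_(i <- r) F i) x = \sum_(i <- r) mpoly_fun (F i) x.
Proof. exact: raddf_sum. Qed.

Definition mpoly_reflect b : mpoly d R -> mpoly d R :=
  comp_mpoly [tuple mX i - (2 * b 0 i / dotp b b) *: linform b | i < d].

HB.instance Definition _ b := GRing.LRMorphism.copy (mpoly_reflect b)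
  (comp_mpoly [tuple mX i - (2 * b 0 i / dotp b b) *: linform b | i < d]).

Lemma mpoly_fun_reflect b p x :
  mpoly_fun (mpoly_reflect b p) x = mpoly_fun p (reflect_in b x).
Proof.
rewrite /mpoly_fun comp_mpoly_meval; apply: meval_eq => i.
rewrite tnth_mktuple mevalB mevalXU mevalZ -/(mpoly_fun _ _) mpoly_fun_linform.
by rewrite /reflect_in !mxE; congr (_ - _); ring.
Qed.

Lemma mpoly_reflectC b c : mpoly_reflect b (mC c) = mC c.
Proof. exact: comp_mpolyC. Qed.

Lemma mpoly_reflectD b p q :
  mpoly_reflect b (p + q) = mpoly_reflect b p + mpoly_reflect b q.
Proof. exact: raddfD. Qed.

Lemma mpoly_reflectZ b c p : mpoly_reflect b (c *: p) = c *: mpoly_reflect b p.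
Proof. exact: linearZ. Qed.

Lemma mpoly_reflectM b p q :
  mpoly_reflect b (p * q) = mpoly_reflect b p * mpoly_reflect b q.
Proof. exact: rmorphM. Qed.

Lemma mpoly_reflect_sum b I (r : seq I) (F : I -> mpoly d R) :
  mpoly_reflect b (\sum_(i <- r) F i) = \sum_(i <- r) mpoly_reflect b (F i).
Proof. exact: raddf_sum. Qed.

Lemma reflect_inD b x y : reflect_in b (x + y) = reflect_in b x + reflect_in b y.
Proof.
by rewrite /reflect_in dotpDr; apply/rowP => i; rewrite !mxE; ring.
Qed.

Lemma reflect_inZr b c x : reflect_in b (c *: x) = c *: reflect_in b x.
Proof.
by rewrite /reflect_in dotpZr; apply/rowP => i; rewrite !mxE; ring.
Qed.

Lemma reflect_inN b x : reflect_in b (- x) = - reflect_in b x.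
Proof. by rewrite -scaleN1r reflect_inZr scaleN1r. Qed.

Lemma reflect_inNl b x : reflect_in (- b) x = reflect_in b x.
Proof. by rewrite -scaleN1r reflect_inZ// oppr_eq0 oner_eq0. Qed.

Lemma dotp_reflectl b x y : dotp (reflect_in b x) y = dotp x (reflect_in b y).
Proof.
rewrite /reflect_in -!(scaleNr _ b) dotpDl dotpDr dotpZl dotpZr.
by rewrite (dotpC x b); congr (_ + _); ring.
Qed.

Lemma reflect_in_self b : b != 0 -> reflect_in b b = - b.
Proof.
move=> b0; have bb : dotp b b != 0 by rewrite dotpp_eq0.
by rewrite /reflect_in -mulrA divff// mulr1 scaler_nat mulr2n opprD addNKr.
Qed.

Lemma reflect_inK b x : reflect_in b (reflect_in b x) = x.
Proof.
have [->|b0] := eqVneq b 0.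
  by rewrite /reflect_in !scaler0 !subr0.
have bb : dotp b b != 0 by rewrite dotpp_eq0.
have E : dotp b (reflect_in b x) = - dotp b x.
  by rewrite -dotp_reflectl reflect_in_self// -scaleN1r dotpZl mulN1r.
by rewrite {1}/reflect_in E /reflect_in; apply/rowP => i; rewrite !mxE; ring.
Qed.

Lemma dotp_reflect b x y :
  dotp (reflect_in b x) (reflect_in b y) = dotp x y.
Proof. by rewrite dotp_reflectl reflect_inK. Qed.

Lemma reflect_in_conj a b x : a != 0 ->
  reflect_in (reflect_in a b) x = reflect_in a (reflect_in b (reflect_in a x)).
Proof.
move=> a0; rewrite [reflect_in b (reflect_in a x)]/reflect_in -(scaleNr _ b).
rewrite reflect_inD reflect_inK reflect_inZr scaleNr {1}/reflect_in.
by rewrite dotp_reflectl dotp_reflect.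
Qed.

Lemma mpoly_reflect_linform b v :
  mpoly_reflect b (linform v) = linform (reflect_in b v).
Proof.
rewrite {1}/linform raddf_sum /= /mpoly_reflect.
under eq_bigr do rewrite comp_mpolyZ comp_mpolyXU -tnth_nth tnth_mktuple scalerBr scalerA.
rewrite sumrB -/(linform v) -scaler_suml /reflect_in -(scaleNr _ b) linformD linformZ scaleNr.
congr (_ - _ *: _); rewrite /dotp mulr_sumr mulr_suml.
by apply: eq_bigr => i _; ring.
Qed.

Lemma mpoly_reflect_conj a b p : a != 0 ->
  mpoly_reflect (reflect_in a b) (mpoly_reflect a p) =
  mpoly_reflect a (mpoly_reflect b p).
Proof.
move=> a0; elim/mpoly_ind_linform: p => [c|p q hp hq|w p hp].
- by rewrite !mpoly_reflectC.
- by rewrite !raddfD /= hp hq.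
- by rewrite !mpoly_reflectM hp !mpoly_reflect_linform (reflect_in_conj _ _ a0) reflect_inK.
Qed.

Lemma mpoly_reflectK b : involutive (mpoly_reflect b).
Proof.
move=> p; elim/mpoly_ind_linform: p => [c|p q hp hq|w p hp].
- by rewrite !mpoly_reflectC.
- by rewrite !raddfD /= hp hq.
- by rewrite !mpoly_reflectM hp !mpoly_reflect_linform reflect_inK.
Qed.

Lemma mpoly_reflectNl b : mpoly_reflect (- b) = mpoly_reflect b.
Proof.
apply/funext => p; elim/mpoly_ind_linform: p => [c|p q hp hq|w p hp].
- by rewrite !mpoly_reflectC.
- by rewrite !raddfD /= hp hq.
- by rewrite !rmorphM /= hp !mpoly_reflect_linform reflect_inNl.
Qed.

(** By induction, since sigma_b changes the linear form <w, x> by the multiple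
    2 (<b, w> / <b, b>) <b, x> of <b, x>. *)
Lemma exists_reflect_quotient b p :
  exists q, linform b * q = p - mpoly_reflect b p.
Proof.
elim/mpoly_ind_linform: p => [c|p q [p' hp] [q' hq]|w p [q hq]].
- by exists 0; rewrite mpoly_reflectC subrr mulr0.
- by exists (p' + q'); rewrite raddfD /= mulrDr hp hq opprD addrACA.
exists (linform w * q + (2 * dotp b w / dotp b b) *: mpoly_reflect b p).
rewrite rmorphM /= mpoly_reflect_linform /reflect_in -(scaleNr _ b) linformD linformZ.
rewrite scaleNr -!mul_mpolyC.
set c := mpolyC _ _; set s := mpoly_reflect b p in hq *.
transitivity (linform w * (linform b * q) + c * linform b * s); first by ring.
by rewrite hq; ring.
Qed.

Definition reflect_quotient b p : mpoly d R :=
  xget 0 [set q | linform b * q = p - mpoly_reflect b p].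

Lemma reflect_quotientP b p :
  linform b * reflect_quotient b p = p - mpoly_reflect b p.
Proof.
rewrite /reflect_quotient; case: xgetP => // /(_ _) h.
by have [q hq] := exists_reflect_quotient b p; have := h q.
Qed.

Lemma reflect_quotient_unique b p q : b != 0 ->
  linform b * q = p - mpoly_reflect b p -> reflect_quotient b p = q.
Proof.
move=> b0 hq; apply: (@mulfI _ (linform b)); first by rewrite linform_eq0.
by rewrite reflect_quotientP.
Qed.

Lemma reflect_quotient_is_linear b : b != 0 -> linear (reflect_quotient b).
Proof.
move=> b0 c p q; apply: reflect_quotient_unique => //.
rewrite mulrDr -scalerAr !reflect_quotientP mpoly_reflectD mpoly_reflectZ scalerBr.
by rewrite opprD addrACA.
Qed.

Lemma reflect_quotientC b c : b != 0 -> reflect_quotient b (mC c) = 0.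
Proof.
move=> b0; apply: reflect_quotient_unique => //.
by rewrite mpoly_reflectC subrr mulr0.
Qed.

Lemma reflect_quotient_linform b w p : b != 0 ->
  reflect_quotient b (linform w * p) = linform w * reflect_quotient b p +
    (2 * dotp b w / dotp b b) *: mpoly_reflect b p.
Proof.
move=> b0; apply: reflect_quotient_unique => //.
rewrite rmorphM /= mpoly_reflect_linform /reflect_in -(scaleNr _ b) linformD linformZ.
have hq := reflect_quotientP b p; rewrite scaleNr -!mul_mpolyC.
set q := reflect_quotient b p in hq *.
set c := mpolyC _ _; set s := mpoly_reflect b p in hq *.
transitivity (linform w * (linform b * q) + c * linform b * s); first by ring.
by rewrite hq; ring.
Qed.

(** Numerator and denominator of (p - sigma_b p) / <b, x> both change sign
    under sigma_b. *)
Lemma mpoly_reflect_quotient b p : b != 0 ->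
  mpoly_reflect b (reflect_quotient b p) = reflect_quotient b p.
Proof.
move=> b0; apply/esym/reflect_quotient_unique => //.
have := congr1 (mpoly_reflect b) (reflect_quotientP b p).
rewrite rmorphM raddfB /= mpoly_reflectK mpoly_reflect_linform.
rewrite reflect_in_self// -scaleN1r linformZ scaleN1r mulNr => h.
by rewrite -[LHS]opprK h opprB.
Qed.

Lemma reflect_quotientM b p q : b != 0 ->
  reflect_quotient b (p * q) = reflect_quotient b p * q +
    p * reflect_quotient b q -
    linform b * (reflect_quotient b p * reflect_quotient b q).
Proof.
move=> b0; apply: reflect_quotient_unique => //.
have ident (a x y P Q : mpoly d R) :
    a * (P * y + x * Q - a * (P * Q)) = x * y - (x - a * P) * (y - a * Q) by ring.
by rewrite mpoly_reflectM ident !reflect_quotientP !subKr.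
Qed.

Definition mpoly_deriv v p : mpoly d R := \sum_j v 0 j *: mderiv j p.

Lemma mpoly_deriv_is_linear v : linear (mpoly_deriv v).
Proof.
move=> c p q; rewrite /mpoly_deriv scaler_sumr -big_split; apply: eq_bigr => i _.
by rewrite linearP scalerDr !scalerA mulrC.
Qed.

HB.instance Definition _ v := GRing.isLinear.Build R (mpoly d R) (mpoly d R) _
  (mpoly_deriv v) (mpoly_deriv_is_linear v).

Lemma mpoly_derivC v c : mpoly_deriv v (mC c) = 0.
Proof. by rewrite /mpoly_deriv big1// => i _; rewrite mderivC scaler0. Qed.

Lemma mpoly_derivM v p q :
  mpoly_deriv v (p * q) = mpoly_deriv v p * q + p * mpoly_deriv v q.
Proof.
rewrite /mpoly_deriv mulr_suml mulr_sumr -big_split; apply: eq_bigr => i _ /=.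
by rewrite mderivM scalerDr scalerAl scalerAr.
Qed.

Lemma mpoly_deriv_linform v w : mpoly_deriv v (linform w) = mC (dotp v w).
Proof.
rewrite /mpoly_deriv /dotp raddf_sum /=; apply: eq_bigr => i _.
have -> : mderiv i (linform w) = \sum_l mderiv i (w 0 l *: mX l).
  exact: raddf_sum.
rewrite (bigD1 i)// big1 => [|l li]; last first.
  by rewrite mderivZ mderivX mnm1E (negbTE li) scale0r scaler0.
rewrite Monoid.simpm mderivZ mderivX mnm1E eqxx scale1r.
rewrite (_ : mnm_sub _ _ = mnm0) ?mpolyX0; last first.
  by apply/mnmP => l; rewrite mnmBE subnn mnm0E.
by rewrite scalerA -mul_mpolyC mulr1.
Qed.

End Polynomials.

(** * Dunkl operators on polynomials *)

Section DunklAlgebra.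
Context {R : realType} {d : nat}.
Variables (Rp : {fset 'rV[R]_d}) (k : 'rV[R]_d -> R).
Implicit Types (p q : mpoly d R) (x y u v w b : 'rV[R]_d).
Local Notation mX i := (mpolyX R (mnm1 i) : mpoly d R).
Local Notation mC c := (mpolyC d c : mpoly d R).

(** A positive subsystem is not stable under its reflections, but the sums over
    it of even functions are. *)
Definition reflection_invariant : Prop :=
  forall (V : lmodType R) (a : 'rV[R]_d) (G : 'rV[R]_d -> V), a \in Rp ->
    (forall b, G (- b) = G b) ->
    \sum_(b <- Rp) k b *: G (reflect_in a b) = \sum_(b <- Rp) k b *: G b.

Fact dunkl_op_key : unit. Proof. exact: tt. Qed.

(** The operator in an arbitrary direction v, so that reflections can act on
    the direction. *)
Definition dunkl_op : 'rV[R]_d -> mpoly d R -> mpoly d R :=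
  locked_with dunkl_op_key (fun v p => mpoly_deriv v p +
    \sum_(b <- Rp) (k b * dotp b v) *: reflect_quotient b p).

Lemma dunkl_opE v p : dunkl_op v p = mpoly_deriv v p +
  \sum_(b <- Rp) (k b * dotp b v) *: reflect_quotient b p.
Proof. by rewrite /dunkl_op unlock. Qed.

Let coef b v w : R := 2 * dotp b v * dotp b w / dotp b b.

Hypothesis Rp0 : forall b, b \in Rp -> b != 0.

Lemma dunkl_op_is_linear v : linear (dunkl_op v).
Proof.
move=> c p q; rewrite !dunkl_opE linearP scalerDr -!addrA; congr (_ + _).
rewrite addrCA; congr (_ + _); rewrite scaler_sumr -big_split /=.
rewrite big_seq [RHS]big_seq; apply: eq_bigr => b bRp.
by rewrite reflect_quotient_is_linear ?Rp0// scalerDr !scalerA mulrC.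
Qed.

Lemma dunkl_opD v p q : dunkl_op v (p + q) = dunkl_op v p + dunkl_op v q.
Proof. by rewrite -[p in LHS]scale1r dunkl_op_is_linear scale1r. Qed.

Lemma dunkl_op0 v : dunkl_op v 0 = 0.
Proof.
by have := dunkl_opD v 0 0; rewrite addr0 -[LHS]addr0 => /addrI.
Qed.

Lemma dunkl_opZ v c p : dunkl_op v (c *: p) = c *: dunkl_op v p.
Proof. by rewrite -[c *: p]addr0 dunkl_op_is_linear dunkl_op0 addr0. Qed.

Lemma dunkl_op_sum v I (r : seq I) (F : I -> mpoly d R) :
  dunkl_op v (\sum_(i <- r) F i) = \sum_(i <- r) dunkl_op v (F i).
Proof.
elim/big_rec2: _ => [|i y1 y2 _ <-]; first exact: dunkl_op0.
exact: dunkl_opD.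
Qed.

Lemma dunkl_opC v c : dunkl_op v (mC c) = 0.
Proof.
rewrite dunkl_opE mpoly_derivC add0r big_seq big1// => b bRp.
by rewrite reflect_quotientC ?Rp0// scaler0.
Qed.

(** All properties of the T_v rest on their commutators with the multiplications
    by linear forms, where each difference quotient leaves a reflection. *)
Lemma dunkl_op_linform v w p :
  dunkl_op v (linform w * p) = linform w * dunkl_op v p + dotp v w *: p +
    \sum_(b <- Rp) k b *: (coef b v w *: mpoly_reflect b p).
Proof.
rewrite !dunkl_opE mpoly_derivM mpoly_deriv_linform mul_mpolyC mulrDr.
rewrite [_ *: p + _]addrC -!addrA; congr (_ + _).
rewrite [RHS]addrCA; congr (_ + _); rewrite mulr_sumr -big_split /=.
rewrite big_seq [RHS]big_seq; apply: eq_bigr => b bRp.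
rewrite reflect_quotient_linform ?Rp0// scalerDr scalerAr; congr (_ + _).
by rewrite !scalerA /coef; congr (_ *: _); ring.
Qed.

Lemma mpoly_deriv_sumv v p :
  mpoly_deriv v p = \sum_j v 0 j *: mpoly_deriv (delta_mx 0 j) p.
Proof.
apply: eq_bigr => j _; congr (_ *: _).
rewrite /mpoly_deriv (bigD1 j)//= big1 ?addr0.
  by rewrite mxE !eqxx scale1r.
by move=> l lj; rewrite mxE (negbTE lj) andbF scale0r.
Qed.

Lemma dotp_delta b j : dotp b (delta_mx 0 j) = b 0 j.
Proof.
rewrite /dotp (bigD1 j)//= big1 ?addr0; first by rewrite mxE !eqxx mulr1.
by move=> l lj; rewrite mxE (negbTE lj) andbF mulr0.
Qed.

Lemma dunkl_op_sumv v p :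
  dunkl_op v p = \sum_j v 0 j *: dunkl_op (delta_mx 0 j) p.
Proof.
under eq_bigr do rewrite dunkl_opE scalerDr.
rewrite big_split /= -mpoly_deriv_sumv dunkl_opE; congr (_ + _).
 under [RHS]eq_bigr do rewrite scaler_sumr.
rewrite exchange_big /=; apply: eq_bigr => b _.
under eq_bigr do rewrite scalerA.
rewrite -scaler_suml; congr (_ *: _).
under [RHS]eq_bigr do rewrite dotp_delta.
by rewrite /dotp mulr_sumr; apply: eq_bigr => j _; ring.
Qed.

Lemma dunkl_op_scalev c v p : dunkl_op (c *: v) p = c *: dunkl_op v p.
Proof.
rewrite dunkl_op_sumv [in RHS]dunkl_op_sumv scaler_sumr.
by apply: eq_bigr => j _; rewrite mxE scalerA.
Qed.

Lemma dunkl_op_addv v w p : dunkl_op (v + w) p = dunkl_op v p + dunkl_op w p.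
Proof.
rewrite (dunkl_op_sumv (v + w)) (dunkl_op_sumv v) (dunkl_op_sumv w) -big_split.
by apply: eq_bigr => j _; rewrite mxE scalerDl.
Qed.

Hypothesis Rp_inv : reflection_invariant.

(** Equivariance: the correction term of dunkl_op_linform is a sum of an even
    function of the root, so conjugation by sigma_a only reindexes it. *)
Lemma dunkl_op_reflect a v p : a \in Rp ->
  mpoly_reflect a (dunkl_op v p) = dunkl_op (reflect_in a v) (mpoly_reflect a p).
Proof.
move=> aRp; have a0 := Rp0 aRp.
elim/(@mpoly_ind_linform R d): p => [c|p q hp hq|w p hp].
- by rewrite mpoly_reflectC !dunkl_opC -(mpolyC0 d R) mpoly_reflectC.
- by rewrite dunkl_opD mpoly_reflectD hp hq mpoly_reflectD dunkl_opD.
rewrite mpoly_reflectM mpoly_reflect_linform !dunkl_op_linform.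
rewrite mpoly_reflectD [X in X + _]mpoly_reflectD mpoly_reflectM.
rewrite mpoly_reflect_linform mpoly_reflectZ.
rewrite hp dotp_reflect; congr (_ + _); rewrite mpoly_reflect_sum.
pose G b := coef b (reflect_in a v) (reflect_in a w) *:
  mpoly_reflect b (mpoly_reflect a p).
rewrite -(Rp_inv (G := G) aRp); last first.
  move=> b; rewrite /G mpoly_reflectNl /coef -scaleN1r !dotpZl dotpZr.
  by congr (_ *: _); rewrite !mulN1r !mulrN !mulNr !opprK.
apply: eq_bigr => b _; rewrite !mpoly_reflectZ /G mpoly_reflect_conj//.
by rewrite /coef !dotp_reflect.
Qed.

(** The terms along sigma_b of the commutator of T_u T_v with a linear form. Up
    to the order of its terms it is symmetric in u and v. *)
Let cross b u v p :=
  dotp b u *: mpoly_reflect b (dunkl_op v p) +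
  dotp b v *: mpoly_reflect b (dunkl_op u p) -
  coef b u v *: mpoly_reflect b (dunkl_op b p).

Lemma dunkl_op2_linform u v w p :
  dunkl_op u (dunkl_op v (linform w * p)) =
  linform w * dunkl_op u (dunkl_op v p) + dotp u w *: dunkl_op v p +
  dotp v w *: dunkl_op u p +
  \sum_(b <- Rp) (k b * (2 * dotp b w / dotp b b)) *: cross b u v p.
Proof.
rewrite (dunkl_op_linform v) !dunkl_opD (dunkl_op_linform u) dunkl_opZ.
rewrite dunkl_op_sum -!addrA; congr (_ + (_ + _)).
rewrite addrCA; congr (_ + _); rewrite -big_split /=.
rewrite big_seq [RHS]big_seq; apply: eq_bigr => b bRp.
have b0 : dotp b b != 0 by rewrite dotpp_eq0 Rp0.
rewrite !dunkl_opZ -{2}[u](reflect_inK b) -dunkl_op_reflect//.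
rewrite /reflect_in -(scaleNr _ b) dunkl_op_addv dunkl_op_scalev.
rewrite mpoly_reflectD mpoly_reflectZ /cross.
move: (mpoly_reflect b _) (mpoly_reflect b _) (mpoly_reflect b _) => A B C.
by rewrite /coef -!mul_mpolyC !(mpolyCM, mpolyCN); ring.
Qed.

(** By dunkl_op2_linform the commutator of T_u and T_v commutes with linear
    forms, and it kills constants, hence it is 0. *)
Lemma dunkl_op_comm u v p : dunkl_op u (dunkl_op v p) = dunkl_op v (dunkl_op u p).
Proof.
elim/(@mpoly_ind_linform R d): p => [c|p q hp hq|w p hp].
- by rewrite !dunkl_opC ?dunkl_op0.
- by rewrite !dunkl_opD hp hq.
rewrite !dunkl_op2_linform hp; congr (_ + _); first by rewrite addrAC.
apply: eq_bigr => b _; congr (_ *: _); rewrite /cross.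
have -> : coef b u v = coef b v u by rewrite /coef [2 * _ * _]mulrAC.
by rewrite [X in X - _]addrC.
Qed.

Definition dunkl_lap p := \sum_(j < d)
  dunkl_op (delta_mx 0 j) (dunkl_op (delta_mx 0 j) p).

Lemma dunkl_lapD p q : dunkl_lap (p + q) = dunkl_lap p + dunkl_lap q.
Proof.
by rewrite -big_split; apply: eq_bigr => j _; rewrite !dunkl_opD.
Qed.

Lemma dunkl_lapZ c p : dunkl_lap (c *: p) = c *: dunkl_lap p.
Proof.
by rewrite scaler_sumr; apply: eq_bigr => j _; rewrite !dunkl_opZ.
Qed.

Lemma dunkl_lap_op v p : dunkl_lap (dunkl_op v p) = dunkl_op v (dunkl_lap p).
Proof.
rewrite /dunkl_lap dunkl_op_sum; apply: eq_bigr => j _.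
by rewrite (dunkl_op_comm _ v) (dunkl_op_comm _ v).
Qed.

(** Summed over an orthonormal basis of directions, the terms cross along each
    sigma_b cancel, since sum_j <b, e_j> T_(e_j) = T_b. *)
Lemma dunkl_lap_linform w p :
  dunkl_lap (linform w * p) = linform w * dunkl_lap p + 2 *: dunkl_op w p.
Proof.
rewrite /dunkl_lap; under eq_bigr do rewrite dunkl_op2_linform -!addrA.
rewrite big_split /= -mulr_sumr; congr (_ + _).
under eq_bigr do rewrite addrA; rewrite big_split /=.
rewrite [X in _ + X](_ : _ = 0) ?addr0.
  rewrite (dunkl_op_sumv w) scaler_sumr; apply: eq_bigr => j _.
  by rewrite dotpC dotp_delta -scalerDl scalerA; congr (_ *: _); ring.
rewrite exchange_big /= big_seq big1// => b bRp.
have b0 : dotp b b != 0 by rewrite dotpp_eq0 Rp0.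
rewrite -scaler_sumr /cross sumrB.
have -> : \sum_(j < d) coef b (delta_mx 0 j) (delta_mx 0 j) *:
    mpoly_reflect b (dunkl_op b p) = 2 *: mpoly_reflect b (dunkl_op b p).
  rewrite -scaler_suml; congr (_ *: _).
  under eq_bigr do rewrite /coef !dotp_delta -mulrA -mulrA.
  by rewrite -mulr_sumr; under eq_bigr do rewrite mulrA; rewrite -mulr_suml divff// mulr1.
rewrite [in X in _ *: (_ - X)]dunkl_op_sumv mpoly_reflect_sum scaler_sumr.
rewrite -sumrB big1 ?scaler0// => j _.
by rewrite mpoly_reflectZ scalerA dotp_delta -scalerDl mulr2n mulrDl !mul1r subrr.
Qed.

End DunklAlgebra.

(** * The Dunkl heat operator and Macdonald's identity *)

Section DunklDegree.
Context {R : realType} {d : nat}.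
Variables (Rp : {fset 'rV[R]_d}) (k : 'rV[R]_d -> R).
Implicit Types (p q : mpoly d R) (x y u v w b : 'rV[R]_d) (m : multinom d).
Local Notation mX i := (mpolyX R (mnm1 i) : mpoly d R).
Local Notation mC c := (mpolyC d c : mpoly d R).
Local Notation homog n := (ishomog1 n mdeg).

Hypothesis Rp0 : forall b, b \in Rp -> b != 0.
Local Notation D := (dunkl_op Rp k).

Lemma mnm_split_deg n m : mdeg m = n.+1 ->
  exists i m', m = mnm_add (mnm1 i) m' /\ mdeg m' = n.
Proof.
move=> mn; have [i mi] : exists i, (0 < m i)%N.
  apply/existsP; apply: contra_eqT mn => /existsPn h.
  rewrite mdegE big1// => i _; have := h i; by rewrite -eqn0Ngt => /eqP.
exists i, (mnm_sub m (mnm1 i)).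
have mE : m = mnm_add (mnm1 i) (mnm_sub m (mnm1 i)).
  apply/mnmP => l; rewrite mnmDE mnmBE mnm1E.
  by case: eqP => [<-|_]; rewrite ?subnKC// subn0.
split=> //; have := congr1 mdeg mE; rewrite mdegD mdeg1 mn add1n => -[] <-//.
Qed.

Lemma linform_homog w : linform w \is homog 1.
Proof.
apply: rpred_sum => i _; apply: rpredZ.
by rewrite dhomogX; apply/eqP; exact: mdeg1.
Qed.

Lemma mpoly_reflect_homog b n p :
  p \is homog n -> mpoly_reflect b p \is homog n.
Proof.
move=> /dhomogP ph; rewrite [p]mpolyE mpoly_reflect_sum big_seq.
apply: rpred_sum => m /ph <-; rewrite mpoly_reflectZ; apply: rpredZ.
move: {2}(mdeg m) (erefl (mdeg m)) => n'.
elim: n' m => [|n' IH] m mn.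
  move/eqP: (mn); rewrite mdeg_eq0 => /eqP ->.
  by rewrite mpolyX0 -mpolyC1 mpoly_reflectC mpolyC1 /= mdeg0 dhomog1.
have [i [m' [-> m'n]]] := mnm_split_deg mn.
rewrite mpolyXD mpoly_reflectM /= mdegD mdeg1; apply: dhomogM; last exact: IH.
by rewrite -linform_delta mpoly_reflect_linform linform_homog.
Qed.

(** In degree 0 there is no lower degree, and the only possible value is 0. *)
Let lower n q := if n is n'.+1 then q \is homog n' else q = 0.

Lemma dunkl_op_homog v n p : p \is homog n -> lower n (D v p).
Proof.
have lowerD q1 q2 c : lower n q1 -> lower n q2 -> lower n (c *: q1 + q2).
  rewrite /lower; case: (n) => [-> ->|n'] ; first by rewrite scaler0 addr0.
  by move=> h1 h2; rewrite rpredD// rpredZ.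
move=> /dhomogP ph; rewrite [p]mpolyE dunkl_op_sum// big_seq.
elim/big_ind: _ => [|q1 q2 h1 h2|m /ph].
- by rewrite /lower; case: (n) => // n'; exact: rpred0.
- by rewrite -[q1]scale1r; apply: lowerD.
move=> mn; rewrite -[D v _]addr0 dunkl_opZ//; apply: lowerD; last first.
  by rewrite /lower; case: (n) => // n'; exact: rpred0.
elim: n m mn {ph} => [|n IH] m mn.
  move/eqP: mn; rewrite mdeg_eq0 => /eqP ->.
  by rewrite mpolyX0 -mpolyC1 dunkl_opC.
have [i [m' [-> m'n]]] := mnm_split_deg mn.
rewrite mpolyXD -linform_delta dunkl_op_linform//.
have Xm' : mpolyX R m' \is homog n by rewrite dhomogX; apply/eqP.
rewrite /lower !rpredD// ?rpredZ//; last first.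
  by apply: rpred_sum => b _; rewrite !rpredZ// mpoly_reflect_homog.
move: (IH _ m'n); rewrite /lower; case: (n) => [->|n']; first by rewrite mulr0 rpred0.
by move=> h; rewrite -[n'.+1]add1n dhomogM// linform_homog.
Qed.

Lemma msize_dunkl_op v n p : (msize p <= n.+1)%N -> (msize (D v p) <= n)%N.
Proof.
move=> pn; rewrite [p]mpolyE dunkl_op_sum// big_seq.
elim/big_ind: _ => [|q1 q2 h1 h2|m mp]; first by rewrite msize0.
  by apply: leq_trans (msizeD_le _ _) _; rewrite geq_max h1.
rewrite dunkl_opZ//; apply: leq_trans (msizeZ_le _ _) _.
have : mpolyX R m \is homog (mdeg m) by rewrite dhomogX.
move=> /(dunkl_op_homog v); case mn: (mdeg m) => [|n'] /=.
  by move=> ->; rewrite msize0.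
move=> /dhomogP h; rewrite msizeE; apply/bigmax_leqP_seq => m' /h -> _.
by have := leq_trans (msize_mdeg_lt mp) pn; rewrite mn ltnS.
Qed.

Local Notation Lap := (dunkl_lap Rp k).

Lemma msize_dunkl_lap n p : (msize p <= n.+1)%N -> (msize (Lap p) <= n)%N.
Proof.
move=> pn; rewrite /dunkl_lap; elim/big_ind: _ => [|q1 q2 h1 h2|j _].
- by rewrite msize0.
- by apply: leq_trans (msizeD_le _ _) _; rewrite geq_max h1.
- by rewrite msize_dunkl_op// ltnW// ltnS msize_dunkl_op.
Qed.

Lemma iter_dunkl_lap0 i p : (msize p <= i)%N -> iter i Lap p = 0.
Proof.
elim: i p => [|i IH] p pi; first by apply/eqP; rewrite -msize_poly_eq0 -leqn0.
by rewrite iterSr IH// msize_dunkl_lap.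
Qed.

Definition heat_coef i : R := (- 4^-1) ^+ i / (i`!)%:R.

Definition exp_lap p : mpoly d R :=
  \sum_(i < msize p) heat_coef i *: iter i Lap p.

(** The exponential series may be cut at any bound on the size, which lets two
    polynomials share the same bound. *)
Lemma exp_lapE n p : (msize p <= n)%N ->
  exp_lap p = \sum_(i < n) heat_coef i *: iter i Lap p.
Proof.
move=> pn; rewrite /exp_lap (big_ord_widen n (fun i => heat_coef i *: iter i Lap p))//.
rewrite big_mkcond /=; apply: eq_bigr => i _; case: ltnP => // pi.
by rewrite iter_dunkl_lap0// scaler0.
Qed.

Lemma iter_dunkl_lapD i p q : iter i Lap (p + q) = iter i Lap p + iter i Lap q.
Proof. by elim: i => [|i IH]//; rewrite !iterS IH dunkl_lapD. Qed.

Lemma iter_dunkl_lapZ i c p : iter i Lap (c *: p) = c *: iter i Lap p.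
Proof. by elim: i => [|i IH]//; rewrite !iterS IH dunkl_lapZ. Qed.

Lemma exp_lapD p q : exp_lap (p + q) = exp_lap p + exp_lap q.
Proof.
pose n := maxn (msize p) (msize q).
rewrite (@exp_lapE n) ?msizeD_le// (@exp_lapE n p) ?leq_maxl//.
rewrite (@exp_lapE n q) ?leq_maxr// -big_split; apply: eq_bigr => i _.
by rewrite iter_dunkl_lapD scalerDr.
Qed.

Lemma exp_lapZ c p : exp_lap (c *: p) = c *: exp_lap p.
Proof.
rewrite (exp_lapE (msizeZ_le _ _)) /exp_lap scaler_sumr; apply: eq_bigr => i _.
by rewrite iter_dunkl_lapZ !scalerA mulrC.
Qed.

Lemma exp_lap_sum I (r : seq I) (F : I -> mpoly d R) :
  exp_lap (\sum_(i <- r) F i) = \sum_(i <- r) exp_lap (F i).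
Proof.
elim/big_rec2: _ => [|i y1 y2 _ <-]; last exact: exp_lapD.
by rewrite /exp_lap msize0 big_ord0.
Qed.

Lemma exp_lapC c : exp_lap (mC c) = mC c.
Proof.
rewrite (@exp_lapE 1); first by rewrite big_ord1 /heat_coef expr0 fact0 divr1 scale1r.
by rewrite msizeC; case: eqP.
Qed.

Hypothesis Rp_inv : reflection_invariant Rp k.

Lemma iter_dunkl_lap_op i v p : iter i Lap (D v p) = D v (iter i Lap p).
Proof. by elim: i => [|i IH]//; rewrite !iterS IH dunkl_lap_op. Qed.

Lemma exp_lap_op v p : exp_lap (D v p) = D v (exp_lap p).
Proof.
rewrite (@exp_lapE (msize p)); last first.
  case pn : (msize p) => [|n]; last by rewrite msize_dunkl_op// pn.
  have /eqP : msize p == 0%N by rewrite pn.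
  by move=> /eqP; rewrite msize_poly_eq0 => /eqP ->; rewrite dunkl_op0// msize0.
rewrite /exp_lap dunkl_op_sum//; apply: eq_bigr => i _.
by rewrite dunkl_opZ// iter_dunkl_lap_op.
Qed.

Lemma iter_dunkl_lap_linform i w p : iter i Lap (linform w * p) =
  linform w * iter i Lap p + (2 * i%:R) *: iter i.-1 Lap (D w p).
Proof.
elim: i => [|i IH]; first by rewrite mulr0 scale0r addr0.
rewrite !iterS IH dunkl_lapD// dunkl_lap_linform// dunkl_lapZ// -addrA.
congr (_ + _); rewrite -iter_dunkl_lap_op; case: i {IH} => [|i] /=.
  by rewrite mulr0 scale0r addr0 mulr1.
by rewrite -scalerDl -[in RHS]natr1; congr (_ *: _); ring.
Qed.

(** From the commutator 2 T_w of Delta_k with <w, x>, that of its i-th power is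
    2 i T_w Delta_k^(i-1); the sum over i is again an exponential. *)
Lemma exp_lap_linform w p :
  exp_lap (linform w * p) = linform w * exp_lap p - 2^-1 *: D w (exp_lap p).
Proof.
have sw : (msize (linform w * p) <= (msize p).+1)%N.
  have [->|p0] := eqVneq p 0; first by rewrite mulr0 msize0.
  have [->|w0] := eqVneq (linform w) 0; first by rewrite mul0r msize0.
  have w2 : (msize (linform w) <= 2)%N.
    rewrite msizeE; apply/bigmax_leqP_seq => m mw _.
    by have /dhomogP/(_ m mw) /= -> := linform_homog w.
  rewrite msizeM//; apply: (@leq_trans (2 + msize p).-1) => //.
  by rewrite -!subn1 leq_sub2r// leq_add2r.
rewrite (exp_lapE sw) -exp_lap_op.
under eq_bigr do rewrite iter_dunkl_lap_linform scalerDr.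
rewrite big_split /= (@exp_lapE (msize p).+1 p) ?leqnSn// mulr_sumr; congr (_ + _).
  by apply: eq_bigr => i _; rewrite scalerAr.
rewrite big_ord_recl mulr0 scale0r scaler0 add0r.
rewrite (@exp_lapE (msize p)); last first.
  case pn : (msize p) => [|n]; last by rewrite msize_dunkl_op// pn.
  have /eqP : msize p == 0%N by rewrite pn.
  by move=> /eqP; rewrite msize_poly_eq0 => /eqP ->; rewrite dunkl_op0// msize0.
rewrite -scaleNr scaler_sumr; apply: eq_bigr => i _ /=.
rewrite !scalerA; congr (_ *: _); rewrite /heat_coef /bump /= add1n exprS factS natrM.
have i0 : (i.+1)%:R != 0 :> R by rewrite pnatr_eq0.
have f0 : (i`!)%:R != 0 :> R by rewrite pnatr_eq0 -lt0n fact_gt0.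
move: (_ ^+ i) (i`!)%:R (i.+1)%:R f0 i0 => a f n f0 n0.
by field; rewrite f0 n0.
Qed.

Lemma dunkl_opM v p q : D v (p * q) = D v p * q + p * D v q -
  \sum_(b <- Rp) (k b * dotp b v) *:
    (linform b * (reflect_quotient b p * reflect_quotient b q)).
Proof.
rewrite !dunkl_opE mpoly_derivM mulrDl mulrDr addrACA -[RHS]addrA; congr (_ + _).
rewrite mulr_suml mulr_sumr -big_split /= -sumrB big_seq [RHS]big_seq.
apply: eq_bigr => b bRp; rewrite reflect_quotientM ?Rp0// scalerBr scalerDr.
by rewrite scalerAl scalerAr.
Qed.

End DunklDegree.

Section Macdonald.
Context {R : realType} {d : nat}.
Variables (Rp : {fset 'rV[R]_d}) (k : 'rV[R]_d -> R).
Implicit Types (p q : mpoly d R) (x y u v w b : 'rV[R]_d) (m : multinom d).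
Local Notation mX i := (mpolyX R (mnm1 i) : mpoly d R).
Local Notation mC c := (mpolyC d c : mpoly d R).
Local Notation homog n := (ishomog1 n mdeg).
Local Notation D := (dunkl_op Rp k).
Local Notation Ex := (exp_lap Rp k).
Hypothesis Rp0 : forall b, b \in Rp -> b != 0.
Hypothesis Rp_inv : reflection_invariant Rp k.
Variable L : mpoly d R -> R.
Hypothesis LD : forall p q, L (p + q) = L p + L q.
Hypothesis LZ : forall c p, L (c *: p) = c * L p.
Hypothesis L_op : forall v p, L (D v p) = 2 * L (linform v * p).
Hypothesis L_reflect : forall b p, b \in Rp -> L (mpoly_reflect b p) = L p.

Let L0 : L 0 = 0. Proof. by rewrite -(scale0r 0) LZ mul0r. Qed.

Let LN p : L (- p) = - L p. Proof. by rewrite -scaleN1r LZ mulN1r. Qed.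

Let L_sum I (r : seq I) (F : I -> mpoly d R) :
  L (\sum_(i <- r) F i) = \sum_(i <- r) L (F i).
Proof. by elim/big_rec2: _ => [|i y1 y2 _ <-]; [exact: L0|exact: LD]. Qed.

(** The correction to the Leibniz rule is a sum of terms <b, x> r with r
    invariant under sigma_b. They are odd under sigma_b, so L kills them. *)
Lemma functional_dunkl_opM v p q :
  L (D v p * q) + L (p * D v q) = 2 * L (linform v * (p * q)).
Proof.
rewrite -L_op dunkl_opM// LD LN -LD [X in _ - X](_ : _ = 0) ?subr0//.
rewrite L_sum big_seq big1// => b bRp; rewrite LZ.
set r := linform b * _.
suff : L r = - L r.
  by move/eqP; rewrite -addr_eq0 -mulr2n mulrn_eq0 => /eqP ->; rewrite mulr0.
rewrite -LN -(L_reflect r bRp) /r !mpoly_reflectM !mpoly_reflect_quotient ?Rp0//.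
by rewrite mpoly_reflect_linform reflect_in_self ?Rp0// -scaleN1r linformZ scaleN1r mulNr.
Qed.

Let B p q := L (Ex p * Ex q).

(** The adjoint of multiplication by <w, x> is T_w / 2: the terms T_w / 2 of
    exp_lap_linform and those of integration by parts cancel. *)
Let B_linform w p q : B (linform w * p) q = 2^-1 * B p (D w q).
Proof.
rewrite /B exp_lap_linform// mulrBl LD LN -scalerAl LZ exp_lap_op//.
have := functional_dunkl_opM w (Ex p) (Ex q); rewrite -mulrA => h.
have -> : L (linform w * (Ex p * Ex q)) =
  2^-1 * (L (D w (Ex p) * Ex q) + L (Ex p * D w (Ex q))) by rewrite h mulKf.
by rewrite mulrDr addrAC subrr add0r.
Qed.

Let B_sym p q : B p q = B q p. Proof. by rewrite /B mulrC. Qed.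

Let BC c q : B (mC c) q = c * (L 1 * mpoly_fun q 0).
Proof.
have BZ c' p' q' : B (c' *: p') q' = c' * B p' q'.
  by rewrite /B exp_lapZ// -scalerAl LZ.
rewrite -[mC c]mulr1 mul_mpolyC BZ; congr (_ * _).
elim/(@mpoly_ind_linform R d) : q => [c'|q1 q2 h1 h2|w q h].
- rewrite B_sym mpoly_funC -[mC c']mulr1 mul_mpolyC BZ mulrC; congr (_ * _).
  by rewrite /B -mpolyC1 !exp_lapC// mpolyC1 mulr1.
- by rewrite mpoly_funD mulrDr -h1 -h2 /B exp_lapD// mulrDr LD.
- have -> : B 1 (linform w * q) = 0.
    have Ex0 : Ex 0 = 0 by rewrite /exp_lap msize0 big_ord0.
    by rewrite B_sym B_linform -mpolyC1 dunkl_opC// /B Ex0 mulr0 L0 mulr0.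
  rewrite mpoly_funM mpoly_fun_linform (_ : dotp w 0 = 0) ?mul0r ?mulr0//.
  by rewrite /dotp big1// => i _; rewrite mxE mulr0.
Qed.

Definition dunkl_op_monomial m q :=
  foldr (fun i r => iter (m i) (D (delta_mx 0 i)) r) q (enum 'I_d).

Definition fischer_form p q :=
  mpoly_fun (\sum_(m <- msupp p) mcoeff m p *: dunkl_op_monomial m q) 0.

Let B_Xn i n p q :
  B (mX i ^+ n * p) q = 2^-1 ^+ n * B p (iter n (D (delta_mx 0 i)) q).
Proof.
elim: n q => [|n IH] q; first by rewrite !expr0 !mul1r.
by rewrite exprS -mulrA -linform_delta B_linform linform_delta IH mulrA iterSr exprS.
Qed.

Let B_monomial m q : B (mpolyX R m) q =
  2^-1 ^+ mdeg m * (L 1 * mpoly_fun (dunkl_op_monomial m q) 0).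
Proof.
rewrite -[mpolyX R m]mulr1 mpolyXE_id mdegE /dunkl_op_monomial.
rewrite -[X in X * 1]big_enum -[X in _ ^+ X]big_enum.
have -> : forall s p, B ((\prod_(i <- s) mX i ^+ m i) * p) q =
  2^-1 ^+ (\sum_(i <- s) m i) *
  B p (foldr (fun i r => iter (m i) (D (delta_mx 0 i)) r) q s).
  elim=> [|i s IH] p; first by rewrite !big_nil expr0 !mul1r.
  by rewrite !big_cons -mulrA mulrCA IH B_Xn mulrA -exprD addnC.
by rewrite -mpolyC1 BC mul1r.
Qed.

(** Moving the variables of p one by one to the other side replaces p by
    2^(-n) p(T), and then only the value at 0 of the result matters. *)
Theorem macdonald_identity n p q : p \is homog n ->
  L (Ex p * Ex q) = 2^-1 ^+ n * (L 1 * fischer_form p q).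
Proof.
move=> /dhomogP ph; rewrite {1}[p]mpolyE exp_lap_sum// mulr_suml L_sum.
rewrite /fischer_form mpoly_fun_sum !mulr_sumr big_seq [RHS]big_seq.
apply: eq_bigr => m /ph <-; rewrite exp_lapZ// -scalerAl LZ -/(B _ _) B_monomial.
by rewrite mpoly_funZ; ring.
Qed.

End Macdonald.

(** * From polynomials to functions *)

Section DirectionalDerivatives.
Context {R : realType} {d : nat}.
Implicit Types (F : 'rV[R]_d -> R) (x y v : 'rV[R]_d).

Lemma is_derive_along_line F y v (s dF : R) :
  is_derive (s *: v + y) v F dF <-> is_derive s 1 (fun t => F (t *: v + y)) dF.
Proof.
have E : (fun h : R => h^-1 *: ((F \o shift (s *: v + y)) (h *: v) -
      F (s *: v + y))) =
    (fun h : R => h^-1 *: (((fun t => F (t *: v + y)) \o shift s) (h *: 1) -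
      F (s *: v + y))).
  apply/funext => h /=; congr (_ *: (F _ - _)).
  by rewrite addrA -scalerDl [h *: 1]mulr1.
split=> -[df <-]; split.
- by rewrite /derivable -E.
- by rewrite /derive -E.
- by rewrite /derivable E.
- by rewrite /derive E.
Qed.

Lemma is_derive_comp_dir F (f : R -> R) x v (dF df : R) :
  is_derive x v F dF -> is_derive (F x) 1 f df ->
  is_derive x v (f \o F) (df * dF).
Proof.
have {1 3}-> : x = 0 *: v + x by rewrite scale0r add0r.
move=> /is_derive_along_line hF hf; apply/is_derive_along_line.
apply: (is_derive1_comp (f := f) (g := fun t => F (t *: v + x))) hF.
by rewrite scale0r add0r.
Qed.

End DirectionalDerivatives.

Section PolynomialFunctions.
Context {R : realType} {d : nat}.
Implicit Types (p q : mpoly d R) (x y u v w b : 'rV[R]_d).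
Local Notation mC c := (mpolyC d c : mpoly d R).

Lemma is_derive_dotp w x v : is_derive x v (dotp w) (dotp w v).
Proof.
have h : (fun h : R => h^-1 *: ((dotp w \o shift x) (h *: v) - dotp w x)) @ 0^'
    --> dotp w v.
  apply: cvg_near_cst; near=> h; have h0 : h != 0 by near: h; exact: nbhs_dnbhs_neq.
  by rewrite /= dotpDr addrK dotpZr scalerA mulVf// scale1r.
by apply: DeriveDef; [apply/cvg_ex; exists (dotp w v)|exact: cvg_lim].
Unshelve. all: by end_near. Qed.

Lemma is_derive_mpoly_fun p x v :
  is_derive x v (mpoly_fun p) (mpoly_fun (mpoly_deriv v p) x).
Proof.
elim/(@mpoly_ind_linform R d) : p => [c|p q hp hq|w p hp].
- have -> : mpoly_fun (mC c) = cst c :> ('rV[R]_d -> R).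
    by apply/funext => y; rewrite mpoly_funC.
  rewrite mpoly_derivC /mpoly_fun meval0; exact: is_derive_cst.
- have -> : mpoly_fun (p + q) = mpoly_fun p + mpoly_fun q :> ('rV[R]_d -> R).
    by apply/funext => y; rewrite mpoly_funD.
  by rewrite raddfD /= mpoly_funD; exact: is_deriveD.
- have -> : mpoly_fun (linform w * p) = dotp w * mpoly_fun p :> ('rV[R]_d -> R).
    by apply/funext => y; rewrite mpoly_funM mpoly_fun_linform.
  rewrite mpoly_derivM mpoly_deriv_linform.
  have hw := is_derive_dotp w x v.
  apply: is_derive_eq.
  rewrite mpoly_funD !mpoly_funM mpoly_funC mpoly_fun_linform /GRing.scale /=.
  by rewrite addrC (dotpC v w); congr (_ + _); rewrite mulrC.
Qed.

(** By induction on the size: the partial derivatives of p - q vanish as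
    functions, hence as polynomials, so p - q is constant. *)
Lemma mpoly_fun_inj p q :
  (forall x, mpoly_fun p x = mpoly_fun q x) -> p = q.
Proof.
move=> pq; apply/eqP; rewrite -subr_eq0; apply/eqP.
have {pq} : forall x, mpoly_fun (p - q) x = 0.
  by move=> x; rewrite mpoly_funB pq subrr.
move: (p - q) => {p q} p; move: {2}(msize p) (leqnn (msize p)) => n.
elim: n p => [|n IH] p pn p0.
  by apply/eqP; rewrite -msize_poly_eq0 -leqn0.
have dp j : mderiv j p = 0.
  apply: IH => [|x].
    (* Without roots the Dunkl operator is a derivative, whose size is known. *)
    have -> : mderiv j p = dunkl_op fset0 (fun=> 0) (delta_mx 0 j) p.
      rewrite dunkl_opE big_seq_fset0 addr0 /mpoly_deriv (bigD1 j)//= big1 ?addr0.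
        by rewrite mxE !eqxx scale1r.
      by move=> l lj; rewrite mxE (negbTE lj) andbF scale0r.
    by apply: msize_dunkl_op.
  have := is_derive_mpoly_fun p x (delta_mx 0 j).
  have -> : mpoly_fun p = cst 0 :> ('rV[R]_d -> R) by apply/funext => y; rewrite p0.
  move=> h; have := @derive_val _ _ _ _ _ _ _ h; rewrite derive_cst.
  rewrite /mpoly_deriv (bigD1 j)//= big1 ?addr0 => [|l lj].
    by rewrite mxE !eqxx scale1r.
  by rewrite mxE (negbTE lj) andbF scale0r.
suff pc : p = mC (mcoeff mnm0 p).
  by have := p0 0; rewrite pc mpoly_funC => ->; rewrite mpolyC0.
apply/mpolyP => m; rewrite mcoeffC; case: eqVneq => [->|m0]; first by rewrite mulr1.
rewrite mulr0; have [i mi] : exists i, (0 < m i)%N.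
  apply/existsP; apply: contraNT m0 => /existsPn h; apply/eqP/mnmP => i.
  by rewrite mnm0E; have := h i; rewrite -eqn0Ngt => /eqP.
have mE : m = mnm_add (mnm_sub m (mnm1 i)) (mnm1 i).
  apply/mnmP => l; rewrite mnmDE mnmBE mnm1E.
  by case: eqP => [<-|_]; rewrite ?subnK// subn0 addn0.
have := congr1 (mcoeff (mnm_sub m (mnm1 i))) (dp i).
by rewrite mcoeff_mderiv -mE mcoeff0 => /eqP; rewrite mulrn_eq0 /= => /eqP.
Qed.

End PolynomialFunctions.

Section DunklFunctions.
Context {R : realType} {d : nat}.
Variables (Rp : {fset 'rV[R]_d}) (k : 'rV[R]_d -> R).
Implicit Types (p q : mpoly d R) (x y u v w b : 'rV[R]_d).
Hypothesis Rp0 : forall b, b \in Rp -> b != 0.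
Local Notation mC c := (mpolyC d c : mpoly d R).

(** On the hyperplane <b, x> = 0, differentiating <b, .> q = p - p o sigma_b
    along b gives <b, b> q = 2 D_b p. *)
Lemma divided_difference_mpoly_fun b p x : b != 0 ->
  divided_difference b (mpoly_fun p) x = mpoly_fun (reflect_quotient b p) x.
Proof.
move=> b0; rewrite /divided_difference; case: ifPn => [/eqP bx|bx].
  have -> : 'D_b (mpoly_fun p) x = mpoly_fun (mpoly_deriv b p) x.
    by have h := is_derive_mpoly_fun p x b; rewrite derive_val.
  elim/(@mpoly_ind_linform R d) : p => [c|p q hp hq|w p hp].
  - by rewrite reflect_quotientC// mpoly_derivC /mpoly_fun !meval0 mulr0.
  - have -> : reflect_quotient b (p + q) =
        reflect_quotient b p + reflect_quotient b q.
      by rewrite -[p in LHS]scale1r reflect_quotient_is_linear// scale1r.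
    by rewrite !raddfD /= !mpoly_funD mulrDr hp hq.
  - rewrite mpoly_derivM mpoly_deriv_linform reflect_quotient_linform//.
    rewrite !mpoly_funD !mpoly_funM mpoly_funC mpoly_fun_linform mpoly_funZ.
    rewrite -hp mpoly_fun_reflect /reflect_in bx mulr0 mul0r scale0r subr0.
    by ring.
have := congr1 (fun q => mpoly_fun q x) (reflect_quotientP b p).
rewrite mpoly_funM mpoly_fun_linform mpoly_funB mpoly_fun_reflect => <-.
by rewrite mulrC mulKf.
Qed.

Lemma dunkl_mpoly_fun j p x :
  dunkl Rp k j (mpoly_fun p) x = mpoly_fun (dunkl_op Rp k (delta_mx 0 j) p) x.
Proof.
rewrite /dunkl dunkl_opE mpoly_funD; congr (_ + _).
  by have h := is_derive_mpoly_fun p x (delta_mx 0 j); rewrite derive_val.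
rewrite mpoly_fun_sum big_seq [RHS]big_seq; apply: eq_bigr => b bRp.
by rewrite mpoly_funZ divided_difference_mpoly_fun ?Rp0// dotp_delta.
Qed.

Lemma dunklPE j : dunklP Rp k j = dunkl_op Rp k (delta_mx 0 j).
Proof.
apply/funext => p; apply: mpoly_fun_inj => x.
rewrite /dunklP; case: xgetP => [q _ ->|/(_ (dunkl_op Rp k (delta_mx 0 j) p))].
  exact: dunkl_mpoly_fun.
by case => y; rewrite dunkl_mpoly_fun.
Qed.

Lemma fischerE p q : fischer Rp k p q = fischer_form Rp k p q.
Proof.
rewrite /fischer /dunkl_subst /fischer_form; congr mpoly_fun.
apply: eq_bigr => m _; congr (_ *: _); rewrite /dunkl_monomial /dunkl_op_monomial.
by elim: (enum _) => //= i s ->; rewrite dunklPE.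
Qed.

Lemma exp_laplaceE p : exp_laplace Rp k p = exp_lap Rp k p.
Proof.
apply: eq_bigr => i _; congr (_ *: _); elim: (i : nat) => //= n ->.
by apply: eq_bigr => j _; rewrite dunklPE.
Qed.

Definition gauss x : R := expR (- (dotp x x / 2)).

Lemma is_derive_dotpp x v : is_derive x v (fun y => dotp y y) (2 * dotp x v).
Proof.
pose F y : R := \sum_(i < d) (dotp (delta_mx 0 i) * dotp (delta_mx 0 i)) y.
have -> : (fun y => dotp y y) = \sum_(i < d) (dotp (delta_mx 0 i) * dotp (delta_mx 0 i)).
  apply/funext => y; rewrite fct_sumE; apply: eq_bigr => i _.
  by rewrite [RHS]/GRing.mul/= !(dotpC _ y) !dotp_delta.
have h (i : 'I_d) : is_derive x v (dotp (delta_mx 0 i) * dotp (delta_mx 0 i))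
    (2 * x 0 i * v 0 i).
  have hi := is_derive_dotp (delta_mx 0 i) x v.
  apply: is_derive_eq; rewrite /GRing.scale /= (dotpC _ x) (dotpC _ v) !dotp_delta.
  by ring.
apply: is_derive_eq.
by rewrite /dotp mulr_sumr; apply: eq_bigr => i _; rewrite mulrA.
Qed.

Lemma is_derive_gauss x v : is_derive x v gauss (- dotp x v * gauss x).
Proof.
have -> : gauss = expR \o (- 2^-1 *: (fun y : 'rV[R]_d => dotp y y)).
  apply/funext => y; rewrite /gauss /=; congr expR.
  by rewrite /GRing.scale /= /GRing.scale /=; ring.
have h := is_derive_dotpp x v.
have h2 : is_derive x v (- 2^-1 *: (fun y : 'rV[R]_d => dotp y y)) (- dotp x v).
  by apply: is_derive_eq; rewrite /GRing.scale /=; field.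
by have := is_derive_comp_dir h2 (is_derive_expR _); rewrite mulrC.
Qed.

Lemma gauss_reflect b x : gauss (reflect_in b x) = gauss x.
Proof. by rewrite /gauss dotp_reflect. Qed.

(** The derivative of the Gaussian cancels multiplication by the coordinate, and
    the Gaussian commutes with the differences because it is radial. *)
Lemma delta_gauss_mpoly c j p x :
  delta Rp k j (fun y => c * gauss y * mpoly_fun p y) x =
  c * gauss x * mpoly_fun (dunkl_op Rp k (delta_mx 0 j) p) x.
Proof.
have dF v : is_derive x v (fun y => c * gauss y * mpoly_fun p y)
  (c * gauss x * (mpoly_fun (mpoly_deriv v p) x - dotp x v * mpoly_fun p x)).
  have h1 := is_derive_gauss x v; have h2 := is_derive_mpoly_fun p x v.
  have -> : (fun y => c * gauss y * mpoly_fun p y) = (c *: gauss) * mpoly_fun p.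
    by apply/funext.
  apply: is_derive_eq; rewrite /GRing.scale /= /GRing.scale /=.
  by ring.
rewrite /delta /dunkl.
have -> : 'D_(delta_mx 0 j) (fun y => c * gauss y * mpoly_fun p y) x =
  c * gauss x * (mpoly_fun (mpoly_deriv (delta_mx 0 j) p) x -
     x 0 j * mpoly_fun p x).
  by have h := dF (delta_mx 0 j); rewrite derive_val dotp_delta.
rewrite dunkl_opE mpoly_funD [mpoly_fun (\sum_(b <- Rp) _) x]mpoly_fun_sum.
rewrite (_ : \sum_(b <- Rp) _ = c * gauss x * \sum_(b <- Rp)
  mpoly_fun ((k b * dotp b (delta_mx 0 j)) *: reflect_quotient b p) x); first by ring.
rewrite mulr_sumr big_seq [RHS]big_seq; apply: eq_bigr => b bRp.
rewrite mpoly_funZ dotp_delta mulrCA; congr (_ * _).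
rewrite -divided_difference_mpoly_fun ?Rp0// /divided_difference.
case: ifPn => [/eqP bx|bx].
  have -> : 'D_b (fun y => c * gauss y * mpoly_fun p y) x =
      c * gauss x * mpoly_fun (mpoly_deriv b p) x.
    by have h := dF b; rewrite derive_val dotpC bx mul0r subr0.
  have -> : 'D_b (mpoly_fun p) x = mpoly_fun (mpoly_deriv b p) x.
    by have h := is_derive_mpoly_fun p x b; rewrite derive_val.
  by rewrite mulrCA.
by rewrite gauss_reflect -mulrBr mulrA.
Qed.

End DunklFunctions.

Section RootSystem.
Context {R : realType} {d : nat}.
Variables (G : {fset 'M[R]_d}) (Phi Phip : {fset 'rV[R]_d}) (k : 'rV[R]_d -> R).
Hypothesis hPhi : root_system_of G Phi.
Hypothesis hPhip : positive_subsystem Phi Phip.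
Hypothesis hk : multiplicity G Phi k.

Lemma pos_root_root b : b \in Phip -> b \in Phi.
Proof. by have [u [_ ->]] := hPhip => /andP[]. Qed.

Lemma root_neq0 b : b \in Phi -> b != 0.
Proof.
by have [[P0 _ _] _] := hPhi; apply: contraTneq => ->.
Qed.

Lemma root_opp b : b \in Phi -> - b \in Phi.
Proof.
have [[_ Pc _] _] := hPhi => bP.
by rewrite -scaleN1r Pc// eqxx orbT.
Qed.

Lemma root_reflect a b : a \in Phi -> b \in Phi -> reflect_in a b \in Phi.
Proof. by have [[_ _ h] _] := hPhi; exact: h. Qed.

Lemma mult_reflect a b : a \in Phi -> b \in Phi -> k (reflect_in a b) = k b.
Proof.
move=> aP bP; have [_ kG] := hk; have [_ Gr] := hPhi.
pose g : 'M[R]_d := 1%:M - (2 / dotp a a) *: (a^T *m a).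
have gE x : x *m g = reflect_in a x.
  rewrite /g mulmxBr mulmx1 /reflect_in -scalemxAr mulmxA; congr (_ - _).
  have -> : x *m a^T = (dotp a x)%:M.
    apply/matrixP => i l; rewrite !ord1 !mxE eqxx mulr1n.
    by apply: eq_bigr => m _; rewrite mxE mulrC.
  by rewrite mul_scalar_mx scalerA; congr (_ *: _); rewrite mulrAC.
have [gG _] : g \in G /\ is_reflection g.
  by apply/Gr; exists a => //; split; [exact: root_neq0|].
by rewrite -gE kG.
Qed.

Lemma mult_opp b : b \in Phi -> k (- b) = k b.
Proof. by move=> bP; rewrite -reflect_in_self ?root_neq0// mult_reflect. Qed.

(** A root system is the disjoint union of the positive roots and their
    opposites. *)
Lemma sum_pos_roots (V : lmodType R) (F : 'rV[R]_d -> V) :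
  (forall b, b \in Phi -> F (- b) = F b) ->
  \sum_(b <- Phi) F b = 2 *: \sum_(b <- Phip) F b.
Proof.
move=> FN; have [u [u0 PE]] := hPhip.
have e1 : perm_eq (Phip : seq _) [seq b <- Phi | 0 < dotp b u].
  apply: uniq_perm; rewrite ?filter_uniq ?fset_uniq// => b.
  by rewrite mem_filter PE andbC.
have iN : injective (fun b : 'rV[R]_d => - b) by move=> b c /oppr_inj.
have e2 : perm_eq [seq - b | b <- (Phip : seq _)] [seq b <- Phi | ~~ (0 < dotp b u)].
  apply: uniq_perm; rewrite ?filter_uniq ?(map_inj_uniq iN) ?fset_uniq//.
  move=> b; rewrite mem_filter -{1}[b]opprK (mem_map iN).
  have dN : dotp (- b) u = - dotp b u by rewrite -scaleN1r dotpZl mulN1r.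
  rewrite PE dN andbC oppr_gt0 -leNgt.
  have -> : (- b \in Phi) = (b \in Phi).
    by apply/idP/idP => /root_opp //; rewrite opprK.
  case bP: (b \in Phi); rewrite ?andbF// !andbT.
  by rewrite lt_neqAle u0.
rewrite (bigID (fun b => 0 < dotp b u)) /= -big_filter -[X in _ + X]big_filter.
rewrite -(perm_big _ e1) -(perm_big _ e2) /= big_map scaler_nat mulr2n; congr (_ + _).
by rewrite big_seq [RHS]big_seq; apply: eq_bigr => b bP; rewrite FN// pos_root_root.
Qed.

(** The full root system is stable under its reflections, and a sum of an even
    function over it is twice the sum over the positive roots. *)
Lemma pos_roots_reflection_invariant : reflection_invariant Phip k.
Proof.
move=> V a F aPp FN; have aP := pos_root_root aPp.
have two : (2 : R) != 0 by rewrite pnatr_eq0.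
apply: (scalerI two); rewrite -!sum_pos_roots; last 2 first.
- by move=> b bP; rewrite FN mult_opp.
- by move=> b bP; rewrite reflect_inN FN mult_opp.
have e : perm_eq [seq reflect_in a b | b <- (Phi : seq _)] Phi.
  have ia : injective (fun b => reflect_in a b) := can_inj (reflect_inK a).
  apply: uniq_perm; rewrite ?(map_inj_uniq ia) ?fset_uniq//.
  move=> b; apply/mapP/idP => [[c cP ->]|bP]; first exact: root_reflect.
  by exists (reflect_in a b); rewrite ?reflect_inK// root_reflect.
rewrite -[RHS](perm_big _ e) big_map big_seq [RHS]big_seq.
by apply: eq_bigr => b bP; rewrite mult_reflect.
Qed.

End RootSystem.

(** * Integrals against the Gaussian *)

Section IntegralDerivative.
Context {R : realType}.
Local Notation leb := (@lebesgue_measure R).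

Lemma integral_derivative0 (f f' : R -> R) :
  (forall s : R, is_derive s 1 f (f' s)) -> continuous f' ->
  leb.-integrable setT (EFin \o f') ->
  f n%:R @[n --> \oo] --> 0 -> f (- n%:R) @[n --> \oo] --> 0 ->
  (\int[leb]_s (f' s)%:E = 0)%E.
Proof.
move=> df cf' if' fp fm.
pose I n := `[- (n.+1%:R : R), n.+1%:R]%classic : set R.
have mI n : measurable (I n : set (measurableTypeR R)) by exact: measurable_itv.
have mf' := measurable_int _ if'.
have cf : continuous f.
  by move=> x; apply/differentiable_continuous/derivable1_diffP; have := df x; case.
have FTC n : (\int[leb]_(s in I n) (f' s)%:E = (f n.+1%:R - f (- n.+1%:R))%:E)%E.
  rewrite EFinB; apply: continuous_FTC2.
  - by rewrite (@lt_trans _ _ 0)// ?oppr_lt0 ltr0n.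
  - exact: continuous_subspaceT.
  - split=> [x _||]; first by have := df x; case.
    + exact/cvg_at_right_filter/cf.
    + exact/cvg_at_left_filter/cf.
  - by move=> x _; rewrite derive1E; have h := df x; rewrite derive_val.
have [||||_ _] := @dominated_convergence _ _ R leb setT measurableT
  (fun n => (EFin \o f') \_ (I n)) (EFin \o f') (fun s => `|(f' s)%:E|)%E _ mf'.
- move=> n; apply/(measurable_restrictT _ (mI n)).
  exact: measurable_funS mf'.
- apply: aeW => s _; apply: cvg_near_cst; near=> n.
  rewrite patchE mem_set// /I /= in_itv /= -ler_norml.
  rewrite (@le_trans _ _ n%:R)// ?ler_nat//.
  by near: n; exact: nbhs_infty_ger.
- exact: integrable_abse.
- apply: aeW => s n _; rewrite patchE; case: ifPn => // _.
  by rewrite abse0 abse_ge0.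
have E : (fun n => \int[leb]_s ((EFin \o f') \_ (I n)) s)%E =
    (fun n => (f n.+1%:R - f (- n.+1%:R))%:E).
  by apply/funext => n; rewrite -integral_mkcond FTC.
rewrite /= E => cvgI; apply: (cvg_unique _ cvgI) => //.
apply: cvg_EFin; first by near=> n.
rewrite -[X in _ --> X](subrr (0 : R)); apply: cvgB.
- by have := fp; rewrite -(cvg_shiftS (fun n => f n%:R)).
- by have := fm; rewrite -(cvg_shiftS (fun n => f (- n%:R))).
Unshelve. all: by end_near. Qed.

Lemma integrable_expR_half_sqr :
  leb.-integrable setT (fun s => (expR (- (s ^+ 2 / 2)))%:E).
Proof.
have h := integrable_normal_pdf (R := R) 0 1.
have := @integrableZl _ _ R leb setT measurableT (normal_peak 1)^-1 _ h.
apply: eq_integrable => // s _; rewrite -EFinM; congr EFin.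
rewrite normal_pdfE ?oner_eq0// mulKf ?gt_eqF ?normal_peak_gt0 ?oner_eq0//.
by rewrite /normal_fun subr0 expr1n mulNr.
Qed.

End IntegralDerivative.

Section GaussianIntegrability.
Context {R : realType}.
Local Notation leb := (@lebesgue_measure R).
Local Notation lebt := (@lebesgue_tuple R).

Lemma rV_measurable_dotpp d : rV_measurable (fun x : 'rV[R]_d => dotp x x).
Proof.
apply: measurable_sum => i; apply: measurable_funM; exact: (rV_measurable_coord i).
Qed.

Lemma rV_measurable_gauss d : rV_measurable (@gauss R d).
Proof.
apply: (measurableT_comp (@measurable_expR R)).
apply: measurable_funN; apply: measurable_funM => //; exact: rV_measurable_dotpp.
Qed.

Lemma dotp_cons d (s : R) (t : d.-tuple R) :
  dotp (rV_of_tuple [tuple of s :: t]) (rV_of_tuple [tuple of s :: t]) =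
  s ^+ 2 + dotp (rV_of_tuple t) (rV_of_tuple t).
Proof.
rewrite /dotp big_ord_recl !mxE tnth0 -expr2; congr (_ + _).
by apply: eq_bigr => i _; rewrite !mxE tnthS.
Qed.

Local Open Scope ereal_scope.

Lemma integral_gauss_lty d : integral_rV (fun x : 'rV[R]_d => (gauss x)%:E) < +oo.
Proof.
have mG d' : measurable_fun setT (fun t : d'.-tuple R => (gauss (rV_of_tuple t))%:E).
  by apply/measurable_EFinP; exact: rV_measurable_gauss.
rewrite /integral_rV; elim: d => [|d IH]; first by rewrite integral_tuple0 ltry.
rewrite ge0_integral_tuple_cons//; last by move=> t; rewrite lee_fin expR_ge0.
set I := \int[@lebt d]_t _ in IH.
have step (s : R) : \int[@lebt d]_t (gauss (rV_of_tuple [tuple of s :: t]))%:E =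
    I * (expR (- (s ^+ 2 / 2)))%:E.
  rewrite muleC /I -(ge0_integralZl _ measurableT (mG d))//.
  - apply: eq_integral => t _; rewrite -EFinM /gauss -expRD dotp_cons.
    by rewrite mulrDl opprD.
  - by move=> t _; rewrite lee_fin expR_ge0.
rewrite (_ : \int[leb]_s _ = \int[leb]_s (I * (expR (- (s ^+ 2 / 2)))%:E)); last first.
  by apply: eq_integral => s _; exact: step.
have I0 : 0 <= I by apply: integral_ge0 => t _; rewrite lee_fin expR_ge0.
have /integrableP[mg gf] := @integrable_expR_half_sqr R.
rewrite ge0_integralZl//.
rewrite lte_mul_pinfty ?ge0_fin_numE//.
apply: le_lt_trans gf; rewrite le_eqVlt; apply/orP; left; apply/eqP.
by apply: eq_integral => s _; rewrite gee0_abs// lee_fin expR_ge0.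
Qed.

End GaussianIntegrability.

Section RowVectorIntegrals.
Context {R : realType} {d : nat}.
Implicit Types (F : 'rV[R]_d -> R).
Local Notation lebt := (@lebesgue_tuple R d).

Definition rV_integrable F :=
  lebt.-integrable setT (EFin \o (F \o @rV_of_tuple R d)).

Definition rV_int F : R := fine (integral_rV (EFin \o F)).

Lemma integral_rVE F : rV_integrable F -> integral_rV (EFin \o F) = (rV_int F)%:E.
Proof. by move=> iF; rewrite /rV_int fineK// integrable_fin_num. Qed.

Lemma rV_intD F1 F2 : rV_integrable F1 -> rV_integrable F2 ->
  rV_int (fun x => F1 x + F2 x) = rV_int F1 + rV_int F2.
Proof. by move=> h1 h2; exact: (RintegralD measurableT h1 h2). Qed.

Lemma rV_intZ c F : rV_integrable F ->
  rV_int (fun x => c * F x) = c * rV_int F.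
Proof. by move=> h; exact: (RintegralZl c measurableT h). Qed.

Lemma rV_integrableD F1 F2 : rV_integrable F1 -> rV_integrable F2 ->
  rV_integrable (fun x => F1 x + F2 x).
Proof.
move=> h1 h2; have := integrableD measurableT h1 h2.
by apply: eq_integrable => // t _; rewrite /= EFinD.
Qed.

Lemma rV_integrableZ c F : rV_integrable F -> rV_integrable (fun x => c * F x).
Proof.
move=> h; have := integrableZl measurableT c h.
by apply: eq_integrable => // t _; rewrite /= EFinM.
Qed.

Lemma rV_integrable0 : rV_integrable (fun=> 0).
Proof. exact: integrable0. Qed.

Lemma rV_integrable_sum I (r : seq I) (F : I -> 'rV[R]_d -> R) :
  (forall i, rV_integrable (F i)) ->
  rV_integrable (fun x => \sum_(i <- r) F i x).
Proof.
move=> iF; elim: r => [|i r IH].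
  by under [fun x => _]eq_fun do rewrite big_nil; exact: rV_integrable0.
by under [fun x => _]eq_fun do rewrite big_cons; exact: rV_integrableD.
Qed.

Lemma rV_int_sum I (r : seq I) (F : I -> 'rV[R]_d -> R) :
  (forall i, rV_integrable (F i)) ->
  rV_int (fun x => \sum_(i <- r) F i x) = \sum_(i <- r) rV_int (F i).
Proof.
move=> iF; elim: r => [|i r IH].
  under [fun x => _]eq_fun do rewrite big_nil.
  by rewrite big_nil /rV_int /integral_rV /= integral0.
under [fun x => _]eq_fun do rewrite big_cons.
by rewrite rV_intD ?IH ?big_cons//; exact: rV_integrable_sum.
Qed.

Lemma rV_integrable_dominated F C : rV_measurable F ->
  (forall x, `|F x| <= C * gauss x) -> rV_integrable F.
Proof.
move=> mF FC.
have ig : rV_integrable gauss.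
  apply/integrableP; split; first by apply/measurable_EFinP; exact: rV_measurable_gauss.
  apply: le_lt_trans (integral_gauss_lty (R := R) d).
  rewrite le_eqVlt; apply/orP; left; apply/eqP.
  by apply: eq_integral => t _; rewrite gee0_abs// lee_fin expR_ge0.
apply: le_integrable (rV_integrableZ C ig) => //.
- by apply/measurable_EFinP.
- move=> t _; rewrite /= lee_fin (le_trans (FC _))//.
  exact: ler_norm.
Qed.

Lemma rV_int_reflect b F : b != 0 -> rV_measurable F ->
  rV_int (fun x => F (reflect_in b x)) = rV_int F.
Proof.
move=> b0 mF; rewrite /rV_int; congr fine; rewrite /integral_rV.
have mFE : measurable_fun setT ((EFin \o F) \o @rV_of_tuple R d).
  exact/measurable_EFinP.
rewrite integralE [RHS]integralE; congr (_ - _)%E.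
- have := @ge0_integral_reflect_in R d b (fun x => (EFin \o F)^\+ x)%E b0.
  have mp : measurable_fun setT ((EFin \o F)^\+ \o @rV_of_tuple R d)%E.
    by rewrite -funepos_comp; exact: measurable_funepos.
  rewrite /integral_rV => /(_ mp) h.
  apply: etrans (etrans (h (fun x => funepos_ge0 _ x)) _).
    by apply: eq_integral => t _; rewrite !funeposE.
  by apply: eq_integral => t _; rewrite !funeposE.
- have := @ge0_integral_reflect_in R d b (fun x => (EFin \o F)^\- x)%E b0.
  have mp : measurable_fun setT ((EFin \o F)^\- \o @rV_of_tuple R d)%E.
    by rewrite -funeneg_comp; exact: measurable_funeneg.
  rewrite /integral_rV => /(_ mp) h.
  apply: etrans (etrans (h (fun x => funeneg_ge0 _ x)) _).
    by apply: eq_integral => t _; rewrite !funenegE.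
  by apply: eq_integral => t _; rewrite !funenegE.
Qed.

End RowVectorIntegrals.

(** * Functions of subgaussian growth and integration by parts *)

Section Tame.
Context {R : realType} {d : nat}.
Implicit Types (f g : 'rV[R]_d -> R) (x y v b : 'rV[R]_d).

(** Asking for every e > 0 makes the condition stable under products. *)
Definition subgaussian f := forall e : R, 0 < e ->
  exists C, forall x, `|f x| <= C * expR (e * dotp x x).

Definition line_continuous f :=
  forall v y, continuous (fun s : R => f (s *: v + y)).

(** The class to which integration by parts along coordinate lines applies.
    Continuity along lines suffices for the fundamental theorem of calculus. *)
Definition tame f :=
  [/\ rV_measurable f, line_continuous f & subgaussian f].

Lemma expR_dotp_ge1 (e : R) x : 0 <= e -> 1 <= expR (e * dotp x x).
Proof. by move=> e0; rewrite leNgt expR_lt1 -leNgt mulr_ge0// dotpp_ge0. Qed.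

Lemma bounded_subgaussian f C : (forall x, `|f x| <= C) -> subgaussian f.
Proof.
move=> fC e e0; exists C => x; rewrite (le_trans (fC x))// ler_peMr//.
  by rewrite (le_trans _ (fC x)).
exact/expR_dotp_ge1/ltW.
Qed.

Lemma tame_cst c : tame (fun=> c).
Proof.
split; first exact: measurable_cst.
- by move=> v y; exact: cst_continuous.
- by apply: (@bounded_subgaussian _ `|c|).
Qed.

Lemma subgaussian_ge0 f e : 0 < e -> subgaussian f ->
  exists C, 0 <= C /\ forall x, `|f x| <= C * expR (e * dotp x x).
Proof.
move=> e0 /(_ e e0)[C fC]; exists C; split=> //.
have := fC 0; rewrite -(ler_pdivrMr _ _ (expR_gt0 _)); apply: le_trans.
by rewrite divr_ge0// expR_ge0.
Qed.

Lemma tameD f g : tame f -> tame g -> tame (fun x => f x + g x).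
Proof.
move=> [mf cf sf] [mg cg sg]; split; first exact: measurable_funD.
- by move=> v y s; apply: cvgD; [exact: cf|exact: cg].
- move=> e e0; have [C fC] := sf e e0; have [C' gC] := sg e e0.
  by exists (C + C') => x; rewrite (le_trans (ler_normD _ _))// mulrDl lerD.
Qed.

Lemma tameM f g : tame f -> tame g -> tame (fun x => f x * g x).
Proof.
move=> [mf cf sf] [mg cg sg]; split; first exact: measurable_funM.
- by move=> v y s; apply: cvgM; [exact: cf|exact: cg].
- move=> e e0; have e20 : 0 < e / 2 by rewrite divr_gt0.
  have [C [C0 fC]] := subgaussian_ge0 e20 sf.
  have [C' [C'0 gC]] := subgaussian_ge0 e20 sg.
  exists (C * C') => x; rewrite normrM.
  rewrite (_ : e * dotp x x = e / 2 * dotp x x + e / 2 * dotp x x); last by field.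
  by rewrite expRD mulrACA ler_pM.
Qed.

Lemma tameZ c f : tame f -> tame (fun x => c * f x).
Proof. by move=> tf; apply: tameM => //; exact: tame_cst. Qed.

Lemma tame_sum I (r : seq I) (F : I -> 'rV[R]_d -> R) :
  (forall i, tame (F i)) -> tame (fun x => \sum_(i <- r) F i x).
Proof.
move=> tF; elim: r => [|i r IH].
  by under [fun x => _]eq_fun do rewrite big_nil; exact: tame_cst.
by under [fun x => _]eq_fun do rewrite big_cons; exact: tameD.
Qed.

Lemma tame_prod (I : eqType) (r : seq I) (F : I -> 'rV[R]_d -> R) :
  (forall i, i \in r -> tame (F i)) -> tame (fun x => \prod_(i <- r) F i x).
Proof.
elim: r => [|i r IH] tF.
  by under [fun x => _]eq_fun do rewrite big_nil; exact: tame_cst.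
under [fun x => _]eq_fun do rewrite big_cons.
apply: tameM; first by apply: tF; rewrite mem_head.
by apply: IH => l lr; apply: tF; rewrite in_cons lr orbT.
Qed.

Lemma tame_norm f : tame f -> tame (fun x => `|f x|).
Proof.
move=> [mf cf sf]; split.
- exact: (measurableT_comp (@normr_measurable R setT) mf).
- by move=> v y s; apply: cvg_norm; exact: cf.
- by move=> e /sf[C fC]; exists C => x; rewrite normr_id.
Qed.

Lemma tameX f n : tame f -> tame (fun x => f x ^+ n).
Proof.
move=> tf; elim: n => [|n IH]; first exact: tame_cst.
by under [fun x => _]eq_fun do rewrite exprS; exact: tameM.
Qed.

Lemma dotp_line_continuous b : line_continuous (dotp b).
Proof.
move=> v y; rewrite (_ : (fun s => _) = (fun s => s * dotp b v + dotp b y)); last first.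
  by apply/funext => s; rewrite dotpDr dotpZr.
by move=> s; apply: cvgD; [apply: cvgM => //; exact: cvg_cst|exact: cvg_cst].
Qed.

Lemma tame_coord i : tame (fun x => x 0 i).
Proof.
split; first exact: rV_measurable_coord.
  rewrite (_ : (fun x => _) = dotp (delta_mx 0 i)); first exact: dotp_line_continuous.
  by apply/funext => x; rewrite dotpC dotp_delta.
move=> e e0; exists (1 + e^-1) => x.
have xi : x 0 i ^+ 2 <= dotp x x.
  rewrite /dotp (bigD1 i)//= -expr2 lerDl; apply: sumr_ge0 => l _.
  by rewrite -expr2 sqr_ge0.
apply: (@le_trans _ _ ((1 + e^-1) * (1 + e * dotp x x))); last first.
  by rewrite ler_wpM2l ?expR_ge1Dx// addr_ge0// invr_ge0 ltW.
rewrite mulrDr mulr1 mulrDl mul1r mulKf ?gt_eqF//.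
apply: (@le_trans _ _ (1 + x 0 i ^+ 2)); last first.
  have ei0 : 0 <= e^-1 by rewrite invr_ge0 ltW.
  have exx : 0 <= e * dotp x x by rewrite mulr_ge0 ?dotpp_ge0// ltW.
  by lra.
have := sqr_ge0 (`|x 0 i| - 1); rewrite -(real_normK (num_real (x 0 i))).
by move: (normr_ge0 (x 0 i)); nra.
Qed.

Lemma tame_dotp b : tame (dotp b).
Proof. by apply: tame_sum => i; apply: tameM; [exact: tame_cst|exact: tame_coord]. Qed.

Lemma tame_mpoly_fun (p : mpoly d R) : tame (mpoly_fun p).
Proof.
elim/(@mpoly_ind_linform R d) : p => [c|p q hp hq|w p hp].
- rewrite (_ : mpoly_fun _ = fun=> c); first exact: tame_cst.
  by apply/funext => x; rewrite mpoly_funC.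
- rewrite (_ : mpoly_fun _ = fun x => mpoly_fun p x + mpoly_fun q x).
    exact: tameD.
  by apply/funext => x; rewrite mpoly_funD.
- rewrite (_ : mpoly_fun _ = fun x => dotp w x * mpoly_fun p x).
    by apply: tameM => //; exact: tame_dotp.
  by apply/funext => x; rewrite mpoly_funM mpoly_fun_linform.
Qed.

Lemma tame_dotpp : tame (fun x => dotp x x).
Proof. by apply: tame_sum => i; apply: tameM; exact: tame_coord. Qed.

Lemma line_continuous_comp f (h : R -> R) :
  line_continuous f -> (forall x, {for f x, continuous h}) ->
  line_continuous (h \o f).
Proof.
move=> cf ch v y s.
exact: (@continuous_cvg R R R (nbhs s) _ (fun s => f (s *: v + y)) h _
  (ch _) (cf v y s)).
Qed.

Lemma tame_gauss : tame gauss.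
Proof.
split; first exact: rV_measurable_gauss.
- apply: (@line_continuous_comp (fun x => - (dotp x x / 2)) expR).
    rewrite (_ : (fun x => _) = (fun x => - 2^-1 * dotp x x)).
      by have [] := tameZ (- 2^-1) tame_dotpp.
    by apply/funext => x; rewrite mulNr mulrC.
  by move=> x; exact: continuous_expR.
- apply: (@bounded_subgaussian _ 1) => x.
  by rewrite ger0_norm ?expR_ge0// expR_le1 oppr_le0 divr_ge0 ?dotpp_ge0.
Qed.

Lemma gauss_sqr x : gauss x ^+ 2 = expR (- dotp x x).
Proof. by rewrite expr2 -expRD; congr expR; field. Qed.

Lemma expR_gauss_sqr x : expR (2^-1 * dotp x x) * gauss x ^+ 2 = gauss x.
Proof. by rewrite gauss_sqr -expRD /gauss; congr expR; field. Qed.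

Lemma tame_gauss_integrable f : tame f ->
  rV_integrable (fun x => f x * gauss x ^+ 2).
Proof.
move=> tf; have [mf _ sf] := tf.
have [C fC] := sf 2^-1 ltac:(by []).
apply: (@rV_integrable_dominated _ _ _ C).
  by have [] := tameM tf (tameX 2 tame_gauss).
move=> x; rewrite normrM (ger0_norm (sqr_ge0 _)).
by rewrite -[X in C * X]expR_gauss_sqr [leRHS]mulrA ler_wpM2r// sqr_ge0.
Qed.

End Tame.

Section IntegrationByParts.
Context {R : realType}.
Local Notation leb := (@lebesgue_measure R).
Local Notation lebt := (@lebesgue_tuple R).

Lemma gauss_line d (j : 'I_d.+1) (s : R) (t : d.-tuple R) :
  gauss (s *: delta_mx 0 j + hyperplane_point j t) <= expR (- (s ^+ 2 / 2)).
Proof.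
rewrite /gauss ler_expR lerN2 ler_pM2r ?invr_gt0//.
set x := _ + _; have -> : s = x 0 j.
  by rewrite !mxE !eqxx mulr1 tnth_insert addr0.
rewrite /dotp (bigD1 j)//= -expr2 lerDl; apply: sumr_ge0 => l _.
by rewrite -expr2 sqr_ge0.
Qed.

Lemma cvg_expR_half_sqr : expR (- ((n%:R : R) ^+ 2 / 2)) @[n --> \oo] --> (0 : R).
Proof.
have z : `|expR (- 2^-1) : R| < 1.
  by rewrite ger0_norm ?expR_ge0// expR_lt1 oppr_lt0 invr_gt0.
apply: squeeze_cvgr (cvg_cst 0) (cvg_expr z).
near=> n; rewrite expR_ge0/= -expRM_natl ler_expR mulrN lerN2 ler_pM2r ?invr_gt0//.
by rewrite -natrX ler_nat; case: (n) => // m; rewrite leq_pmulr.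
Unshelve. all: by end_near. Qed.

(** On each line parallel to e_j the integral of the derivative is 0. Fubini's
    theorem then follows from Tonelli's for the positive and negative parts,
    which have the same integral on every line. *)
Lemma rV_int_derivative0 d (j : 'I_d) (P Q : 'rV[R]_d -> R) :
  tame P -> tame Q ->
  (forall x, is_derive x (delta_mx 0 j) (fun y => P y * gauss y ^+ 2)
     (Q x * gauss x ^+ 2)) ->
  rV_int (fun x => Q x * gauss x ^+ 2) = 0.
Proof.
case: d => [|d] in j P Q *; first by case: j.
move=> tP tQ dP; set F := fun x => Q x * gauss x ^+ 2.
have tF : tame F by exact: tameM tQ (tameX 2 tame_gauss).
have iF : rV_integrable F := tame_gauss_integrable tQ.
have bound f : tame f -> exists C, forall (s : R) (t : d.-tuple R),
    `|f (s *: delta_mx 0 j + hyperplane_point j t) *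
      gauss (s *: delta_mx 0 j + hyperplane_point j t) ^+ 2| <=
    C * expR (- (s ^+ 2 / 2)).
  move=> [_ _ sf]; have [C [C0 fC]] := subgaussian_ge0 (e := 2^-1) ltac:(by []) sf.
  exists C => s t; set x := _ + _; rewrite normrM (ger0_norm (sqr_ge0 _)).
  apply: (@le_trans _ _ (C * gauss x)); last by rewrite ler_wpM2l// gauss_line.
  by rewrite -[X in C * X]expR_gauss_sqr [leRHS]mulrA ler_wpM2r// sqr_ge0.
have [CP CPb] := bound P tP; have [CQ CQb] := bound Q tQ.
pose l (t : d.-tuple R) (s : R) := s *: delta_mx 0 j + hyperplane_point j t.
have mFl t : measurable_fun setT (F \o l t).
  have [mF _ _] := tF.
  exact: (measurableT_comp (measurable_line_point j (delta_mx 0 j) mF)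
    (measurable_pair2 t)).
have iFl t : leb.-integrable setT (EFin \o (F \o l t)).
  have := integrableZl measurableT CQ (integrable_expR_half_sqr (R := R)).
  apply: le_integrable => //; first by apply/measurable_EFinP; exact: mFl.
  by move=> s _; rewrite -EFinM /= lee_fin (le_trans (CQb s t))// ler_norm.
have lim0 t (sg : R) : sg ^+ 2 = 1 ->
    P (l t (sg * n%:R)) * gauss (l t (sg * n%:R)) ^+ 2 @[n --> \oo] --> 0.
  move=> sg1; apply/norm_cvg0P.
  have h : CP * expR (- ((n%:R : R) ^+ 2 / 2)) @[n --> \oo] --> (0 : R).
    by rewrite -[X in _ --> X](mulr0 CP); apply: cvgM; [exact: cvg_cst|exact: cvg_expR_half_sqr].
  apply: squeeze_cvgr (cvg_cst 0) h; near=> n; rewrite normr_ge0 /=.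
  by rewrite (le_trans (CPb _ _))// exprMn sg1 mul1r.
have int0 t : (\int[leb]_s (F (l t s))%:E = 0)%E.
  apply: (@integral_derivative0 _ (fun s => P (l t s) * gauss (l t s) ^+ 2)).
  - move=> s; apply/(is_derive_along_line (fun y => P y * gauss y ^+ 2)); exact: dP.
  - by have [_ cF _] := tF; exact: cF.
  - exact: iFl.
  - have := lim0 t 1 (expr1n _ _); rewrite (_ : (fun n : nat => _) =
      fun n : nat => P (l t n%:R) * gauss (l t n%:R) ^+ 2)//.
    by apply/funext => n; rewrite mul1r.
  - have := lim0 t (-1) ltac:(by rewrite sqrrN expr1n); rewrite (_ : (fun n : nat => _) =
      fun n : nat => P (l t (- n%:R)) * gauss (l t (- n%:R)) ^+ 2)//.
    by apply/funext => n; rewrite mulN1r.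
have [mF _ _] := tF.
have mFE : measurable_fun setT ((EFin \o F) \o @rV_of_tuple R d.+1).
  exact/measurable_EFinP.
have e1 : (delta_mx 0 j : 'rV[R]_d.+1) 0 j = 1 by rewrite mxE !eqxx.
have fin_sube0 (a b : \bar R) : a \is a fin_num -> b \is a fin_num ->
    (a - b = 0 -> a = b)%E.
  move: a b => [a| |] [b| |] // _ _ [] /eqP; rewrite subr_eq0 => /eqP -> //.
have posneg : (integral_rV (EFin \o F)^\+ = integral_rV (EFin \o F)^\-)%E.
  rewrite (ge0_integral_lines e1); last 2 first.
  - by rewrite /rV_measurable -funepos_comp; exact: measurable_funepos.
  - by move=> x; exact: funepos_ge0.
  rewrite (ge0_integral_lines e1); last 2 first.
  - by rewrite /rV_measurable -funeneg_comp; exact: measurable_funeneg.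
  - by move=> x; exact: funeneg_ge0.
  apply: eq_integral => t _; have := int0 t; rewrite integralE.
  have fp := integrable_pos_fin_num measurableT (iFl t).
  have fn := integrable_neg_fin_num measurableT (iFl t).
  move=> /(fin_sube0 _ _ fp fn) h; apply: etrans (etrans h _).
    by apply: eq_integral => s _; rewrite !funeposE.
  by apply: eq_integral => s _; rewrite !funenegE.
rewrite /rV_int /integral_rV integralE.
have E1 : (\int[@lebt d.+1]_t (fun t => (EFin \o F) (rV_of_tuple t))^\+ t =
    integral_rV (EFin \o F)^\+)%E.
  by apply: eq_integral => t _; rewrite !funeposE.
have E2 : (\int[@lebt d.+1]_t (fun t => (EFin \o F) (rV_of_tuple t))^\- t =
    integral_rV (EFin \o F)^\-)%E.
  by apply: eq_integral => t _; rewrite !funenegE.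
have fp := integrable_pos_fin_num measurableT iF.
move: fp; rewrite [X in X \is a fin_num -> _]E1 => fp.
by rewrite E1 E2 -posneg subee.
Unshelve. all: by end_near. Qed.

End IntegrationByParts.

(** * Integration by parts for the Dunkl weight *)

Section RegularizedWeight.
Context {R : realType} {d : nat}.
Variables (Rp : {fset 'rV[R]_d}) (k : 'rV[R]_d -> R).
Implicit Types (x y v b : 'rV[R]_d) (e : R).
Hypothesis Rp0 : forall b, b \in Rp -> b != 0.
Hypothesis k_ge0 : forall b, b \in Rp -> 0 <= k b.
Hypothesis Rp_inv : reflection_invariant Rp k.

Let sq b e x := dotp b x ^+ 2 + e.

Let sq_ge b e x : e <= sq b e x. Proof. by rewrite lerDr sqr_ge0. Qed.

Let sq_gt0 b e x : 0 < e -> 0 < sq b e x.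
Proof. by move=> e0; rewrite (lt_le_trans e0). Qed.

Let tame_sq b e : tame (sq b e).
Proof. by apply: tameD; [apply: tameX; exact: tame_dotp|exact: tame_cst]. Qed.

(** The smooth weight prod_b (<b, x>^2 + e)^k(b). *)
Definition reg_weight e x := expR (\sum_(b <- Rp) k b * ln (sq b e x)).

Lemma reg_weightE e x :
  reg_weight e x = \prod_(b <- Rp) expR (k b * ln (sq b e x)).
Proof. exact: expR_sum. Qed.

Lemma reg_weight_gt0 e x : 0 < reg_weight e x. Proof. exact: expR_gt0. Qed.

Let tame_expR_ln c b e : 0 < e ->
  subgaussian (fun x => expR (c * ln (sq b e x))) ->
  tame (fun x => expR (c * ln (sq b e x))).
Proof.
move=> e0 sg; have [mu cu _] := tame_sq b e; split=> //.
  apply: (measurableT_comp (@measurable_expR R)); apply: measurable_funM => //.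
  exact: (measurableT_comp (@measurable_ln R) mu).
apply: (@line_continuous_comp _ _ (sq b e) (fun u => expR (c * ln u)) cu) => x.
have h : {for sq b e x, continuous (fun u : R => c * ln u)}.
  by apply: cvgM; [exact: cvg_cst|exact/continuous_ln/sq_gt0].
exact: (continuous_comp h (@continuous_expR R _)).
Qed.

(** For N >= k(b), the factor u^k(b) is at most 1 + u^N. *)
Lemma tame_reg_weight e : 0 < e -> tame (reg_weight e).
Proof.
move=> e0; rewrite (_ : reg_weight e = fun x =>
  \prod_(b <- Rp) expR (k b * ln (sq b e x))); last first.
  by apply/funext => x; exact: reg_weightE.
apply: tame_prod => b bRp; apply: tame_expR_ln => // eta eta0.
pose N := Num.bound (k b).
have kN : k b <= N%:R by rewrite ltW// archi_boundP// k_ge0.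
have [_ _ sg] := tameD (tame_cst 1) (tameX N (tame_sq b e)).
have [C hC] := sg _ eta0; exists C => x; apply: le_trans (hC x).
have u0 := sq_gt0 b x e0.
rewrite !ger0_norm ?expR_ge0//; last by rewrite addr_ge0// exprn_ge0// ltW.
have [u1|u1] := leP (sq b e x) 1.
  rewrite (@le_trans _ _ 1)//; last by rewrite lerDl exprn_ge0// ltW.
  by rewrite expR_le1 mulr_ge0_le0 ?k_ge0// ln_le0.
rewrite (@le_trans _ _ (sq b e x ^+ N))//; last by rewrite lerDr.
rewrite -[X in _ <= X ^+ N]lnK ?posrE// -expRM_natl ler_expR ler_wpM2r//.
by rewrite ln_ge0// ltW.
Qed.

Lemma tame_inv_sq b e : 0 < e -> tame (fun x => (sq b e x)^-1).
Proof.
move=> e0; rewrite (_ : (fun x => _) = fun x => expR (-1 * ln (sq b e x))); last first.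
  by apply/funext => x; rewrite mulN1r expRN lnK// posrE sq_gt0.
apply: tame_expR_ln => //; apply: (@bounded_subgaussian _ _ _ e^-1) => x.
rewrite ger0_norm ?expR_ge0// mulN1r expRN lnK ?posrE ?sq_gt0//.
by rewrite lef_pV2 ?posrE ?sq_gt0.
Qed.

Lemma reg_weight_reflect a e x : a \in Rp ->
  reg_weight e (reflect_in a x) = reg_weight e x.
Proof.
move=> aRp; congr expR.
rewrite -[RHS](Rp_inv (V := R^o) (G := fun b => ln (sq b e x)) aRp); last first.
  by move=> b; rewrite /sq -scaleN1r dotpZl mulN1r sqrrN.
by apply: eq_bigr => b _; rewrite /sq dotp_reflectl.
Qed.

Lemma is_derive_bigsum I (r : seq I) (F : I -> 'rV[R]_d -> R) (dF : I -> R) x v :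
  (forall i, is_derive x v (F i) (dF i)) ->
  is_derive x v (fun y => \sum_(i <- r) F i y) (\sum_(i <- r) dF i).
Proof.
move=> h; elim: r => [|i r IH].
  by under [fun y => _]eq_fun do rewrite big_nil; rewrite big_nil; exact: is_derive_cst.
rewrite big_cons (_ : (fun y => _) = F i + (fun y => \sum_(i <- r) F i y)).
  exact: is_deriveD.
by apply/funext => y; rewrite big_cons.
Qed.

Lemma is_derive_reg_weight e x v : 0 < e ->
  is_derive x v (reg_weight e)
    (reg_weight e x * \sum_(b <- Rp) k b * (2 * dotp b x * dotp b v / sq b e x)).
Proof.
move=> e0; apply: (is_derive_comp_dir (F := fun y => \sum_(b <- Rp) k b * ln (sq b e y))
  _ (is_derive_expR _)).
apply: is_derive_bigsum => b.
have h1 : is_derive x v (sq b e) (2 * dotp b x * dotp b v).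
  have hb := is_derive_dotp b x v.
  have -> : sq b e = dotp b ^+ 2 + cst e by apply/funext => y.
  by apply: is_derive_eq; rewrite addr0 /GRing.scale /= expr1 mulr2n mulrDl mul1r.
have h2 := is_derive_comp_dir h1 (is_derive1_ln (sq_gt0 b x e0)).
have -> : (fun y => k b * ln (sq b e y)) = k b *: (@ln R \o sq b e) by [].
by apply: is_derive_eq; rewrite /GRing.scale /=; ring.
Qed.

Lemma reg_weight_le e x : 0 < e -> e <= 1 -> reg_weight e x <= reg_weight 1 x.
Proof.
move=> e0 e1; rewrite ler_expR big_seq [leRHS]big_seq; apply: ler_sum => b bRp.
by rewrite ler_wpM2l ?k_ge0// ler_ln ?posrE ?sq_gt0// lerD2l.
Qed.

Let e_ n : R := n.+1%:R^-1.
Let e_gt0 n : 0 < e_ n. Proof. by rewrite invr_gt0. Qed.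
Let e_le1 n : e_ n <= 1. Proof. by rewrite invf_le1// ler1n. Qed.

Let cvg_sq b x : sq b n.+1%:R^-1 x @[n --> \oo] --> dotp b x ^+ 2.
Proof.
rewrite -[X in _ --> X]addr0; apply: cvgD; first exact: cvg_cst.
exact: cvg_harmonic.
Qed.

Lemma cvg_reg_weight x :
  reg_weight n.+1%:R^-1 x @[n --> \oo] --> weight Rp k x.
Proof.
rewrite (_ : (fun n => _) = fun n : nat =>
    \prod_(b <- Rp) expR (k b * ln (sq b n.+1%:R^-1 x))); last first.
  by apply/funext => n; exact: reg_weightE.
rewrite /weight.
suff : forall r : seq 'rV[R]_d, (forall b, b \in r -> 0 <= k b) ->
    \prod_(b <- r) expR (k b * ln (sq b n.+1%:R^-1 x)) @[n --> \oo] -->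
    \prod_(b <- r) (`|dotp b x| `^ (2 * k b)) by apply; exact: k_ge0.
elim=> [|b r IH] kr.
  by under eq_fun do rewrite big_nil; rewrite big_nil; exact: cvg_cst.
under eq_fun do rewrite big_cons; rewrite big_cons; apply: cvgM; last first.
  by apply: IH => c cr; apply: kr; rewrite in_cons cr orbT.
have kb : 0 <= k b by apply: kr; rewrite mem_head.
have [bx|bx] := eqVneq (dotp b x) 0; last first.
  have -> : `|dotp b x| `^ (2 * k b) = expR (k b * ln (dotp b x ^+ 2)).
    rewrite /powR normr_eq0 (negbTE bx) -(real_normK (num_real _)) lnXn ?normr_gt0//.
    by congr expR; rewrite mulr2n; ring.
  have h := @cvg_sq b x.
  have sx : 0 < dotp b x ^+ 2 by rewrite exprn_even_gt0.
  apply: continuous_cvg; first exact: continuous_expR.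
  apply: cvgM; first exact: cvg_cst.
  by apply: continuous_cvg => //; exact: continuous_ln.
rewrite /sq bx normr0 expr0n /=; have [k0|k0] := eqVneq (k b) 0.
  by rewrite k0 mulr0 powRr0; under eq_fun do rewrite mul0r expR0; exact: cvg_cst.
rewrite powR0; last by rewrite mulf_neq0.
have kb0 : 0 < k b by rewrite lt_neqAle eq_sym k0.
apply/cvgrPdist_lt => eps eps0; near=> n.
rewrite sub0r normrN ger0_norm ?expR_ge0// add0r -[ltRHS]lnK ?posrE// ltr_expR.
rewrite mulrC -ltr_pdivlMr// -[ltRHS]expRK ltr_ln ?posrE ?expR_gt0//.
by near: n; exact: (near_infty_natSinv_lt (PosNum (expR_gt0 _))).
Unshelve. all: by end_near. Qed.

Lemma weight_ge0 x : 0 <= weight Rp k x.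
Proof. by apply: prodr_ge0 => b _; exact: powR_ge0. Qed.

(** Measurability, invariance and domination pass to the limit from the smooth
    weights. *)
Lemma rV_measurable_weight : rV_measurable (weight Rp k).
Proof.
apply: (@measurable_fun_cvg _ _ _ _ (fun n t => reg_weight n.+1%:R^-1 (rV_of_tuple t))).
  by move=> n; have [] := tame_reg_weight (e_gt0 n).
by move=> t _; exact: cvg_reg_weight.
Qed.

Lemma weight_reflect a x : a \in Rp ->
  weight Rp k (reflect_in a x) = weight Rp k x.
Proof.
move=> aRp; have h := @cvg_reg_weight (reflect_in a x).
have E : (fun n : nat => reg_weight n.+1%:R^-1 (reflect_in a x)) =
    (fun n : nat => reg_weight n.+1%:R^-1 x).
  by apply/funext => n; exact: reg_weight_reflect.
by rewrite E in h; apply: (cvg_unique _ h) => //; exact: cvg_reg_weight.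
Qed.

Lemma weight_le x : weight Rp k x <= reg_weight 1 x.
Proof.
have h := @cvg_reg_weight x.
rewrite -(cvg_lim (@Rhausdorff R) h); apply: limr_le; first by apply/cvg_ex; exists (weight Rp k x).
by near=> n; exact: (reg_weight_le _ (e_gt0 n) (e_le1 n)).
Unshelve. all: by end_near. Qed.

Lemma weight_integrable f : tame f ->
  rV_integrable (fun x => f x * weight Rp k x * gauss x ^+ 2).
Proof.
move=> tf; have tfW := tame_norm (tameM tf (tame_reg_weight (ltr01 : (0 : R) < 1))).
have iG := tame_gauss_integrable tfW.
apply: le_integrable iG => //.
  apply/measurable_EFinP; have [mf _ _] := tf; have [mg _ _] := tameX 2 (@tame_gauss R d).
  apply: measurable_funM => //; apply: measurable_funM => //.
  exact: rV_measurable_weight.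
move=> t _; rewrite /= lee_fin; set x := rV_of_tuple t.
rewrite !normrM normr_id ler_wpM2r// ?normr_ge0// ler_wpM2l//.
by rewrite !ger0_norm ?weight_ge0 ?weight_le// ltW// reg_weight_gt0.
Qed.

Lemma rV_int_cvg (f_ : nat -> 'rV[R]_d -> R) F G :
  (forall n, rV_measurable (f_ n)) ->
  (forall x, f_ n x @[n --> \oo] --> F x) -> rV_integrable G ->
  (forall n x, `|f_ n x| <= G x) ->
  rV_int (f_ n) @[n --> \oo] --> rV_int F.
Proof.
move=> mf fF iG fG.
have mF : rV_measurable F.
  apply: (@measurable_fun_cvg _ _ _ _ (fun n t => f_ n (rV_of_tuple t))).
    exact: mf.
  by move=> t _; exact: fF.
have mE n : measurable_fun setT (EFin \o (f_ n \o @rV_of_tuple R d)).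
  by apply/measurable_EFinP; exact: mf.
have mFE : measurable_fun setT (EFin \o (F \o @rV_of_tuple R d)).
  by apply/measurable_EFinP; exact: mF.
have fFE t : (f_ n (rV_of_tuple t))%:E @[n --> \oo] --> (F (rV_of_tuple t))%:E.
  by apply: cvg_EFin; [near=> n|exact: fF].
have fGE n t : (`|(f_ n (rV_of_tuple t))%:E| <= (G (rV_of_tuple t))%:E)%E.
  by rewrite /= lee_fin.
have [iF _ h] := dominated_convergence measurableT mE mFE
  (aeW _ (fun t _ => fFE t)) iG (aeW _ (fun t n _ => fGE n t)).
apply: (fine_cvg (f := fun n => integral_rV (EFin \o f_ n))).
by rewrite -/(rV_int F) fineK//; exact: integrable_fin_num.
Unshelve. all: by end_near. Qed.

Definition gauss_functional (p : mpoly d R) : R :=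
  rV_int (fun x => mpoly_fun p x * weight Rp k x * gauss x ^+ 2).

Local Notation L := gauss_functional.

Lemma gauss_functionalD p q : L (p + q) = L p + L q.
Proof.
rewrite -rV_intD; try exact/weight_integrable/tame_mpoly_fun.
by congr rV_int; apply/funext => x; rewrite mpoly_funD !mulrDl.
Qed.

Lemma gauss_functionalZ c p : L (c *: p) = c * L p.
Proof.
rewrite -rV_intZ; last exact/weight_integrable/tame_mpoly_fun.
by congr rV_int; apply/funext => x; rewrite mpoly_funZ !mulrA.
Qed.

Lemma gauss_functional_reflect b p : b \in Rp -> L (mpoly_reflect b p) = L p.
Proof.
move=> bRp; have [mp _ _] := tame_mpoly_fun p.
have [mg _ _] := tameX 2 (@tame_gauss R d).
have mF : rV_measurable (fun x => mpoly_fun p x * weight Rp k x * gauss x ^+ 2).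
  apply: measurable_funM mg; apply: measurable_funM mp _.
  exact: rV_measurable_weight.
rewrite /gauss_functional -[RHS](rV_int_reflect (Rp0 bRp) mF).
congr rV_int; apply/funext => x.
by rewrite mpoly_fun_reflect weight_reflect// gauss_reflect.
Qed.

(** With theta_b = <b, x> / (<b, x>^2 + e), the logarithmic derivative of the
    smooth weight is the sum of the 2 k(b) <b, v> theta_b. *)
Section Limit.
Variables (j : 'I_d) (p : mpoly d R).
Let A := mpoly_deriv (delta_mx 0 j) p - 2 *: (linform (delta_mx 0 j) * p).
Let q b := reflect_quotient b p.
Let theta b e x := dotp b x * (sq b e x)^-1.

Let tame_theta b e : 0 < e -> tame (theta b e).
Proof. by move=> e0; apply: tameM; [exact: tame_dotp|exact: tame_inv_sq]. Qed.

(** Averaging with the image under sigma_b, for which theta is odd, turns p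
    into the difference p - sigma_b p = <b, x> q_b. The factor <b, x> theta_b
    so obtained lies between 0 and 1, whereas theta_b alone blows up as e
    tends to 0. *)
Let theta_int b e : 0 < e -> b \in Rp ->
  rV_int (fun x => 2 * (mpoly_fun p x * theta b e x * reg_weight e x * gauss x ^+ 2)) =
  rV_int (fun x => mpoly_fun (q b) x * (dotp b x * theta b e x) * reg_weight e x * gauss x ^+ 2).
Proof.
move=> e0 bRp; pose F x := mpoly_fun p x * theta b e x * reg_weight e x * gauss x ^+ 2.
have tF : tame (fun x => mpoly_fun p x * theta b e x * reg_weight e x).
  apply: tameM; last exact: tame_reg_weight.
  by apply: tameM; [exact: tame_mpoly_fun|exact: tame_theta].
have iF : rV_integrable F := tame_gauss_integrable tF.
have Fr x : F (reflect_in b x) =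
    - (mpoly_fun (mpoly_reflect b p) x * theta b e x * reg_weight e x *
       gauss x ^+ 2).
  rewrite /F mpoly_fun_reflect reg_weight_reflect// gauss_reflect /theta /sq.
  rewrite -dotp_reflectl reflect_in_self ?Rp0// -scaleN1r dotpZl mulN1r sqrrN.
  by rewrite mulNr !(mulrN, mulNr).
have iFr : rV_integrable (fun x => F (reflect_in b x)).
  have tr : tame (fun x => mpoly_fun (mpoly_reflect b p) x * theta b e x * reg_weight e x).
    apply: tameM; last exact: tame_reg_weight.
    by apply: tameM; [exact: tame_mpoly_fun|exact: tame_theta].
  have := rV_integrableZ (-1) (tame_gauss_integrable tr).
  by congr rV_integrable; apply/funext => x; rewrite Fr mulN1r.
have [mF _ _] := tameM tF (tameX 2 (@tame_gauss R d)).
transitivity (rV_int F + rV_int (fun x => F (reflect_in b x))).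
  by rewrite (rV_int_reflect (Rp0 bRp) mF) rV_intZ// mulr2n mulrDl mul1r.
rewrite -rV_intD//; congr rV_int; apply/funext => x; rewrite Fr.
have := congr1 (fun r => mpoly_fun r x) (reflect_quotientP b p).
rewrite mpoly_funM mpoly_funB mpoly_fun_linform => h.
by rewrite /F (mulrA (mpoly_fun (q b) x)) (mulrC (mpoly_fun (q b) x)) h; ring.
Qed.

(** The integral of d/dx_j (p W_e E^2) is 0, and theta_int applies to the terms
    coming from the derivative of the weight W_e. *)
Let reg_identity e : 0 < e ->
  rV_int (fun x => mpoly_fun A x * reg_weight e x * gauss x ^+ 2) +
  \sum_(b <- Rp) b 0 j * rV_int (fun x => (k b * mpoly_fun (q b) x) *
    (dotp b x * theta b e x) * reg_weight e x * gauss x ^+ 2) = 0.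
Proof.
move=> e0; pose S x := \sum_(b <- Rp) b 0 j * k b * (2 * theta b e x).
have tS : tame S.
  by apply: tame_sum => b; apply: tameZ; apply: tameZ; exact: tame_theta.
pose P x := mpoly_fun p x * reg_weight e x.
pose Q x := (mpoly_fun A x + mpoly_fun p x * S x) * reg_weight e x.
have tW := tame_reg_weight e0.
have tP : tame P by apply: tameM => //; exact: tame_mpoly_fun.
have tQ : tame Q.
  apply: tameM => //; apply: tameD; first exact: tame_mpoly_fun.
  by apply: tameM => //; exact: tame_mpoly_fun.
have dP x : is_derive x (delta_mx 0 j) (fun y => P y * gauss y ^+ 2) (Q x * gauss x ^+ 2).
  have h1 := is_derive_mpoly_fun p x (delta_mx 0 j).
  have h2 := is_derive_reg_weight x (delta_mx 0 j) e0.
  have h3 := is_derive_gauss x (delta_mx 0 j).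
  have -> : (fun y => P y * gauss y ^+ 2) = (mpoly_fun p * reg_weight e) * gauss ^+ 2.
    by apply/funext.
  apply: is_derive_eq.
  rewrite /GRing.scale /= /GRing.scale /= /Q /A mpoly_funB mpoly_funZ mpoly_funM.
  rewrite mpoly_fun_linform (_ : \sum_(b <- Rp) _ = S x); last first.
    by apply: eq_bigr => b _; rewrite dotp_delta /theta; ring.
  rewrite (_ : (gauss ^+ 2) x = gauss x ^+ 2)//.
  rewrite (_ : (mpoly_fun p * reg_weight e) x = mpoly_fun p x * reg_weight e x)//.
  by rewrite (dotpC _ x); ring.
have := rV_int_derivative0 tP tQ dP.
pose B b x := b 0 j * (k b * (2 * (mpoly_fun p x * theta b e x * reg_weight e x * gauss x ^+ 2))).
have iT b : rV_integrable (fun x => mpoly_fun p x * theta b e x * reg_weight e x * gauss x ^+ 2).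
  apply: tame_gauss_integrable; apply: tameM => //.
  by apply: tameM; [exact: tame_mpoly_fun|exact: tame_theta].
have iB b : rV_integrable (B b) by do 3 apply: rV_integrableZ.
have iA : rV_integrable (fun x => mpoly_fun A x * reg_weight e x * gauss x ^+ 2).
  by apply: tame_gauss_integrable; apply: tameM => //; exact: tame_mpoly_fun.
have -> : (fun x => Q x * gauss x ^+ 2) = (fun x =>
    mpoly_fun A x * reg_weight e x * gauss x ^+ 2 + \sum_(b <- Rp) B b x).
  apply/funext => x; rewrite /Q !mulrDl; congr (_ + _).
  rewrite /S mulr_sumr !mulr_suml; apply: eq_bigr => b _; rewrite /B; ring.
rewrite rV_intD//; last exact: rV_integrable_sum.
rewrite rV_int_sum// => h; rewrite -[RHS]h; congr (_ + _).
rewrite big_seq [RHS]big_seq; apply: eq_bigr => b bRp.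
rewrite /B (rV_intZ (b 0 j)); last by do 2 apply: rV_integrableZ.
congr (_ * _); rewrite (rV_intZ (k b)); last exact: rV_integrableZ.
rewrite theta_int// -(rV_intZ (k b)); last first.
  apply: tame_gauss_integrable; apply: tameM => //.
  apply: tameM; first exact: tame_mpoly_fun.
  by apply: tameM; [exact: tame_dotp|exact: tame_theta].
by congr rV_int; apply/funext => x; rewrite !mulrA.
Qed.

Let reg_limit f (rho : nat -> 'rV[R]_d -> R) : tame f ->
  (forall n, rV_measurable (rho n)) -> (forall n x, `|rho n x| <= 1) ->
  (forall x, f x * rho n x * reg_weight n.+1%:R^-1 x @[n --> \oo] -->
     f x * weight Rp k x) ->
  rV_int (fun x => f x * rho n x * reg_weight n.+1%:R^-1 x * gauss x ^+ 2)
    @[n --> \oo] --> rV_int (fun x => f x * weight Rp k x * gauss x ^+ 2).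
Proof.
move=> tf mrho rho1 flim; have [mf _ _] := tf.
have [mg _ _] := tameX 2 (@tame_gauss R d).
apply: (@rV_int_cvg _ _ (fun x => `|f x| * reg_weight 1 x * gauss x ^+ 2)).
- move=> n; apply: measurable_funM => //; apply: measurable_funM => //.
    by apply: measurable_funM; [exact: mf|exact: mrho].
  by have [] := tame_reg_weight (e_gt0 n).
- by move=> x; apply: cvgM; [exact: flim|exact: cvg_cst].
- apply: tame_gauss_integrable; apply: tameM; first exact: tame_norm.
  exact: tame_reg_weight.
- move=> n x; rewrite normrM (ger0_norm (sqr_ge0 _)) ler_wpM2r ?sqr_ge0//.
  rewrite !normrM (ger0_norm (ltW (reg_weight_gt0 _ _))).
  apply: ler_pM.
  + by rewrite mulr_ge0.
  + exact: ltW (reg_weight_gt0 _ _).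
  + by rewrite ler_piMr.
  + exact: (reg_weight_le _ (e_gt0 n) (e_le1 n)).
Qed.

(** The factor <b, x> theta_b tends to 1 off the hyperplane of b; on that
    hyperplane the weight is 0 unless k(b) = 0. *)
Let rho_lim b x : b \in Rp ->
  (k b * mpoly_fun (q b) x) * (dotp b x * theta b n.+1%:R^-1 x) *
    reg_weight n.+1%:R^-1 x @[n --> \oo] -->
  (k b * mpoly_fun (q b) x) * weight Rp k x.
Proof.
move=> bRp; have [k0|k0] := eqVneq (k b) 0.
  by under eq_fun do rewrite k0 !mul0r; rewrite k0 !mul0r; exact: cvg_cst.
have [bx|bx] := eqVneq (dotp b x) 0.
  under eq_fun do rewrite bx mul0r mulr0 mul0r.
  have -> : weight Rp k x = 0; last by rewrite mulr0; exact: cvg_cst.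
  apply/eqP; rewrite prodf_seq_eq0; apply/hasP; exists b => //=.
  by rewrite bx normr0 powR0// mulf_neq0.
apply: cvgM; last exact: cvg_reg_weight.
have sx : dotp b x ^+ 2 != 0 by rewrite expf_neq0.
have h : dotp b x ^+ 2 / sq b n.+1%:R^-1 x @[n --> \oo] -->
    dotp b x ^+ 2 / dotp b x ^+ 2.
  by apply: cvgM; [exact: cvg_cst|apply: cvgV => //; exact: (@cvg_sq b x)].
rewrite divff// in h; rewrite -[X in _ --> X]mulr1; apply: cvgM.
  exact: cvg_cst.
by under eq_fun do rewrite /theta mulrA -expr2.
Qed.

Lemma gauss_functional_dunkl_coord :
  L (dunkl_op Rp k (delta_mx 0 j) p) = 2 * L (linform (delta_mx 0 j) * p).
Proof.
have LB p1 p2 : L (p1 - p2) = L p1 - L p2.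
  by rewrite gauss_functionalD -scaleN1r gauss_functionalZ mulN1r.
have L_sum (r : seq 'rV[R]_d) (F : 'rV[R]_d -> mpoly d R) :
    L (\sum_(b <- r) F b) = \sum_(b <- r) L (F b).
  elim/big_rec2: _ => [|b y1 y2 _ <-]; last exact: gauss_functionalD.
  by rewrite -[0](scale0r 0) gauss_functionalZ mul0r.
apply/eqP; rewrite -subr_eq0 -gauss_functionalZ -LB dunkl_opE addrAC -/A.
rewrite gauss_functionalD L_sum; apply/eqP.
have limA : rV_int (fun x => mpoly_fun A x * reg_weight n.+1%:R^-1 x * gauss x ^+ 2)
    @[n --> \oo] --> L A.
  have := @reg_limit (mpoly_fun A) (fun _ _ => 1) (tame_mpoly_fun _).
  rewrite (_ : (fun n : nat => rV_int _) = (fun n : nat => rV_int (fun x =>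
      mpoly_fun A x * reg_weight n.+1%:R^-1 x * gauss x ^+ 2))); last first.
    by apply/funext => n; congr rV_int; apply/funext => x; rewrite mulr1.
  apply => [n|n x|x]; first exact: measurable_cst.
    by rewrite normr1.
  under eq_fun do rewrite mulr1.
  by apply: cvgM; [exact: cvg_cst|exact: cvg_reg_weight].
have limB b : b \in Rp -> rV_int (fun x => (k b * mpoly_fun (q b) x) *
    (dotp b x * theta b n.+1%:R^-1 x) * reg_weight n.+1%:R^-1 x * gauss x ^+ 2)
    @[n --> \oo] --> k b * L (q b).
  move=> bRp; rewrite -gauss_functionalZ /L.
  rewrite (_ : (fun x => _) =
    (fun x => k b * mpoly_fun (q b) x * weight Rp k x * gauss x ^+ 2)); last first.
    by apply/funext => x; rewrite mpoly_funZ.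
  apply: (@reg_limit (fun x => k b * mpoly_fun (q b) x)
    (fun n x => dotp b x * theta b n.+1%:R^-1 x)).
  - by apply: tameZ; exact: tame_mpoly_fun.
  - by move=> n; have [] := tameM (tame_dotp b) (tame_theta b (e_gt0 n)).
  - move=> n x; have u0 := sq_gt0 b x (e_gt0 n).
    rewrite /theta mulrA -expr2 ger0_norm; last by rewrite divr_ge0 ?sqr_ge0// ltW.
    by rewrite ler_pdivrMr// mul1r lerDl ltW// e_gt0.
  - by move=> x; exact: rho_lim.
have limS : \sum_(b <- Rp) b 0 j * rV_int (fun x => (k b * mpoly_fun (q b) x) *
    (dotp b x * theta b n.+1%:R^-1 x) * reg_weight n.+1%:R^-1 x * gauss x ^+ 2)
    @[n --> \oo] --> \sum_(b <- Rp) b 0 j * (k b * L (q b)).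
  suff : forall r : seq 'rV[R]_d, (forall b, b \in r -> b \in Rp) ->
    \sum_(b <- r) b 0 j * rV_int (fun x => (k b * mpoly_fun (q b) x) *
      (dotp b x * theta b n.+1%:R^-1 x) * reg_weight n.+1%:R^-1 x * gauss x ^+ 2)
      @[n --> \oo] --> \sum_(b <- r) b 0 j * (k b * L (q b)) by apply.
  elim=> [|b r IH] rRp.
    by under eq_fun do rewrite big_nil; rewrite big_nil; exact: cvg_cst.
  under eq_fun do rewrite big_cons; rewrite big_cons; apply: cvgD.
    by apply: cvgM; [exact: cvg_cst|apply: limB; apply: rRp; rewrite mem_head].
  by apply: IH => c cr; apply: rRp; rewrite in_cons cr orbT.
have lim := cvgD limA limS.
have E : (fun n : nat =>
    rV_int (fun x => mpoly_fun A x * reg_weight n.+1%:R^-1 x * gauss x ^+ 2)) \+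
  (fun n : nat => \sum_(b <- Rp) b 0 j * rV_int (fun x => (k b * mpoly_fun (q b) x) *
    (dotp b x * theta b n.+1%:R^-1 x) * reg_weight n.+1%:R^-1 x * gauss x ^+ 2)) = cst 0.
  by apply/funext => n /=; exact: (reg_identity (e_gt0 n)).
transitivity (L A + \sum_(b <- Rp) b 0 j * (k b * L (q b))); last first.
  have {}lim : (cst 0 : nat -> R) n @[n --> \oo] -->
      L A + \sum_(b <- Rp) b 0 j * (k b * L (q b)) by rewrite -E; exact: lim.
  by apply: (cvg_unique _ lim) => //; exact: cvg_cst.
congr (_ + _); apply: eq_bigr => b _.
by rewrite gauss_functionalZ dotp_delta; ring.
Qed.

End Limit.

Lemma gauss_functional_dunkl v p :
  L (dunkl_op Rp k v p) = 2 * L (linform v * p).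
Proof.
have L_sum (r : seq 'I_d) (F : 'I_d -> mpoly d R) :
    L (\sum_(i <- r) F i) = \sum_(i <- r) L (F i).
  elim/big_rec2: _ => [|i y1 y2 _ <-]; last exact: gauss_functionalD.
  by rewrite -[0](scale0r 0) gauss_functionalZ mul0r.
rewrite dunkl_op_sumv// L_sum [in RHS]/linform mulr_suml L_sum mulr_sumr.
apply: eq_bigr => i _; rewrite gauss_functionalZ gauss_functional_dunkl_coord.
by rewrite linform_delta -scalerAl gauss_functionalZ mulrCA.
Qed.

End RegularizedWeight.

(** * Orthogonal series in L^2 *)

Section SquareIntegrable.
Context {dT} {T : measurableType dT} {R : realType}.
Variable mu : {measure set T -> \bar R}.
Implicit Types (f g h : T -> R).

Definition sqr_integral f : \bar R := (\int[mu]_t (f t ^+ 2)%:E)%E.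

Local Notation Q := sqr_integral.

Lemma sqr_integral_ge0 f : (0 <= Q f)%E.
Proof. by apply: integral_ge0 => t _; rewrite lee_fin sqr_ge0. Qed.

Let measurable_sqr f : measurable_fun setT f ->
  measurable_fun setT (fun t => (f t ^+ 2)%:E).
Proof. by move=> mf; apply/measurable_EFinP; exact: measurable_funX. Qed.

(** A triangle inequality up to a constant factor, without square roots. *)
Lemma sqr_integral_parallelogram f g h :
  measurable_fun setT f -> measurable_fun setT g -> measurable_fun setT h ->
  (forall t, f t = g t + h t) -> (Q f <= 2%:E * Q g + 2%:E * Q h)%E.
Proof.
move=> mf mg mh fE; rewrite -!ge0_integralZl//; try exact: measurable_sqr;
  try by (move=> t _; rewrite lee_fin sqr_ge0).
have m2 (u : T -> R) : measurable_fun setT u ->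
    measurable_fun setT (fun t => (2%:E * (u t ^+ 2)%:E)%E).
  by move=> mu'; apply: emeasurable_funM => //; exact: measurable_sqr.
rewrite -ge0_integralD//; try exact: m2;
  try by (move=> t _; rewrite -EFinM lee_fin mulr_ge0// sqr_ge0).
apply: ge0_le_integral => //; try exact: measurable_sqr.
- by move=> t _; rewrite lee_fin sqr_ge0.
- by apply: emeasurable_funD; exact: m2.
- move=> t _; rewrite -!EFinM -EFinD lee_fin fE.
  by have := sqr_ge0 (g t - h t); nra.
Qed.

(** The function sum_m 2^m (S_(m+1) - S_m)^2 is integrable, hence finite almost
    everywhere. Together with a geometric series it dominates the increments,
    as |D| <= 2^(-m) + 2^m D^2. *)
Lemma sqr_integral_fast_cauchy (S : nat -> T -> R) :
  (forall m, measurable_fun setT (S m)) ->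
  (forall m, (Q (fun t => (S m.+1 t - S m t)%R) <= (4^-1 ^+ m)%:E)%E) ->
  exists g, measurable_fun setT g /\
    {ae mu, forall t, S m t @[m --> \oo] --> g t}.
Proof.
move=> mS QS.
pose u m t := 2 ^+ m * (S m.+1 t - S m t) ^+ 2.
have u0 m t : 0 <= u m t by rewrite mulr_ge0 ?sqr_ge0 ?exprn_ge0.
have mu_ m : measurable_fun setT (fun t => (u m t)%:E).
  apply/measurable_EFinP; apply: measurable_funM => //.
  by apply: measurable_funX; exact: measurable_funB.
pose phi t := (\sum_(0 <= m <oo) (u m t)%:E)%E.
have phi_fin : (\int[mu]_t phi t < +oo)%E.
  rewrite integral_nneseries//; last by move=> m t _; rewrite lee_fin.
  apply: (@le_lt_trans _ _ (\sum_(0 <= m <oo) (2^-1 ^+ m)%:E)%E).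
    apply: lee_nneseries => m.
      by move=> *; apply: integral_ge0 => t _; rewrite lee_fin.
    move=> _; rewrite (eq_integral (fun t =>
      (2 ^+ m)%:E * ((S m.+1 t - S m t) ^+ 2)%:E)%E); last first.
      by move=> t _; rewrite -EFinM.
    rewrite ge0_integralZl//; last 2 first.
    - by apply: measurable_sqr; exact: measurable_funB.
    - by move=> t _; rewrite lee_fin sqr_ge0.
    rewrite (_ : (2^-1 ^+ m)%:E = (2 ^+ m)%:E * (4^-1 ^+ m)%:E)%E.
      by rewrite lee_wpmul2l ?lee_fin ?exprn_ge0//; exact: QS.
    by rewrite -EFinM -exprMn; congr (_ ^+ _)%:E; field.
  rewrite (eq_eseriesr (g := fun m => (2 / (2 ^ (m + 1))%:R)%:E)); last first.
    move=> m _; rewrite addn1 expnS natrM natrX invfM mulrA divff// mul1r.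
    by rewrite exprVn.
  by rewrite (cvg_lim _ (@cvg_geometric_eseries_half R 2 0))// expr0 divr1 ltry.
have phi0 t : (0 <= phi t)%E.
  by apply: nneseries_ge0 => m _ _; rewrite lee_fin.
have mphi : measurable_fun setT phi.
  by apply: ge0_emeasurable_sum => // m t _; rewrite lee_fin.
have phi_int : mu.-integrable setT phi.
  apply/integrableP; split=> //.
  by rewrite (eq_integral phi)// => t _; rewrite gee0_abs.
have Scvg t : phi t \is a fin_num -> cvgn (S ^~ t).
  move=> phit; have useries : cvgn (series (u ^~ t)).
    apply: nondecreasing_is_cvgn.
      by apply/nondecreasing_series => n _ _; exact: u0.
    exists (fine (phi t)) => _ [n _ <-].
    rewrite -lee_fin fineK// /series/= -sumEFin; apply: nneseries_lim_ge => m _ _.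
    by rewrite lee_fin.
  have gseries : cvgn (series (geometric 1 (2^-1 : R))).
    by apply: is_cvg_geometric_series; rewrite ger0_norm ?invr_ge0// invf_lt1 ?ltr1n.
  have : cvgn (series (telescope (S ^~ t))).
    apply: normed_cvg.
    apply: (@series_le_cvg _ _ (fun m => geometric 1 (2^-1 : R) m + u m t)).
    - by move=> m; exact: normr_ge0.
    - by move=> m; rewrite addr_ge0// /geometric/= mul1r exprn_ge0.
    - move=> m; rewrite /telescope/= mul1r /u -[(_ - _) ^+ 2]real_normK ?num_real//.
      set a := `|_|; have a0 : 0 <= a by exact: normr_ge0.
      have p0 : 0 < (2 : R) ^+ m by rewrite exprn_gt0.
      rewrite exprVn -(ler_pM2l p0) mulrDr divff ?gt_eqF//.
      by rewrite mulrA -expr2 -exprMn; set b := _ * a; nra.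
    rewrite (_ : series _ = series (geometric 1 (2^-1 : R)) + series (u ^~ t)).
      exact: is_cvgD.
    by apply/funext => n; rewrite /series/= fctE big_split.
  move=> tel; rewrite (_ : S ^~ t = cst (S 0%N t) + series (telescope (S ^~ t))).
    by apply: is_cvgD => //; exact: is_cvg_cst.
  by apply/funext => n; rewrite [LHS](eq_sum_telescope (S ^~ t)).
exists (fun t => fine (limn_esup (fun m => (S m t)%:E))); split.
  apply: (measurableT_comp (fine_measurable _)) => //.
  by apply: measurable_fun_limn_esup => m; apply/measurable_EFinP; exact: mS.
apply: filterS (integrable_ae measurableT phi_int) => t /(_ I) phit.
have /cvg_ex [l Sl] := Scvg t phit.
have SlE : (S m t)%:E @[m --> \oo] --> l%:E by apply: cvg_EFin => //; exact: nearW.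
by rewrite (cvg_limn_einf_sup SlE).2.
Qed.

Lemma sqr_integral_ae_limit (S : nat -> T -> R) g h (c : R) :
  (forall m, measurable_fun setT (S m)) ->
  measurable_fun setT g -> measurable_fun setT h ->
  {ae mu, forall t, S m t @[m --> \oo] --> g t} ->
  (\forall m \near \oo, (Q (fun t => (S m t - h t)%R) <= c%:E)%E) ->
  (Q (fun t => (g t - h t)%R) <= c%:E)%E.
Proof.
move=> mS mg mh Sg QS.
pose F m t := ((S m t - h t) ^+ 2)%:E.
have mF m : measurable_fun setT (F m).
  by apply: measurable_sqr; exact: measurable_funB.
have F0 m t : (0 <= F m t)%E by rewrite lee_fin sqr_ge0.
have lim_ge0 t : (0 <= limn_einf (F ^~ t))%E.
  rewrite limn_einf_lim; apply: lime_ge; first exact: is_cvg_einfs.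
  by apply: nearW => n; apply: le_ereal_inf_tmp => _ [m _ <-]; exact: F0.
have F_lim : ae_eq mu setT (fun t => ((g t - h t) ^+ 2)%:E)
    (fun t => limn_einf (F ^~ t)).
  apply: filterS Sg => t Sgt _; symmetry; rewrite /F.
  have SE : ((S m t - h t) ^+ 2)%:E @[m --> \oo] --> ((g t - h t) ^+ 2)%:E.
    apply: cvg_EFin; first exact: nearW.
    rewrite expr2; under eq_cvg do rewrite /= expr2.
    by apply: cvgM; apply: cvgB => //; exact: cvg_cst.
  by rewrite (cvg_limn_einf_sup SE).1.
have mgh : measurable_fun setT (fun t => ((g t - h t) ^+ 2)%:E).
  by apply: measurable_sqr; exact: measurable_funB.
have mlim : measurable_fun setT (fun t => limn_einf (F ^~ t)).
  rewrite /limn_einf; apply: measurableT_comp => //.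
  apply: measurable_fun_limn_esup => m; exact: measurableT_comp.
have gh0 t : [set: T] t -> (0 <= ((g t - h t) ^+ 2)%:E)%E.
  by rewrite lee_fin sqr_ge0.
rewrite /Q (ge0_ae_eq_integral measurableT mgh mlim gh0 (fun t _ => lim_ge0 t) F_lim).
apply: le_trans (fatou mu measurableT mF _) _ => //.
rewrite limn_einf_lim; apply: lime_le; first exact: is_cvg_einfs.
case: QS => N _ QS; exists N => // m /= Nm.
apply: le_trans (QS m Nm); apply: ereal_inf_lbound.
by exists m => /=.
Qed.

(** Riesz-Fischer for sums over an arbitrary index set: partial sums are
    compared with those of a convergent numerical series, and a sequence of
    finite sets exhausting that series gives the limit. *)
Lemma sqr_integral_summable (I : choiceType) (u : I -> T -> R) (s : I -> R)
    (M : R) :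
  (forall n, measurable_fun setT (u n)) -> (forall n, 0 <= s n) ->
  (forall A : {fset I},
     (Q (fun t => (\sum_(n <- A) u n t)%R) <= (\sum_(n <- A) s n)%:E)%E) ->
  (forall A : {fset I}, \sum_(n <- A) s n <= M) ->
  exists g, measurable_fun setT g /\
    forall e : R, 0 < e -> exists A0 : {fset I}, forall A : {fset I},
      (A0 `<=` A)%fset ->
      (Q (fun t => (g t - \sum_(n <- A) u n t)%R) <= e%:E)%E.
Proof.
move=> mu_ s0 Qu sM.
pose S (A : {fset I}) t := \sum_(n <- A) u n t.
have mS A : measurable_fun setT (S A) by exact: measurable_sum.
have sumD (V : nmodType) (F : I -> V) (A B : {fset I}) : (B `<=` A)%fset ->
    \sum_(n <- A) F n = \sum_(n <- B) F n + \sum_(n <- (A `\` B)%fset) F n.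
  move=> BA; rewrite -big_cat; apply: perm_big; apply: uniq_perm => //=.
    rewrite cat_uniq !fset_uniq/= andbT; apply/hasPn => n /=.
    by rewrite in_fsetD => /andP[].
  move=> n; rewrite mem_cat in_fsetD; case: (boolP (n \in B)) => //= nB.
  by rewrite (fsubsetP BA).
pose E := range (fun A : {fset I} => \sum_(n <- A) s n).
have supE : has_sup E.
  by split; [exists (\sum_(n <- fset0) s n), fset0 | exists M => _ [A _ <-]].
have /choice[A_ A_s] m : exists A : {fset I}, sup E - 4^-1 ^+ m < \sum_(n <- A) s n.
  have [|_ [A _ <-] ltA] := @sup_adherent _ _ (4^-1 ^+ m) _ supE; last by exists A.
  by rewrite exprn_gt0// invr_gt0.
(* Unions make the exhausting sets increasing. *)
pose B_ := fix B m := if m is m'.+1 then (B m' `|` A_ m'.+1)%fset else A_ 0%N.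
have AB m : (A_ m `<=` B_ m)%fset by case: m => //= m; exact: fsubsetUr.
have BB m p : (m <= p)%N -> (B_ m `<=` B_ p)%fset.
  elim: p => [|p IH]; first by rewrite leqn0 => /eqP ->.
  rewrite leq_eqVlt ltnS => /predU1P[->//|/IH mp].
  by apply: fsubset_trans mp _; exact: fsubsetUl.
have QB m (A : {fset I}) : (B_ m `<=` A)%fset ->
    (Q (fun t => (S A t - S (B_ m) t)%R) <= (4^-1 ^+ m)%:E)%E.
  move=> BA; rewrite (_ : (fun t => _) = S (A `\` B_ m)%fset); last first.
    by apply/funext => t; rewrite /S (sumD _ _ _ _ BA) addrC addKr.
  apply: le_trans (Qu _) _; rewrite lee_fin.
  have : \sum_(n <- A) s n <= sup E by apply: sup_ubound; [case: supE|exists A].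
  have := A_s m; rewrite (sumD _ _ _ _ BA) (sumD _ _ _ _ (AB m)).
  have : 0 <= \sum_(n <- (B_ m `\` A_ m)%fset) s n by exact: sumr_ge0.
  by lra.
have [g [mg Sg]] := @sqr_integral_fast_cauchy (fun m => S (B_ m)) (fun m => mS _)
  (fun m => QB m _ (BB _ _ (leqnSn m))).
exists g; split=> // e e0.
have [m m_e] : exists m, (4^-1 : R) ^+ m <= e / 4.
  have : (fun m => (4^-1 : R) ^+ m) @ \oo --> 0.
    by apply: cvg_expr; rewrite ger0_norm ?invr_ge0// invf_lt1 ?ltr1n.
  move=> /cvgrPdist_le /(_ (e / 4)) [|m _ /(_ _ (leqnn m))]; first by rewrite divr_gt0.
  by rewrite sub0r normrN ger0_norm ?exprn_ge0 ?invr_ge0//; exists m.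
exists (B_ m) => A BA.
have gB : (Q (fun t => (g t - S (B_ m) t)%R) <= (4^-1 ^+ m)%:E)%E.
  apply: (sqr_integral_ae_limit _ mg (mS _) Sg) => //.
  by exists m => // p mp; exact: QB (BB _ _ mp).
apply: (@le_trans _ _ (2%:E * Q (fun t => (g t - S (B_ m) t)%R) +
    2%:E * Q (fun t => (S (B_ m) t - S A t)%R))%E).
  apply: sqr_integral_parallelogram.
  - exact: measurable_funB mg (mS A).
  - exact: measurable_funB mg (mS _).
  - exact: measurable_funB.
  - by move=> t; rewrite /S; ring.
have QC : Q (fun t => (S (B_ m) t - S A t)%R) = Q (fun t => (S A t - S (B_ m) t)%R).
  by apply: eq_integral => t _; rewrite -sqrrN opprB.
rewrite QC; apply: (@le_trans _ _ (2%:E * (4^-1 ^+ m)%:E + 2%:E * (4^-1 ^+ m)%:E)%E).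
  by apply: leeD; apply: lee_wpmul2l => //; exact: QB.
by rewrite -!EFinM -EFinD lee_fin; lra.
Qed.

Definition sqr_integrable f := measurable_fun setT f /\ (Q f < +oo)%E.

Definition inner_product f g : R := fine (\int[mu]_t (f t * g t)%:E)%E.

Local Notation ip := inner_product.

Lemma sqr_integrableM f g : sqr_integrable f -> sqr_integrable g ->
  mu.-integrable setT (fun t => (f t * g t)%:E).
Proof.
move=> [mf Qf] [mg Qg].
have i2 (h : T -> R) : measurable_fun setT h -> (Q h < +oo)%E ->
    mu.-integrable setT (fun t => (h t ^+ 2)%:E).
  move=> mh Qh; apply/integrableP; split; first exact: measurable_sqr.
  rewrite (eq_integral (fun t => (h t ^+ 2)%:E))// => t _.
  by rewrite gee0_abs// lee_fin sqr_ge0.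
apply: le_integrable (integrableD measurableT (i2 _ mf Qf) (i2 _ mg Qg)) => //.
  by apply/measurable_EFinP; exact: measurable_funM.
move=> t _ /=; rewrite lee_fin normrM (ger0_norm (addr_ge0 (sqr_ge0 _) (sqr_ge0 _))).
rewrite -(real_normK (num_real (f t))) -(real_normK (num_real (g t))).
by have := normr_ge0 (f t); have := normr_ge0 (g t); nra.
Qed.

Lemma inner_productC f g : ip f g = ip g f.
Proof. by congr fine; apply: eq_integral => t _; rewrite mulrC. Qed.

Lemma inner_productZr c f g : sqr_integrable f -> sqr_integrable g ->
  ip f (fun t => c * g t) = c * ip f g.
Proof.
move=> sf sg; have := @RintegralZl _ _ _ mu setT _ c measurableT (sqr_integrableM sf sg).
by rewrite /Rintegral => <-; congr fine; apply: eq_integral => t _; rewrite mulrCA.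
Qed.

Lemma inner_productDr f g h :
  sqr_integrable f -> sqr_integrable g -> sqr_integrable h ->
  ip f (fun t => g t + h t) = ip f g + ip f h.
Proof.
move=> sf sg sh.
have := @RintegralD _ _ _ mu setT _ _ measurableT (sqr_integrableM sf sg) (sqr_integrableM sf sh).
by rewrite /Rintegral => <-; congr fine; apply: eq_integral => t _; rewrite mulrDr.
Qed.

Lemma sqr_integrableE f : sqr_integrable f -> Q f = (ip f f)%:E.
Proof.
move=> [mf Qf]; rewrite fineK// ge0_fin_numE//.
by apply: integral_ge0 => t _; rewrite lee_fin -expr2 sqr_ge0.
Qed.

Lemma sqr_integrableD f g : sqr_integrable f -> sqr_integrable g ->
  sqr_integrable (fun t => f t + g t).
Proof.
move=> [mf Qf] [mg Qg]; split; first exact: measurable_funD.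
apply: le_lt_trans (sqr_integral_parallelogram _ mf mg (fun=> erefl)) _.
  exact: measurable_funD.
by rewrite lte_add_pinfty// lte_mul_pinfty.
Qed.

Lemma sqr_integralZ c f : measurable_fun setT f ->
  Q (fun t => c * f t) = ((c ^+ 2)%:E * Q f)%E.
Proof.
move=> mf; rewrite -ge0_integralZl//; first last.
- by rewrite lee_fin sqr_ge0.
- by move=> t _; rewrite lee_fin sqr_ge0.
- exact: measurable_sqr.
by apply: eq_integral => t _; rewrite exprMn EFinM.
Qed.

Lemma sqr_integrableZ c f : sqr_integrable f -> sqr_integrable (fun t => c * f t).
Proof.
move=> [mf Qf]; split; first exact: measurable_funM.
by rewrite sqr_integralZ// lte_mul_pinfty// ?lee_fin ?sqr_ge0.
Qed.

Section Orthogonal.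
Context {I : choiceType}.
Implicit Types (A : {fset I}) (s : seq I) (c : I -> R) (e v : I -> T -> R).

Lemma sqr_integrable_sum s v : (forall n, sqr_integrable (v n)) ->
  sqr_integrable (fun t => \sum_(n <- s) v n t).
Proof.
move=> sv; elim: s => [|n s IH].
  under eq_fun do rewrite big_nil.
  split; first exact: measurable_cst.
  by rewrite /Q (eq_integral (cst 0%E)) ?integral0// => t _; rewrite expr0n.
by under eq_fun do rewrite big_cons; exact: sqr_integrableD.
Qed.

Lemma inner_product_sumr s c f v :
  sqr_integrable f -> (forall n, sqr_integrable (v n)) ->
  ip f (fun t => \sum_(n <- s) c n * v n t) = \sum_(n <- s) c n * ip f (v n).
Proof.
move=> sf sv; elim: s => [|n s IH].
  rewrite big_nil /ip (eq_integral (cst 0%E)) ?integral0// => t _.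
  by rewrite big_nil mulr0.
under eq_fun do rewrite big_cons.
rewrite inner_productDr ?inner_productZr ?big_cons ?IH//.
  exact: sqr_integrableZ.
by apply: sqr_integrable_sum => m; exact: sqr_integrableZ.
Qed.

Lemma inner_product_orthogonal_sum A c v :
  (forall n, sqr_integrable (v n)) ->
  (forall n m, n != m -> ip (v n) (v m) = 0) ->
  ip (fun t => \sum_(n <- A) c n * v n t) (fun t => \sum_(n <- A) c n * v n t) =
  \sum_(n <- A) c n ^+ 2 * ip (v n) (v n).
Proof.
move=> sv ov; rewrite inner_product_sumr//; last first.
  by apply: sqr_integrable_sum => n; exact: sqr_integrableZ.
rewrite big_seq [RHS]big_seq; apply: eq_bigr => n nA.
rewrite inner_productC inner_product_sumr// (big_fsetD1 n)//= big_seq big1 ?addr0.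
  by rewrite mulrA -expr2.
by move=> m; rewrite in_fsetD1 => /andP[mn _]; rewrite ov ?mulr0// eq_sym.
Qed.

(** The square of the norm of f - sum_n <f, e_n> e_n is nonnegative. *)
Lemma bessel A e f : (forall n, sqr_integrable (e n)) ->
  (forall n m, n != m -> ip (e n) (e m) = 0) ->
  (forall n, ip (e n) (e n) <= 1) ->
  sqr_integrable f -> \sum_(n <- A) ip f (e n) ^+ 2 <= ip f f.
Proof.
move=> se oe e1 sf.
pose h t := \sum_(n <- A) - ip f (e n) * e n t.
have sh : sqr_integrable h.
  by apply: sqr_integrable_sum => n; exact: sqr_integrableZ.
have : 0 <= ip (fun t => f t + h t) (fun t => f t + h t).
  by apply: fine_ge0; apply: integral_ge0 => t _; rewrite lee_fin -expr2 sqr_ge0.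
have sfh := sqr_integrableD sf sh.
rewrite inner_productDr// inner_productC inner_productDr//.
rewrite (inner_productC (fun t => f t + h t) h) inner_productDr// (inner_productC h f).
rewrite inner_product_orthogonal_sum// inner_product_sumr//.
have le1 : \sum_(n <- A) (- ip f (e n)) ^+ 2 * ip (e n) (e n) <=
    \sum_(n <- A) ip f (e n) ^+ 2.
  by apply: ler_sum => n _; rewrite sqrrN ler_piMr ?sqr_ge0.
under eq_bigr do rewrite mulNr -expr2; rewrite sumrN.
by move: le1; lra.
Qed.

(** Bessel's inequality controls the coefficients, and Riesz-Fischer sums the
    image: this is the boundedness of the operator sending e n to v n. *)
Lemma orthogonal_transform e v f (K : R) :
  (forall n, sqr_integrable (e n)) ->
  (forall n m, n != m -> ip (e n) (e m) = 0) ->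
  (forall n, ip (e n) (e n) <= 1) ->
  (forall n, sqr_integrable (v n)) ->
  (forall n m, n != m -> ip (v n) (v m) = 0) ->
  (forall n, ip (v n) (v n) <= K) -> 0 <= K -> sqr_integrable f ->
  (forall A, (Q (fun t => (\sum_(n <- A) ip f (e n) * v n t)%R) <= K%:E * Q f)%E) /\
  exists g, measurable_fun setT g /\
    forall eps : R, 0 < eps -> exists A0 : {fset I}, forall A, (A0 `<=` A)%fset ->
      (Q (fun t => (g t - \sum_(n <- A) ip f (e n) * v n t)%R) <= eps%:E)%E.
Proof.
move=> se oe e1 sv ov vK K0 sf.
have sA A : (Q (fun t => (\sum_(n <- A) ip f (e n) * v n t)%R) <=
    (\sum_(n <- A) K * ip f (e n) ^+ 2)%:E)%E.
  rewrite sqr_integrableE; last first.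
    by apply: sqr_integrable_sum => n; exact: sqr_integrableZ.
  rewrite lee_fin inner_product_orthogonal_sum//; apply: ler_sum => n _.
  by rewrite mulrC ler_wpM2r ?sqr_ge0.
have sK A : \sum_(n <- A) K * ip f (e n) ^+ 2 <= K * ip f f.
  by rewrite -mulr_sumr ler_wpM2l//; exact: bessel.
split=> [A|]; first by rewrite (sqr_integrableE sf) -EFinM (le_trans (sA A))// lee_fin.
apply: (@sqr_integral_summable _ _ (fun n => K * ip f (e n) ^+ 2) (K * ip f f)) => //.
- by move=> n; exact: (sqr_integrableZ _ (sv n)).1.
- by move=> n; rewrite mulr_ge0// sqr_ge0.
Qed.

End Orthogonal.
End SquareIntegrable.

(** * The Hermite system *)

Section HermiteSystem.
Context {R : realType} {d : nat}.
Variables (Rp : {fset 'rV[R]_d}) (k : 'rV[R]_d -> R).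
Hypothesis Rp0 : forall b, b \in Rp -> b != 0.
Hypothesis k_ge0 : forall b, b \in Rp -> 0 <= k b.
Hypothesis Rp_inv : reflection_invariant Rp k.
Implicit Types (p q : mpoly d R) (c : R).

Let mu : {measure set (d.-tuple R) -> \bar R} := @lebesgue_tuple R d.

Definition sqrt_weight (t : d.-tuple R) : R := weight Rp k (rV_of_tuple t) `^ 2^-1.

Local Notation W := sqrt_weight.

Lemma sqrt_weight_sqr t : W t ^+ 2 = weight Rp k (rV_of_tuple t).
Proof. by rewrite /W powR12_sqrt ?weight_ge0// sqr_sqrtr ?weight_ge0. Qed.

Lemma measurable_sqrt_weight : measurable_fun setT W.
Proof.
apply: (measurableT_comp (measurable_powR 2^-1)).
exact: rV_measurable_weight.
Qed.

(** The functions c e^{-|x|^2/2} p(x), with the weight shared evenly between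
    the two factors of a product. *)
Definition gauss_mpoly c p (t : d.-tuple R) : R :=
  c * gauss (rV_of_tuple t) * mpoly_fun p (rV_of_tuple t) * W t.

Let gauss_mpolyM c c' p q t : gauss_mpoly c p t * gauss_mpoly c' q t =
  c * c' * (mpoly_fun (p * q) (rV_of_tuple t) * weight Rp k (rV_of_tuple t) *
            gauss (rV_of_tuple t) ^+ 2).
Proof. by rewrite -sqrt_weight_sqr mpoly_funM /gauss_mpoly; ring. Qed.

Let mpoly_integrable p : rV_integrable
  (fun x => mpoly_fun p x * weight Rp k x * gauss x ^+ 2).
Proof. by apply: weight_integrable => //; exact: tame_mpoly_fun. Qed.

Lemma inner_product_gauss_mpoly c c' p q :
  inner_product mu (gauss_mpoly c p) (gauss_mpoly c' q) =
  c * c' * gauss_functional Rp k (p * q).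
Proof.
rewrite /gauss_functional -rV_intZ; last exact: mpoly_integrable.
by congr fine; apply: eq_integral => t _; rewrite gauss_mpolyM.
Qed.

Lemma sqr_integrable_gauss_mpoly c p : sqr_integrable mu (gauss_mpoly c p).
Proof.
split.
  apply: measurable_funM measurable_sqrt_weight.
  apply: measurable_funM; last by have [] := tame_mpoly_fun p.
  by apply: measurable_funM => //; exact: rV_measurable_gauss.
rewrite /sqr_integral (eq_integral (fun t => (c ^+ 2)%:E *
  (mpoly_fun (p * p) (rV_of_tuple t) * weight Rp k (rV_of_tuple t) *
            gauss (rV_of_tuple t) ^+ 2)%:E)%E); last first.
  by move=> t _; rewrite expr2 gauss_mpolyM -EFinM.
rewrite integralZl//; last exact: mpoly_integrable.
rewrite [X in (_ * X)%E](integral_rVE (mpoly_integrable (p * p))).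
by rewrite -EFinM ltry.
Qed.

Lemma gauss_constE : gauss_const Rp k = gauss_functional Rp k 1.
Proof.
congr fine; apply: eq_integral => t _.
by rewrite /= -gauss_sqr (_ : 1 = mpolyC d 1)// mpoly_funC mul1r mulrC.
Qed.

Lemma gauss_const_ge0 : 0 <= gauss_const Rp k.
Proof.
apply: fine_ge0; apply: integral_ge0 => t _.
by rewrite lee_fin mulr_ge0 ?expR_ge0 ?weight_ge0.
Qed.

Lemma inner_product_exp_lap c c' n p q : p \is ishomog1 n mdeg ->
  inner_product mu (gauss_mpoly c (exp_lap Rp k p)) (gauss_mpoly c' (exp_lap Rp k q)) =
  c * c' * (2^-1 ^+ n * (gauss_const Rp k * fischer_form Rp k p q)).
Proof.
move=> ph; rewrite inner_product_gauss_mpoly gauss_constE.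
congr (_ * _); apply: macdonald_identity => //.
- exact: gauss_functionalD.
- exact: gauss_functionalZ.
- exact: gauss_functional_dunkl.
- by move=> b r; exact: gauss_functional_reflect.
Qed.

Variable phi : multinom d -> mpoly d R.
Hypothesis phi_homog : forall n, phi n \is ishomog1 (mdeg n) mdeg.
Hypothesis phi_orthonormal :
  forall n m, fischer_form Rp k (phi n) (phi m) = (n == m)%:R.

Definition hermite_coeff (n : multinom d) : R :=
  Num.sqrt ((2 ^+ mdeg n * (mfactorial n)%:R * gauss_const Rp k)^-1) *
  (2 ^+ mdeg n * Num.sqrt (mfactorial n)%:R).

Lemma hermite_funE n : hermite_fun Rp k phi n =
  fun x => hermite_coeff n * gauss x * mpoly_fun (exp_lap Rp k (phi n)) x.
Proof.
apply/funext => x; rewrite /hermite_fun /hermite_poly exp_laplaceE// mpoly_funZ.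
by rewrite /hermite_coeff /gauss; ring.
Qed.

(** Here theta is 1, or 0 if the weighted Gaussian has integral 0, in which case
    all coefficients vanish; Bessel's inequality allows both. *)
Lemma hermite_coeff_sqr n : exists2 theta : R, 0 <= theta <= 1 &
  hermite_coeff n ^+ 2 * gauss_const Rp k = 2 ^+ mdeg n * theta.
Proof.
have f0 : (0 : R) < (mfactorial n)%:R.
  by rewrite ltr0n; apply: prodn_gt0 => i; exact: fact_gt0.
have p0 : 0 < (2 : R) ^+ mdeg n by rewrite exprn_gt0.
have c0 := gauss_const_ge0.
rewrite /hermite_coeff !exprMn !sqr_sqrtr ?ler0n//; last first.
  by rewrite invr_ge0 !mulr_ge0// ltW.
case: (eqVneq (gauss_const Rp k) 0) => [->|c1].
  by exists 0; rewrite ?lexx ?ler01// !mulr0.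
by exists 1; rewrite ?lexx ?ler01//; field; rewrite c1 !gt_eqF.
Qed.

Definition weighted_hermite n : d.-tuple R -> R :=
  gauss_mpoly (hermite_coeff n) (exp_lap Rp k (phi n)).

Lemma weighted_hermiteE n t :
  weighted_hermite n t = hermite_fun Rp k phi n (rV_of_tuple t) * W t.
Proof. by rewrite hermite_funE. Qed.

Lemma inner_product_hermite n m : n != m ->
  inner_product mu (weighted_hermite n) (weighted_hermite m) = 0.
Proof.
move=> nm; rewrite (inner_product_exp_lap _ _ _ (phi_homog n)).
by rewrite phi_orthonormal (negbTE nm) !mulr0.
Qed.

Lemma norm_hermite n :
  inner_product mu (weighted_hermite n) (weighted_hermite n) <= 1.
Proof.
rewrite (inner_product_exp_lap _ _ _ (phi_homog n)) phi_orthonormal eqxx mulr1.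
rewrite mulrCA -expr2; have [th /andP[_ th1] ->] := hermite_coeff_sqr n.
by rewrite mulrA -exprMn mulVf// expr1n mul1r.
Qed.

Variable j : 'I_d.

Local Notation Dj := (dunkl_op Rp k (delta_mx 0 j)).

Definition riesz_scale (n : multinom d) : R :=
  (Num.sqrt (2 * (mdeg n)%:R + 2 * gamma Rp k + d%:R))^-1.

Definition weighted_delta n : d.-tuple R -> R :=
  gauss_mpoly (riesz_scale n * hermite_coeff n) (exp_lap Rp k (Dj (phi n))).

Lemma weighted_deltaE n t : weighted_delta n t =
  riesz_scale n * delta Rp k j (hermite_fun Rp k phi n) (rV_of_tuple t) * W t.
Proof.
rewrite hermite_funE delta_gauss_mpoly// -exp_lap_op//.
by rewrite /weighted_delta /gauss_mpoly; ring.
Qed.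

Lemma inner_product_delta n m :
  fischer_form Rp k (Dj (phi n)) (Dj (phi m)) = 0 ->
  inner_product mu (weighted_delta n) (weighted_delta m) = 0.
Proof.
move=> F0; have := dunkl_op_homog k Rp0 (delta_mx 0 j) (phi_homog n).
case: (mdeg n) => [D0|n' Dh].
  have D1 : Dj (phi n) \is ishomog1 0 mdeg by rewrite D0; exact: rpred0.
  by rewrite (inner_product_exp_lap _ _ _ D1) F0 !mulr0.
by rewrite (inner_product_exp_lap _ _ _ Dh) F0 !mulr0.
Qed.

(** The dimension is positive, as there is a coordinate j, and gamma >= 0. *)
Lemma riesz_scale_sqr n :
  0 <= riesz_scale n ^+ 2 <= ((mdeg n)%:R + 1)^-1.
Proof.
have g0 : 0 <= gamma Rp k by rewrite /gamma big_seq; apply: sumr_ge0.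
have d1 : 1 <= d%:R :> R by rewrite ler1n (leq_ltn_trans _ (ltn_ord j)).
have n0 : 0 <= (mdeg n)%:R :> R by exact: ler0n.
rewrite /riesz_scale exprVn sqr_sqrtr; last by lra.
by apply/andP; split; [rewrite invr_ge0|rewrite lef_pV2 ?posrE]; lra.
Qed.

(** The operator Dj lowers degrees by one, so that the normalization of the
    Hermite function of degree mdeg n leaves a factor 2. *)
Lemma norm_delta C n :
  fischer_form Rp k (Dj (phi n)) (Dj (phi n)) <= C ^+ 2 * ((mdeg n)%:R + 1) ->
  inner_product mu (weighted_delta n) (weighted_delta n) <= 2 * C ^+ 2.
Proof.
move=> FC; have := dunkl_op_homog k Rp0 (delta_mx 0 j) (phi_homog n).
have [th /andP[th0 th1]] := hermite_coeff_sqr n.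
have /andP[s0 s1] := riesz_scale_sqr n.
case Dn : (mdeg n) => [|n'] thE.
  move=> D0; rewrite (_ : weighted_delta n = gauss_mpoly 0 0); last first.
    apply/funext => t; rewrite /weighted_delta /gauss_mpoly D0.
    by rewrite -(scale0r 0) exp_lapZ// !mpoly_funZ !mul0r mulr0 mul0r.
  by rewrite inner_product_gauss_mpoly !mul0r mulr_ge0// sqr_ge0.
move=> Dh; rewrite (inner_product_exp_lap _ _ _ Dh).
set F := fischer_form _ _ _ _ in FC *.
rewrite [leLHS](_ : _ = 2 * th * (riesz_scale n ^+ 2 * F)); last first.
  transitivity (riesz_scale n ^+ 2 * (2^-1 ^+ n' * (hermite_coeff n ^+ 2 * gauss_const Rp k) * F)).
    by ring.
  rewrite thE (exprS 2 n').
  by rewrite exprVn; field; rewrite expf_neq0.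
have sF : riesz_scale n ^+ 2 * F <= C ^+ 2.
  apply: (@le_trans _ _ (riesz_scale n ^+ 2 * (C ^+ 2 * ((mdeg n)%:R + 1)))).
    exact: ler_wpM2l.
  have n0 : 0 < (mdeg n)%:R + 1 :> R by rewrite ltr_wpDl.
  rewrite mulrCA ler_piMr ?sqr_ge0//.
  by rewrite -(ler_pdivlMr _ _ n0) mul1r.
have C0 := sqr_ge0 C.
rewrite -mulrA ler_pM2l//; apply: (@le_trans _ _ (th * C ^+ 2)).
  exact: ler_wpM2l.
by rewrite ler_piMl.
Qed.

End HermiteSystem.

(** * Complex functions and the theorem *)

Lemma poweR_half_le {R : realType} (x : \bar R) (e : R) : 0 <= e -> (0 <= x)%E ->
  (poweR x 2^-1 <= e%:E)%E = (x <= (e ^+ 2)%:E)%E.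
Proof.
move=> e0; case: x => [r||]//.
  rewrite !lee_fin /= => r0; rewrite powR12_sqrt// ?lee_fin.
  rewrite -(@ler_pXn2r _ 2%N) ?nnegrE ?sqrtr_ge0//.
  by rewrite sqr_sqrtr.
by move=> _ /=; rewrite gt_eqF ?invr_gt0//.
Qed.

Lemma poweR_half_lty {R : realType} (x : \bar R) : (0 <= x)%E ->
  (poweR x 2^-1 < +oo)%E = (x < +oo)%E.
Proof.
case: x => [r||]//; first by rewrite /= !ltry.
by move=> _ /=; rewrite gt_eqF ?invr_gt0//.
Qed.

Section ComplexFunctions.
Context {R : realType} {d : nat}.
Variables (Rp : {fset 'rV[R]_d}) (k : 'rV[R]_d -> R).
Hypothesis k_ge0 : forall b, b \in Rp -> 0 <= k b.
Implicit Types (f g : 'rV[R]_d -> R[i]) (t : d.-tuple R).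

Let mu : {measure set (d.-tuple R) -> \bar R} := @lebesgue_tuple R d.
Local Notation W := (sqrt_weight Rp k).

(** Real and imaginary parts are treated separately, since the Hermite functions
    are real; multiplication by the square root of the weight leads to the
    Lebesgue measure. *)
Definition weighted_Re f t : R := complex.Re (f (rV_of_tuple t)) * W t.
Definition weighted_Im f t : R := complex.Im (f (rV_of_tuple t)) * W t.

Lemma measurable_weighted_Re f : measurable_rV (fun x => complex.Re (f x)) ->
  measurable_fun setT (weighted_Re f).
Proof. by move=> mf; exact: measurable_funM mf (measurable_sqrt_weight k_ge0). Qed.

Lemma measurable_weighted_Im f : measurable_rV (fun x => complex.Im (f x)) ->
  measurable_fun setT (weighted_Im f).
Proof. by move=> mf; exact: measurable_funM mf (measurable_sqrt_weight k_ge0). Qed.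

Lemma norm2E f : measurable_fun setT (weighted_Re f) ->
  measurable_fun setT (weighted_Im f) ->
  norm2 Rp k f =
  poweR (sqr_integral mu (weighted_Re f) + sqr_integral mu (weighted_Im f))%E 2^-1.
Proof.
move=> mr mi; congr (poweR _ _); rewrite /sqr_integral -ge0_integralD//; first last.
- by apply/measurable_EFinP; exact: measurable_funX.
- by move=> t _; rewrite lee_fin sqr_ge0.
- by apply/measurable_EFinP; exact: measurable_funX.
- by move=> t _; rewrite lee_fin sqr_ge0.
apply: eq_integral => t _; rewrite -EFinD; congr EFin.
rewrite /weighted_Re /weighted_Im !exprMn sqrt_weight_sqr -mulrDl.
by case: (f _) => a b /=; rewrite sqr_sqrtr// addr_ge0 ?sqr_ge0.
Qed.

Lemma norm2_le f e : 0 <= e -> measurable_fun setT (weighted_Re f) ->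
  measurable_fun setT (weighted_Im f) ->
  (norm2 Rp k f <= e%:E)%E =
  (sqr_integral mu (weighted_Re f) + sqr_integral mu (weighted_Im f) <=
   (e ^+ 2)%:E)%E.
Proof.
move=> e0 mr mi; rewrite norm2E// poweR_half_le//.
by apply: adde_ge0; exact: sqr_integral_ge0.
Qed.

Lemma in_L2E f : in_L2 Rp k f <->
  [/\ measurable_rV (fun x => complex.Re (f x)),
      measurable_rV (fun x => complex.Im (f x)),
      (sqr_integral mu (weighted_Re f) < +oo)%E &
      (sqr_integral mu (weighted_Im f) < +oo)%E].
Proof.
have Q0 := @sqr_integral_ge0 _ _ _ mu.
have m := measurable_weighted_Re; have m' := measurable_weighted_Im.
split=> [[mr mi]|[mr mi Qr Qi]].
  rewrite norm2E; [|exact: m|exact: m'].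
  rewrite (poweR_half_lty (adde_ge0 (Q0 _) (Q0 _))) => Qf; split=> //.
    by apply: le_lt_trans Qf; exact: leeDl _ (Q0 _).
  by apply: le_lt_trans Qf; exact: leeDr _ (Q0 _).
split=> //; rewrite norm2E; [|exact: m|exact: m'].
by rewrite (poweR_half_lty (adde_ge0 (Q0 _) (Q0 _))) lte_add_pinfty.
Qed.

Lemma in_L2_sqr_integrable f : in_L2 Rp k f ->
  sqr_integrable mu (weighted_Re f) /\ sqr_integrable mu (weighted_Im f).
Proof.
move=> /in_L2E[mr mi Qr Qi]; split; split=> //.
- exact: measurable_weighted_Re.
- exact: measurable_weighted_Im.
Qed.

(** Where the weight vanishes, division by its square root gives 0. *)
Definition unweighted (F : d.-tuple R -> R) (x : 'rV[R]_d) : R :=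
  F [tuple x 0 i | i < d] * (W [tuple x 0 i | i < d])^-1.

Lemma rV_of_tupleK t : [tuple rV_of_tuple t 0 i | i < d] = t.
Proof. by apply: eq_from_tnth => i; rewrite tnth_mktuple mxE. Qed.

Lemma measurable_unweighted F : measurable_fun setT F ->
  measurable_rV (unweighted F).
Proof.
move=> mF; rewrite /measurable_rV /unweighted.
under eq_fun do rewrite rV_of_tupleK /sqrt_weight -powRN.
apply: measurable_funM => //; apply: (measurableT_comp (measurable_powR _)).
exact: rV_measurable_weight.
Qed.

Lemma unweightedK F t : unweighted F (rV_of_tuple t) * W t =
  if W t == 0 then 0 else F t.
Proof.
by rewrite /unweighted rV_of_tupleK; case: eqP => [->|/eqP W0]; rewrite ?mulr0// mulfVK.
Qed.

End ComplexFunctions.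

Lemma mpoly_fun0 {R : realType} {d : nat} x : @mpoly_fun R d 0 x = 0.
Proof. by rewrite /mpoly_fun meval0. Qed.

Lemma fischer_form0l {R : realType} {d : nat} (Rp : {fset 'rV[R]_d})
    (k : 'rV[R]_d -> R) q : fischer_form Rp k 0 q = 0.
Proof. by rewrite /fischer_form msupp0 big_nil mpoly_fun0. Qed.

Lemma fischer_form0r {R : realType} {d : nat} (Rp : {fset 'rV[R]_d})
    (k : 'rV[R]_d -> R) p : (forall b, b \in Rp -> b != 0) ->
  fischer_form Rp k p 0 = 0.
Proof.
move=> Rp0; rewrite /fischer_form big1 ?mpoly_fun0// => m _.
rewrite /dunkl_op_monomial (_ : foldr _ _ _ = 0) ?scaler0//.
elim: (enum _) => //= i s ->.
by elim: (m i) => //= n ->; exact: dunkl_op0.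
Qed.

Section RieszTransform.
Local Open Scope complex_scope.
Context {R : realType} {d : nat}.
Variables (Rp : {fset 'rV[R]_d}) (k : 'rV[R]_d -> R).
Hypothesis Rp0 : forall b, b \in Rp -> b != 0.
Hypothesis k_ge0 : forall b, b \in Rp -> 0 <= k b.
Hypothesis Rp_inv : reflection_invariant Rp k.
Variable phi : multinom d -> mpoly d R.
Hypothesis phi_homog : forall n, phi n \is ishomog1 (mdeg n) mdeg.
Hypothesis phi_orthonormal :
  forall n m, fischer_form Rp k (phi n) (phi m) = (n == m)%:R.
Variable j : 'I_d.
Local Notation Dj := (dunkl_op Rp k (delta_mx 0 j)).
Hypothesis dunkl_orthogonal :
  forall n m, n != m -> fischer_form Rp k (Dj (phi n)) (Dj (phi m)) = 0.
Variable C : R.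
Hypothesis dunkl_norm : forall n,
  fischer_form Rp k (Dj (phi n)) (Dj (phi n)) <= C ^+ 2 * ((mdeg n)%:R + 1).
Implicit Types (f g : 'rV[R]_d -> R[i]) (t : d.-tuple R) (A : {fset multinom d}).

Let mu : {measure set (d.-tuple R) -> \bar R} := @lebesgue_tuple R d.
Local Notation W := (sqrt_weight Rp k).
Local Notation Q := (sqr_integral mu).
Local Notation e := (weighted_hermite Rp k phi).
Local Notation v := (weighted_delta Rp k phi j).
Local Notation image F A :=
  (fun t => \sum_(n <- A) inner_product mu F (e n) * v n t).
Local Notation remainder f g A :=
  (fun x => g x - \sum_(n <- A) riesz_term Rp k phi j f n x).

Lemma inner_hermite f n : inner Rp k f (fun y => (hermite_fun Rp k phi n y)%:C) =
  inner_product mu (weighted_Re Rp k f) (e n) +i*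
  inner_product mu (weighted_Im Rp k f) (e n).
Proof.
congr (_ +i* _); congr fine; apply: eq_integral => t _; congr EFin;
rewrite weighted_hermiteE// /weighted_Re /weighted_Im -sqrt_weight_sqr;
by case: (f _) => a b /=; ring.
Qed.

Lemma riesz_termE f n t :
  riesz_term Rp k phi j f n (rV_of_tuple t) * (W t)%:C =
  (inner_product mu (weighted_Re Rp k f) (e n) * v n t) +i*
  (inner_product mu (weighted_Im Rp k f) (e n) * v n t).
Proof.
rewrite /riesz_term inner_hermite weighted_deltaE// /riesz_scale.
by apply/eqP; rewrite eq_complex /=; apply/andP; split; apply/eqP; ring.
Qed.

Lemma riesz_remainderE f g A t :
  (g (rV_of_tuple t) - \sum_(n <- A) riesz_term Rp k phi j f n (rV_of_tuple t)) *
    (W t)%:C =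
  (weighted_Re Rp k g t - image (weighted_Re Rp k f) A t) +i*
  (weighted_Im Rp k g t - image (weighted_Im Rp k f) A t).
Proof.
rewrite mulrBl mulr_suml; under eq_bigr do rewrite riesz_termE.
rewrite (_ : \sum_(n <- A) _ = image (weighted_Re Rp k f) A t +i*
    image (weighted_Im Rp k f) A t).
  by rewrite /weighted_Re /weighted_Im; case: (g _) => a b; apply/eqP;
    rewrite eq_complex /=; apply/andP; split; apply/eqP; ring.
by elim/big_rec3 : _ => // n z a b _ ->.
Qed.

Lemma weighted_Re_remainder f g A t :
  weighted_Re Rp k (remainder f g A) t =
  weighted_Re Rp k g t - image (weighted_Re Rp k f) A t.
Proof.
rewrite [LHS](_ : _ = complex.Re ((g (rV_of_tuple t) -
    \sum_(n <- A) riesz_term Rp k phi j f n (rV_of_tuple t)) * (W t)%:C)).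
  by rewrite riesz_remainderE.
by rewrite /weighted_Re; case: (_ - _) => a b /=; ring.
Qed.

Lemma weighted_Im_remainder f g A t :
  weighted_Im Rp k (remainder f g A) t =
  weighted_Im Rp k g t - image (weighted_Im Rp k f) A t.
Proof.
rewrite [LHS](_ : _ = complex.Im ((g (rV_of_tuple t) -
    \sum_(n <- A) riesz_term Rp k phi j f n (rV_of_tuple t)) * (W t)%:C)).
  by rewrite riesz_remainderE.
by rewrite /weighted_Im; case: (_ - _) => a b /=; ring.
Qed.

Let K := 2 * C ^+ 2.

Let transform F : sqr_integrable mu F ->
  (forall A, (Q (image F A) <= K%:E * Q F)%E) /\
  exists G : d.-tuple R -> R, measurable_fun setT G /\
    forall eps : R, 0 < eps -> exists A0 : {fset multinom d}, forall A, (A0 `<=` A)%fset ->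
      (Q (fun t => (G t - image F A t)%R) <= eps%:E)%E.
Proof.
apply: orthogonal_transform.
- by move=> n; exact: sqr_integrable_gauss_mpoly.
- by move=> n m; exact: inner_product_hermite.
- by move=> n; exact: norm_hermite.
- by move=> n; exact: sqr_integrable_gauss_mpoly.
- by move=> n m nm; apply: inner_product_delta => //; exact: dunkl_orthogonal.
- by move=> n; exact: norm_delta.
- by rewrite mulr_ge0// sqr_ge0.
Qed.

Let measurable_image F A : measurable_fun setT (image F A).
Proof.
apply: measurable_sum => n; apply: measurable_funM => //.
by have [] := sqr_integrable_gauss_mpoly k_ge0 (riesz_scale Rp k n * hermite_coeff Rp k n)
  (exp_lap Rp k (Dj (phi n))).
Qed.

Let measurable_Re_remainder f g A : measurable_fun setT (weighted_Re Rp k g) ->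
  measurable_fun setT
    (weighted_Re Rp k (remainder f g A)).
Proof.
move=> mg; rewrite (funext (weighted_Re_remainder f g A)).
exact: measurable_funB.
Qed.

Let measurable_Im_remainder f g A : measurable_fun setT (weighted_Im Rp k g) ->
  measurable_fun setT
    (weighted_Im Rp k (remainder f g A)).
Proof.
move=> mg; rewrite (funext (weighted_Im_remainder f g A)).
exact: measurable_funB.
Qed.

Let Re_remainder f g A :
  Q (weighted_Re Rp k (remainder f g A)) =
  Q (fun t => weighted_Re Rp k g t - image (weighted_Re Rp k f) A t).
Proof. by apply: eq_integral => t _; rewrite weighted_Re_remainder. Qed.

Let Im_remainder f g A :
  Q (weighted_Im Rp k (remainder f g A)) =
  Q (fun t => weighted_Im Rp k g t - image (weighted_Im Rp k f) A t).
Proof. by apply: eq_integral => t _; rewrite weighted_Im_remainder. Qed.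

(** The images vanish where the weight does, so that dividing by the square
    root of the weight loses nothing. *)
Let unweighted_remainder F G A : measurable_fun setT G ->
  (Q (fun t => (unweighted Rp k G (rV_of_tuple t) * W t - image F A t)%R) <=
   Q (fun t => (G t - image F A t)%R))%E.
Proof.
move=> mG; apply: ge0_le_integral => //.
- by move=> t _; rewrite lee_fin sqr_ge0.
- apply/measurable_EFinP; apply: measurable_funX; apply: measurable_funB => //.
  apply: measurable_funM; last exact: measurable_sqrt_weight.
  exact: measurable_unweighted.
- apply/measurable_EFinP; apply: measurable_funX; exact: measurable_funB.
- move=> t _; rewrite lee_fin unweightedK; case: eqP => // W0.
  rewrite (_ : image F A t = 0) ?subr0 ?expr0n ?sqr_ge0//.
  by apply: big1 => n _; rewrite weighted_deltaE// W0 !mulr0.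
Qed.

(** This bounds both the limit constructed in riesz_exists and any other one. *)
Let remainder_bound F G A : sqr_integrable mu F -> measurable_fun setT G ->
  (Q G <= 2%:E * Q (fun t => (G t - image F A t)%R) + 2%:E * (K%:E * Q F))%E.
Proof.
move=> sF mG; have [QF _] := transform sF.
apply: (@le_trans _ _
  (2%:E * Q (fun t => (G t - image F A t)%R) + 2%:E * Q (image F A))%E).
  apply: sqr_integral_parallelogram => //; first exact: measurable_funB.
  by move=> t; rewrite subrK.
by rewrite leeD2l// lee_wpmul2l.
Qed.

Lemma riesz_exists f : in_L2 Rp k f -> exists g, is_riesz Rp k phi j f g.
Proof.
move=> /(in_L2_sqr_integrable k_ge0)[sr si].
have [_ [Gr [mGr cr]]] := transform sr; have [_ [Gi [mGi ci]]] := transform si.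
pose g x := unweighted Rp k Gr x +i* unweighted Rp k Gi x.
have mr : measurable_fun setT (weighted_Re Rp k g).
  by apply: measurable_weighted_Re => //; exact: measurable_unweighted.
have mi : measurable_fun setT (weighted_Im Rp k g).
  by apply: measurable_weighted_Im => //; exact: measurable_unweighted.
(* One remainder of norm at most 1 already shows that the limit is in L^2. *)
have fin (F G H : d.-tuple R -> R) : sqr_integrable mu F -> measurable_fun setT H ->
    (forall eps : R, 0 < eps -> exists A0 : {fset multinom d}, forall A, (A0 `<=` A)%fset ->
      (Q (fun t => (G t - image F A t)%R) <= eps%:E)%E) ->
    (forall A, (Q (fun t => (H t - image F A t)%R) <=
                Q (fun t => (G t - image F A t)%R))%E) -> (Q H < +oo)%E.
  move=> sF mH /(_ 1 ltr01)[A /(_ A (fsubset_refl A)) GA] HG.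
  apply: le_lt_trans (remainder_bound A sF mH) _.
  have lt1 : (Q (fun t => (H t - image F A t)%R) < +oo)%E.
    by apply: le_lt_trans (HG A) (le_lt_trans GA _); rewrite ltry.
  rewrite (sqr_integrableE sF) lte_add_pinfty ?lte_mul_pinfty ?ltry//.
  by rewrite lee_fin mulr_ge0// sqr_ge0.
exists g; split.
  apply/in_L2E => //; split.
  - exact: measurable_unweighted.
  - exact: measurable_unweighted.
  - by apply: (fin _ _ _ sr mr cr) => A; exact: unweighted_remainder.
  - by apply: (fin _ _ _ si mi ci) => A; exact: unweighted_remainder.
move=> P [eps /= eps0 epsP].
have h0 : 0 < (eps / 2) ^+ 2 / 2 by rewrite divr_gt0// exprn_gt0// divr_gt0.
have [Ar Arh] := cr _ h0; have [Ai Aih] := ci _ h0.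
exists (Ar `|` Ai)%fset => // A /=; rewrite fsubUset => /andP[ArA AiA].
have : (norm2 Rp k (remainder f g A) <=
    (eps / 2)%:E)%E.
  rewrite norm2_le ?(ltW (divr_gt0 eps0 _))//; [|exact: measurable_Re_remainder
    |exact: measurable_Im_remainder].
  rewrite Re_remainder Im_remainder.
  apply: (@le_trans _ _ (((eps / 2) ^+ 2 / 2)%:E + ((eps / 2) ^+ 2 / 2)%:E)%E).
    apply: leeD.
      by apply: le_trans (Arh A ArA); exact: unweighted_remainder.
    by apply: le_trans (Aih A AiA); exact: unweighted_remainder.
  by rewrite -EFinD lee_fin; lra.
have : (0 <= norm2 Rp k (remainder f g A))%E.
  exact: poweR_ge0.
case: (norm2 _ _ _) => [r||]//; rewrite !lee_fin => r0 re; apply: epsP => /=.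
by rewrite sub0r normrN ger0_norm//; lra.
Qed.

Lemma riesz_bounded f g : in_L2 Rp k f -> is_riesz Rp k phi j f g ->
  (norm2 Rp k g <= (Num.sqrt (2 * K))%:E * norm2 Rp k f)%E.
Proof.
move=> /(in_L2_sqr_integrable k_ge0)[sr si].
move=> [/(in_L2_sqr_integrable k_ge0)[[mr _] [mi _]] cvg0].
pose N := inner_product mu (weighted_Re Rp k f) (weighted_Re Rp k f) +
  inner_product mu (weighted_Im Rp k f) (weighted_Im Rp k f).
have NE : (Q (weighted_Re Rp k f) + Q (weighted_Im Rp k f))%E = N%:E.
  by rewrite !sqr_integrableE.
have N0 : 0 <= N by rewrite -lee_fin -NE adde_ge0// sqr_integral_ge0.
have K0 : 0 <= K by rewrite mulr_ge0// sqr_ge0.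
have -> : norm2 Rp k f = (Num.sqrt N)%:E.
  by rewrite norm2E ?NE; [rewrite /= powR12_sqrt|case: sr|case: si].
have K2 : 0 <= 2 * K by exact: mulr_ge0 (ler0n _ _) K0.
rewrite -EFinM -(sqrtrM _ K2) norm2_le ?sqrtr_ge0//.
rewrite sqr_sqrtr ?(mulr_ge0 K2 N0)//; apply/lee_addgt0Pr => eps eps0.
have s0 : 0 < Num.sqrt (eps / 2) by rewrite sqrtr_gt0 divr_gt0.
have [A _ /(_ A (fsubset_refl A))] : totally [set A : {fset multinom d} |
    (norm2 Rp k (remainder f g A) <= (Num.sqrt (eps / 2))%:E)%E].
  apply: (cvg0 [set y | (y <= (Num.sqrt (eps / 2))%:E)%E]); exists (Num.sqrt (eps / 2)) => //= r.
  by rewrite /ball_/= sub0r normrN lee_fin => /ltW; apply: le_trans; exact: ler_norm.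
rewrite /= norm2_le ?sqrtr_ge0//; [|exact: measurable_Re_remainder
    |exact: measurable_Im_remainder].
rewrite Re_remainder Im_remainder sqr_sqrtr ?(ltW (divr_gt0 eps0 _))// => rem.
apply: le_trans (leeD (remainder_bound A sr mr) (remainder_bound A si mi)) _.
have Q0 := @sqr_integral_ge0 _ _ _ mu.
have QD F G := adde_ge0 (Q0 F) (Q0 G).
rewrite addeACA -!ge0_muleDr ?mule_ge0 ?QD ?Q0 ?lee_fin// NE.
apply: (@le_trans _ _ (2 * (eps / 2 + K * N))%:E).
  rewrite [leRHS](EFinM 2); apply: lee_wpmul2l => //.
  exact: (leeD rem (lexx (K%:E * N%:E)%E)).
by rewrite -EFinD lee_fin; lra.
Qed.

End RieszTransform.

Theorem proposition2p1 (R : realType) (d : nat)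
    (G : {fset 'M[R]_d}) (Phi Phip : {fset 'rV[R]_d}) (k : 'rV[R]_d -> R)
    (phi : multinom d -> mpoly d R)
    (hG : finite_reflection_group G)
    (hPhi : root_system_of G Phi)
    (hPhip : positive_subsystem Phi Phip)
    (hk : multiplicity G Phi k)
    (hbasis : orthonormal_basis Phip k phi)
    (hdeg : forall n, phi n \is ishomog1 (mdeg n) mdeg)
    (horth : forall (j : 'I_d) (n m : multinom d),
       Nhat Phip k phi j n -> Nhat Phip k phi j m -> n != m ->
       fischer Phip k (dunklP Phip k j (phi n)) (dunklP Phip k j (phi m)) = 0)
    (hnorm : forall j : 'I_d, exists C : R, forall n : multinom d,
       Nhat Phip k phi j n ->
       fischer_norm Phip k (dunklP Phip k j (phi n)) <=
         C * Num.sqrt ((mdeg n)%:R + 1)) :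
  forall j : 'I_d, bounded_on_L2 Phip k (is_riesz Phip k phi j).
Proof.
move=> j.
have Rp0 b : b \in Phip -> b != 0.
  by move=> /(pos_root_root hPhip); exact: (root_neq0 hPhi).
have k0 b : b \in Phip -> 0 <= k b.
  by move=> /(pos_root_root hPhip); case: hk => + _; exact.
have Rp_inv := pos_roots_reflection_invariant hPhi hPhip hk.
have on n m : fischer_form Phip k (phi n) (phi m) = (n == m)%:R.
  by rewrite -fischerE//; case: hbasis.
have oD n m : n != m -> fischer_form Phip k (dunkl_op Phip k (delta_mx 0 j) (phi n))
    (dunkl_op Phip k (delta_mx 0 j) (phi m)) = 0.
  move=> nm; rewrite -!dunklPE// -fischerE//.
  case: (eqVneq (dunklP Phip k j (phi n)) 0) => [->|Dn].
    by rewrite fischerE// fischer_form0l.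
  case: (eqVneq (dunklP Phip k j (phi m)) 0) => [->|Dm].
    by rewrite fischerE// fischer_form0r.
  exact: horth.
have [C normC] := hnorm j.
have nD n : fischer_form Phip k (dunkl_op Phip k (delta_mx 0 j) (phi n))
    (dunkl_op Phip k (delta_mx 0 j) (phi n)) <= C ^+ 2 * ((mdeg n)%:R + 1).
  rewrite -!dunklPE// -fischerE//.
  have n0 : 0 <= (mdeg n)%:R + 1 :> R by rewrite addr_ge0.
  case: (eqVneq (dunklP Phip k j (phi n)) 0) => [->|Dn].
    by rewrite fischerE// fischer_form0r// mulr_ge0// sqr_ge0.
  have [F0|F0] := leP (fischer Phip k (dunklP Phip k j (phi n)) (dunklP Phip k j (phi n))) 0.
    by rewrite (le_trans F0)// mulr_ge0// sqr_ge0.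
  have := normC n Dn; rewrite /fischer_norm => leC.
  rewrite -(sqr_sqrtr (ltW F0)) -(sqr_sqrtr n0) -exprMn ler_pXn2r// ?nnegrE ?sqrtr_ge0//.
  by apply: le_trans leC; exact: sqrtr_ge0.
split; first by move=> f; exact: riesz_exists.
exists (Num.sqrt (2 * (2 * C ^+ 2))) => f g; exact: riesz_bounded.
Qed.
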